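(* Let $n_0=18$ and $n_1=41$. Let $\varphi:\mathcal P_5\to\mathcal P_5$ be the map $u\mapsto x_1x_2x_3x_4x_5\,u^2$, and let $\widetilde{\xi}_{n_0}\in(\mathcal P_5)_{18}$ and $\widetilde{\xi}_{n_1}\in(\mathcal P_5)_{41}$ be the explicit polynomials listed in the context. Then $$(Q^{\otimes 5}_{n_0})^{G(5)}=\langle[\widetilde{\xi}_{n_0}]\rangle\quad\text{and}\quad (Q^{\otimes 5}_{n_1})^{G(5)}=\langle[\varphi(\widetilde{\xi}_{n_0})+\widetilde{\xi}_{n_1}]\rangle,$$ where $\langle\cdot\rangle$ denotes the $\mathbb F_2$-linear span.
   Context: $\mathscr A$ is the mod-2 Steenrod algebra and $\overline{\mathscr A}$ its positive-degree part. $\mathcal P_5=\mathbb F_2[x_1,\ldots,x_5]$ with $|x_i|=1$ is an $\mathscr A$-module via $Sq^k(x_j^n)=\binom nk x_j^{n+k}$ and the Cartan formula. $(\mathcal P_5)_n$ is the subspace of homogeneous polynomials of degree $n$, $Q^{\otimes 5}_n=(\mathcal P_5)_n/((\mathcal P_5)_n\cap\overline{\mathscr A}\mathcal P_5)$, and $[f]$ is the class of $f$. $G(5)=GL(5,\mathbb F_2)$ acts on $\mathcal P_5$ by linear substitution of the variables; this commutes with the $\mathscr A$-action and hence induces an action on $Q^{\otimes 5}_n$, whose invariants are $(Q^{\otimes 5}_n)^{G(5)}$. In the lists below, a tuple $(a,b,c,d,e)$ stands for the monomial $x_1^ax_2^bx_3^cx_4^dx_5^e$, and the polynomial is the sum of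 all the listed monomials. $\widetilde{\xi}_{n_0}$ is the sum of: $(3,5,8,2,0)$, $(3,1,12,2,0)$, $(1,3,12,2,0)$, $(1,1,14,2,0)$, $(3,5,2,8,0)$, $(1,1,6,10,0)$, $(3,1,2,12,0)$, $(1,3,2,12,0)$, $(1,1,2,14,0)$, $(3,5,8,1,1)$, $(3,1,12,1,1)$, $(1,3,12,1,1)$, $(1,1,14,1,1)$, $(3,5,1,8,1)$, $(3,1,1,12,1)$, $(1,3,1,12,1)$, $(1,1,1,14,1)$, $(3,5,8,0,2)$, $(3,1,12,0,2)$, $(1,3,12,0,2)$, $(1,1,14,0,2)$, $(3,5,0,8,2)$, $(3,0,5,8,2)$, $(1,2,5,8,2)$, $(0,3,5,8,2)$, $(1,2,4,9,2)$, $(3,1,0,12,2)$, $(1,3,0,12,2)$, $(3,0,1,12,2)$, $(0,3,1,12,2)$, $(1,0,3,12,2)$, $(0,1,3,12,2)$, $(1,1,0,14,2)$, $(1,0,1,14,2)$, $(0,1,1,14,2)$, $(3,5,2,4,4)$, $(3,5,2,0,8)$, $(3,5,1,1,8)$, $(3,5,0,2,8)$, $(3,0,5,2,8)$, $(1,2,5,2,8)$, $(0,3,5,2,8)$, $(1,1,6,2,8)$, $(3,1,2,4,8)$, $(1,3,2,4,8)$, $(1,2,1,6,8)$, $(1,1,6,0,10)$, $(1,2,4,1,10)$, $(1,2,1,4,10)$, $(1,1,2,4,10)$, $(1,1,0,6,10)$, $(1,0,1,6,10)$, $(0,1,1,6,10)$, $(3,1,2,0,12)$, $(1,3,2,0,12)$,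 $(3,1,1,1,12)$, $(1,3,1,1,12)$, $(3,1,0,2,12)$, $(1,3,0,2,12)$, $(3,0,1,2,12)$, $(0,3,1,2,12)$, $(1,0,3,2,12)$, $(0,1,3,2,12)$, $(1,1,2,0,14)$, $(1,1,1,1,14)$, $(1,1,0,2,14)$, $(1,0,1,2,14)$, $(0,1,1,2,14)$. $\widetilde{\xi}_{n_1}$ is the sum of: $(15,19,7,0,0)$, $(7,27,7,0,0)$, $(15,7,19,0,0)$, $(7,7,27,0,0)$, $(15,19,1,6,0)$, $(7,27,1,6,0)$, $(15,3,17,6,0)$, $(7,11,17,6,0)$, $(3,15,17,6,0)$, $(15,1,19,6,0)$, $(3,13,19,6,0)$, $(1,15,19,6,0)$, $(7,1,27,6,0)$, $(3,5,27,6,0)$, $(1,7,27,6,0)$, $(3,3,29,6,0)$, $(15,19,0,7,0)$, $(7,27,0,7,0)$, $(15,1,18,7,0)$, $(3,13,18,7,0)$, $(1,15,18,7,0)$, $(15,0,19,7,0)$, $(1,14,19,7,0)$, $(0,15,19,7,0)$, $(7,1,26,7,0)$, $(3,5,26,7,0)$, $(1,7,26,7,0)$, $(7,0,27,7,0)$, $(1,6,27,7,0)$, $(0,7,27,7,0)$, $(7,7,11,16,0)$, $(15,7,1,18,0)$, $(15,3,5,18,0)$, $(7,11,5,18,0)$, $(3,15,5,18,0)$, $(15,1,7,18,0)$, $(3,13,7,18,0)$, $(1,15,7,18,0)$, $(15,7,0,19,0)$, $(15,1,6,19,0)$, $(3,13,6,19,0)$, $(1,15,6,19,0)$, $(15,0,7,19,0)$,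 $(1,14,7,19,0)$, $(0,15,7,19,0)$, $(7,7,8,19,0)$, $(7,1,14,19,0)$, $(3,5,14,19,0)$, $(1,7,14,19,0)$, $(7,1,11,22,0)$, $(3,5,11,22,0)$, $(1,7,11,22,0)$, $(7,7,1,26,0)$, $(7,1,7,26,0)$, $(3,5,7,26,0)$, $(1,7,7,26,0)$, $(7,7,0,27,0)$, $(7,1,6,27,0)$, $(3,5,6,27,0)$, $(1,7,6,27,0)$, $(7,0,7,27,0)$, $(1,6,7,27,0)$, $(0,7,7,27,0)$, $(3,3,5,30,0)$, $(7,11,17,4,2)$, $(7,3,25,4,2)$, $(3,7,25,4,2)$, $(3,3,29,4,2)$, $(7,11,16,5,2)$, $(7,3,24,5,2)$, $(3,7,24,5,2)$, $(3,3,28,5,2)$, $(15,3,5,16,2)$, $(7,11,5,16,2)$, $(3,15,5,16,2)$, $(3,5,15,16,2)$, $(15,3,1,20,2)$, $(7,11,1,20,2)$, $(3,15,1,20,2)$, $(15,1,3,20,2)$, $(1,15,3,20,2)$, $(3,3,13,20,2)$, $(3,1,15,20,2)$, $(1,3,15,20,2)$, $(3,13,2,21,2)$, $(3,3,12,21,2)$, $(15,1,1,22,2)$, $(3,13,1,22,2)$, $(1,15,1,22,2)$, $(7,1,9,22,2)$, $(3,1,13,22,2)$, $(1,1,15,22,2)$, $(3,5,8,23,2)$, $(3,1,12,23,2)$, $(1,3,12,23,2)$, $(1,1,14,23,2)$, $(7,1,7,24,2)$, $(3,5,7,24,2)$, $(3,7,4,25,2)$, $(3,5,6,25,2)$, $(3,4,7,25,2)$,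 $(1,6,7,25,2)$, $(3,7,1,28,2)$, $(7,1,3,28,2)$, $(1,7,3,28,2)$, $(3,1,7,28,2)$, $(1,3,7,28,2)$, $(3,5,2,29,2)$, $(3,4,3,29,2)$, $(1,6,3,29,2)$, $(3,3,4,29,2)$, $(3,1,6,29,2)$, $(7,1,1,30,2)$, $(3,5,1,30,2)$, $(1,7,1,30,2)$, $(3,1,5,30,2)$, $(1,3,5,30,2)$, $(1,3,28,6,3)$, $(1,2,29,6,3)$, $(7,7,8,16,3)$, $(3,1,14,20,3)$, $(3,1,12,22,3)$, $(7,1,6,24,3)$, $(3,5,6,24,3)$, $(1,7,2,28,3)$, $(1,3,6,28,3)$, $(1,3,4,30,3)$, $(1,2,5,30,3)$, $(1,1,6,30,3)$, $(15,19,1,2,4)$, $(7,27,1,2,4)$, $(15,3,17,2,4)$, $(7,11,17,2,4)$, $(3,15,17,2,4)$, $(15,1,19,2,4)$, $(3,13,19,2,4)$, $(1,15,19,2,4)$, $(7,1,27,2,4)$, $(3,5,27,2,4)$, $(1,7,27,2,4)$, $(3,3,29,2,4)$, $(15,3,1,18,4)$, $(3,15,1,18,4)$, $(15,1,3,18,4)$, $(3,13,3,18,4)$, $(1,15,3,18,4)$, $(7,1,11,18,4)$, $(3,5,11,18,4)$, $(1,7,11,18,4)$, $(3,3,13,18,4)$, $(3,1,15,18,4)$, $(1,3,15,18,4)$, $(15,1,2,19,4)$, $(3,13,2,19,4)$, $(1,15,2,19,4)$, $(3,1,14,19,4)$, $(1,3,14,19,4)$, $(1,2,15,19,4)$, $(7,3,1,26,4)$,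 $(3,7,1,26,4)$, $(7,1,3,26,4)$, $(3,5,3,26,4)$, $(1,3,7,26,4)$, $(7,1,2,27,4)$, $(3,5,2,27,4)$, $(1,7,2,27,4)$, $(3,3,4,27,4)$, $(3,1,6,27,4)$, $(1,3,6,27,4)$, $(1,2,7,27,4)$, $(3,3,3,28,4)$, $(3,1,3,30,4)$, $(15,19,1,0,6)$, $(7,27,1,0,6)$, $(15,3,17,0,6)$, $(7,11,17,0,6)$, $(3,15,17,0,6)$, $(15,1,19,0,6)$, $(3,13,19,0,6)$, $(1,15,19,0,6)$, $(7,1,27,0,6)$, $(3,5,27,0,6)$, $(1,7,27,0,6)$, $(3,3,29,0,6)$, $(15,19,0,1,6)$, $(7,27,0,1,6)$, $(7,11,16,1,6)$, $(15,1,18,1,6)$, $(3,13,18,1,6)$, $(1,15,18,1,6)$, $(15,0,19,1,6)$, $(1,14,19,1,6)$, $(0,15,19,1,6)$, $(7,3,24,1,6)$, $(3,7,24,1,6)$, $(7,1,26,1,6)$, $(3,5,26,1,6)$, $(1,7,26,1,6)$, $(7,0,27,1,6)$, $(1,6,27,1,6)$, $(0,7,27,1,6)$, $(3,3,28,1,6)$, $(1,3,28,3,6)$, $(1,2,29,3,6)$, $(15,3,1,16,6)$, $(7,11,1,16,6)$, $(3,15,1,16,6)$, $(15,1,3,16,6)$, $(3,13,3,16,6)$, $(1,15,3,16,6)$, $(7,3,9,16,6)$, $(7,1,11,16,6)$, $(3,5,11,16,6)$, $(1,7,11,16,6)$, $(3,1,15,16,6)$, $(1,3,15,16,6)$, $(15,3,0,17,6)$,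 $(7,11,0,17,6)$, $(3,15,0,17,6)$, $(15,1,2,17,6)$, $(1,15,2,17,6)$, $(15,0,3,17,6)$, $(1,14,3,17,6)$, $(0,15,3,17,6)$, $(7,3,8,17,6)$, $(7,1,10,17,6)$, $(3,5,10,17,6)$, $(1,7,10,17,6)$, $(7,0,11,17,6)$, $(3,4,11,17,6)$, $(0,7,11,17,6)$, $(3,3,12,17,6)$, $(3,1,14,17,6)$, $(1,3,14,17,6)$, $(3,0,15,17,6)$, $(1,2,15,17,6)$, $(0,3,15,17,6)$, $(1,3,13,18,6)$, $(15,1,0,19,6)$, $(3,13,0,19,6)$, $(1,15,0,19,6)$, $(15,0,1,19,6)$, $(1,14,1,19,6)$, $(0,15,1,19,6)$, $(1,3,12,19,6)$, $(3,0,13,19,6)$, $(1,2,13,19,6)$, $(0,3,13,19,6)$, $(1,0,15,19,6)$, $(0,1,15,19,6)$, $(3,5,3,24,6)$, $(1,7,3,24,6)$, $(3,1,7,24,6)$, $(7,1,2,25,6)$, $(3,5,2,25,6)$, $(1,7,2,25,6)$, $(3,3,4,25,6)$, $(1,7,1,26,6)$, $(1,1,7,26,6)$, $(7,1,0,27,6)$, $(3,5,0,27,6)$, $(1,7,0,27,6)$, $(7,0,1,27,6)$, $(3,4,1,27,6)$, $(0,7,1,27,6)$, $(1,3,4,27,6)$, $(3,0,5,27,6)$, $(1,2,5,27,6)$, $(0,3,5,27,6)$, $(1,0,7,27,6)$, $(0,1,7,27,6)$, $(3,1,3,28,6)$, $(3,3,0,29,6)$, $(1,3,2,29,6)$, $(3,0,3,29,6)$,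 $(0,3,3,29,6)$, $(1,3,1,30,6)$, $(1,1,3,30,6)$, $(15,19,0,0,7)$, $(7,27,0,0,7)$, $(15,1,18,0,7)$, $(3,13,18,0,7)$, $(1,15,18,0,7)$, $(15,0,19,0,7)$, $(1,14,19,0,7)$, $(0,15,19,0,7)$, $(7,1,26,0,7)$, $(3,5,26,0,7)$, $(1,7,26,0,7)$, $(7,0,27,0,7)$, $(1,6,27,0,7)$, $(0,7,27,0,7)$, $(15,1,2,16,7)$, $(3,13,2,16,7)$, $(1,15,2,16,7)$, $(3,5,10,16,7)$, $(3,1,14,16,7)$, $(1,3,14,16,7)$, $(1,2,15,16,7)$, $(15,1,0,18,7)$, $(3,13,0,18,7)$, $(1,15,0,18,7)$, $(15,0,1,18,7)$, $(1,14,1,18,7)$, $(0,15,1,18,7)$, $(3,1,12,18,7)$, $(1,3,12,18,7)$, $(3,0,13,18,7)$, $(1,2,13,18,7)$, $(0,3,13,18,7)$, $(1,1,14,18,7)$, $(1,0,15,18,7)$, $(0,1,15,18,7)$, $(15,0,0,19,7)$, $(1,14,0,19,7)$, $(0,15,0,19,7)$, $(1,2,12,19,7)$, $(1,0,14,19,7)$, $(0,1,14,19,7)$, $(0,0,15,19,7)$, $(7,1,2,24,7)$, $(1,7,2,24,7)$, $(1,2,7,24,7)$, $(7,1,0,26,7)$, $(3,5,0,26,7)$, $(1,7,0,26,7)$, $(7,0,1,26,7)$, $(1,6,1,26,7)$, $(0,7,1,26,7)$, $(3,1,4,26,7)$, $(1,3,4,26,7)$, $(3,0,5,26,7)$, $(1,2,5,26,7)$,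 $(0,3,5,26,7)$, $(1,0,7,26,7)$, $(0,1,7,26,7)$, $(7,0,0,27,7)$, $(1,6,0,27,7)$, $(0,7,0,27,7)$, $(1,2,4,27,7)$, $(1,0,6,27,7)$, $(0,1,6,27,7)$, $(0,0,7,27,7)$, $(3,1,2,28,7)$, $(1,3,2,28,7)$, $(1,1,2,30,7)$, $(7,7,11,0,16)$, $(15,7,1,2,16)$, $(7,11,5,2,16)$, $(15,1,7,2,16)$, $(3,13,7,2,16)$, $(1,15,7,2,16)$, $(7,7,9,2,16)$, $(3,5,15,2,16)$, $(7,7,8,3,16)$, $(15,3,1,6,16)$, $(7,11,1,6,16)$, $(3,15,1,6,16)$, $(15,1,3,6,16)$, $(7,9,3,6,16)$, $(1,15,3,6,16)$, $(7,1,11,6,16)$, $(3,5,11,6,16)$, $(1,7,11,6,16)$, $(3,1,15,6,16)$, $(1,3,15,6,16)$, $(15,1,2,7,16)$, $(3,13,2,7,16)$, $(1,15,2,7,16)$, $(3,5,10,7,16)$, $(3,1,14,7,16)$, $(1,3,14,7,16)$, $(1,2,15,7,16)$, $(7,7,1,10,16)$, $(3,7,5,10,16)$, $(7,7,0,11,16)$, $(3,5,6,11,16)$, $(1,7,6,11,16)$, $(7,0,7,11,16)$, $(1,6,7,11,16)$, $(0,7,7,11,16)$, $(3,7,3,12,16)$, $(7,1,3,14,16)$, $(3,5,3,14,16)$, $(1,7,3,14,16)$, $(1,3,7,14,16)$, $(3,5,2,15,16)$, $(15,7,1,0,18)$, $(15,3,5,0,18)$, $(7,11,5,0,18)$, $(3,15,5,0,18)$,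 $(15,1,7,0,18)$, $(3,13,7,0,18)$, $(1,15,7,0,18)$, $(15,7,0,1,18)$, $(15,1,6,1,18)$, $(3,13,6,1,18)$, $(1,15,6,1,18)$, $(15,0,7,1,18)$, $(1,14,7,1,18)$, $(0,15,7,1,18)$, $(15,3,1,4,18)$, $(3,15,1,4,18)$, $(15,1,3,4,18)$, $(7,9,3,4,18)$, $(1,15,3,4,18)$, $(7,3,9,4,18)$, $(7,1,11,4,18)$, $(3,5,11,4,18)$, $(1,7,11,4,18)$, $(3,3,13,4,18)$, $(3,1,15,4,18)$, $(1,3,15,4,18)$, $(15,3,0,5,18)$, $(7,11,0,5,18)$, $(3,15,0,5,18)$, $(15,1,2,5,18)$, $(7,9,2,5,18)$, $(3,13,2,5,18)$, $(1,15,2,5,18)$, $(15,0,3,5,18)$, $(1,14,3,5,18)$, $(0,15,3,5,18)$, $(7,1,10,5,18)$, $(3,5,10,5,18)$, $(1,7,10,5,18)$, $(7,0,11,5,18)$, $(3,4,11,5,18)$, $(0,7,11,5,18)$, $(3,1,14,5,18)$, $(1,3,14,5,18)$, $(3,0,15,5,18)$, $(1,2,15,5,18)$, $(0,3,15,5,18)$, $(15,1,1,6,18)$, $(3,13,1,6,18)$, $(1,15,1,6,18)$, $(7,1,9,6,18)$, $(1,3,13,6,18)$, $(1,1,15,6,18)$, $(15,1,0,7,18)$, $(3,13,0,7,18)$, $(1,15,0,7,18)$, $(15,0,1,7,18)$, $(1,14,1,7,18)$, $(0,15,1,7,18)$, $(3,1,12,7,18)$, $(1,3,12,7,18)$, $(3,0,13,7,18)$,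 $(1,2,13,7,18)$, $(0,3,13,7,18)$, $(1,1,14,7,18)$, $(1,0,15,7,18)$, $(0,1,15,7,18)$, $(7,7,1,8,18)$, $(3,7,5,8,18)$, $(7,3,4,9,18)$, $(3,7,4,9,18)$, $(7,1,6,9,18)$, $(3,5,6,9,18)$, $(1,7,6,9,18)$, $(3,7,1,12,18)$, $(3,5,3,12,18)$, $(3,5,2,13,18)$, $(3,1,6,13,18)$, $(3,5,1,14,18)$, $(1,7,1,14,18)$, $(3,1,5,14,18)$, $(1,1,6,15,18)$, $(15,7,0,0,19)$, $(15,1,6,0,19)$, $(3,13,6,0,19)$, $(1,15,6,0,19)$, $(15,0,7,0,19)$, $(1,14,7,0,19)$, $(0,15,7,0,19)$, $(7,7,8,0,19)$, $(7,1,14,0,19)$, $(3,5,14,0,19)$, $(1,7,14,0,19)$, $(15,1,2,4,19)$, $(3,13,2,4,19)$, $(1,15,2,4,19)$, $(3,5,10,4,19)$, $(3,1,14,4,19)$, $(1,3,14,4,19)$, $(1,2,15,4,19)$, $(15,1,0,6,19)$, $(3,13,0,6,19)$, $(1,15,0,6,19)$, $(15,0,1,6,19)$, $(1,14,1,6,19)$, $(0,15,1,6,19)$, $(3,1,12,6,19)$, $(1,3,12,6,19)$, $(3,0,13,6,19)$, $(1,2,13,6,19)$, $(0,3,13,6,19)$, $(1,1,14,6,19)$, $(1,0,15,6,19)$, $(0,1,15,6,19)$, $(15,0,0,7,19)$, $(1,14,0,7,19)$, $(0,15,0,7,19)$, $(1,2,12,7,19)$, $(1,0,14,7,19)$, $(0,1,14,7,19)$,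 $(0,0,15,7,19)$, $(7,7,0,8,19)$, $(3,5,6,8,19)$, $(1,7,6,8,19)$, $(7,0,7,8,19)$, $(1,6,7,8,19)$, $(0,7,7,8,19)$, $(1,7,2,12,19)$, $(1,2,7,12,19)$, $(7,1,0,14,19)$, $(3,5,0,14,19)$, $(1,7,0,14,19)$, $(7,0,1,14,19)$, $(1,6,1,14,19)$, $(0,7,1,14,19)$, $(1,3,4,14,19)$, $(3,0,5,14,19)$, $(1,2,5,14,19)$, $(0,3,5,14,19)$, $(1,1,6,14,19)$, $(1,0,7,14,19)$, $(0,1,7,14,19)$, $(15,3,1,2,20)$, $(7,11,1,2,20)$, $(3,15,1,2,20)$, $(15,1,3,2,20)$, $(7,9,3,2,20)$, $(3,13,3,2,20)$, $(1,15,3,2,20)$, $(7,3,9,2,20)$, $(3,3,13,2,20)$, $(3,1,15,2,20)$, $(1,3,15,2,20)$, $(3,5,10,3,20)$, $(3,1,14,3,20)$, $(3,7,3,8,20)$, $(3,3,7,8,20)$, $(7,3,1,10,20)$, $(7,1,3,10,20)$, $(3,5,3,10,20)$, $(3,3,5,10,20)$, $(1,7,2,11,20)$, $(1,2,7,11,20)$, $(3,3,1,14,20)$, $(1,3,3,14,20)$, $(3,1,2,15,20)$, $(1,3,2,15,20)$, $(7,1,11,0,22)$, $(3,5,11,0,22)$, $(1,7,11,0,22)$, $(3,13,2,1,22)$, $(3,3,12,1,22)$, $(15,1,1,2,22)$, $(7,9,1,2,22)$, $(3,13,1,2,22)$, $(1,15,1,2,22)$, $(7,1,9,2,22)$, $(3,1,13,2,22)$,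 $(1,1,15,2,22)$, $(1,1,14,3,22)$, $(7,3,1,8,22)$, $(7,1,3,8,22)$, $(3,5,3,8,22)$, $(1,7,3,8,22)$, $(3,3,5,8,22)$, $(1,3,7,8,22)$, $(3,5,2,9,22)$, $(3,1,6,9,22)$, $(1,7,1,10,22)$, $(3,1,5,10,22)$, $(1,1,7,10,22)$, $(7,1,0,11,22)$, $(3,5,0,11,22)$, $(1,7,0,11,22)$, $(7,0,1,11,22)$, $(1,6,1,11,22)$, $(0,7,1,11,22)$, $(1,3,4,11,22)$, $(3,0,5,11,22)$, $(1,2,5,11,22)$, $(0,3,5,11,22)$, $(1,1,6,11,22)$, $(1,0,7,11,22)$, $(0,1,7,11,22)$, $(3,3,1,12,22)$, $(1,3,3,12,22)$, $(3,1,1,14,22)$, $(1,3,1,14,22)$, $(1,1,3,14,22)$, $(1,1,2,15,22)$, $(3,5,8,2,23)$, $(3,1,12,2,23)$, $(1,3,12,2,23)$, $(1,1,14,2,23)$, $(3,5,2,8,23)$, $(1,1,6,10,23)$, $(3,1,2,12,23)$, $(1,3,2,12,23)$, $(1,1,2,14,23)$, $(1,7,7,2,24)$, $(7,1,6,3,24)$, $(3,5,6,3,24)$, $(3,7,3,4,24)$, $(3,3,7,4,24)$, $(7,3,1,6,24)$, $(3,3,5,6,24)$, $(3,1,7,6,24)$, $(7,1,2,7,24)$, $(1,7,2,7,24)$, $(1,2,7,7,24)$, $(7,7,1,0,26)$, $(7,1,7,0,26)$, $(3,5,7,0,26)$, $(1,7,7,0,26)$, $(7,7,0,1,26)$, $(3,7,4,1,26)$,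 $(7,1,6,1,26)$, $(1,7,6,1,26)$, $(7,0,7,1,26)$, $(3,4,7,1,26)$, $(0,7,7,1,26)$, $(7,1,3,4,26)$, $(3,3,5,4,26)$, $(7,1,2,5,26)$, $(3,5,2,5,26)$, $(1,7,2,5,26)$, $(3,4,3,5,26)$, $(1,6,3,5,26)$, $(1,3,6,5,26)$, $(7,1,1,6,26)$, $(1,3,5,6,26)$, $(7,1,0,7,26)$, $(3,5,0,7,26)$, $(1,7,0,7,26)$, $(7,0,1,7,26)$, $(1,6,1,7,26)$, $(0,7,1,7,26)$, $(3,1,4,7,26)$, $(1,3,4,7,26)$, $(3,0,5,7,26)$, $(1,2,5,7,26)$, $(0,3,5,7,26)$, $(1,0,7,7,26)$, $(0,1,7,7,26)$, $(7,7,0,0,27)$, $(7,1,6,0,27)$, $(3,5,6,0,27)$, $(1,7,6,0,27)$, $(7,0,7,0,27)$, $(1,6,7,0,27)$, $(0,7,7,0,27)$, $(7,1,2,4,27)$, $(3,5,2,4,27)$, $(1,7,2,4,27)$, $(3,1,6,4,27)$, $(1,3,6,4,27)$, $(1,2,7,4,27)$, $(7,1,0,6,27)$, $(3,5,0,6,27)$, $(1,7,0,6,27)$, $(7,0,1,6,27)$, $(1,6,1,6,27)$, $(0,7,1,6,27)$, $(3,1,4,6,27)$, $(1,3,4,6,27)$, $(3,0,5,6,27)$, $(1,2,5,6,27)$, $(0,3,5,6,27)$, $(1,0,7,6,27)$, $(0,1,7,6,27)$, $(7,0,0,7,27)$, $(1,6,0,7,27)$, $(0,7,0,7,27)$, $(1,2,4,7,27)$,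 $(1,0,6,7,27)$, $(0,1,6,7,27)$, $(0,0,7,7,27)$, $(7,1,3,2,28)$, $(3,5,3,2,28)$, $(1,7,3,2,28)$, $(3,1,7,2,28)$, $(1,7,2,3,28)$, $(3,3,4,3,28)$, $(1,3,6,3,28)$, $(3,3,1,6,28)$, $(3,1,3,6,28)$, $(3,1,2,7,28)$, $(1,3,2,7,28)$, $(3,3,5,0,30)$, $(3,5,2,1,30)$, $(3,4,3,1,30)$, $(1,6,3,1,30)$, $(3,3,4,1,30)$, $(3,1,6,1,30)$, $(7,1,1,2,30)$, $(1,7,1,2,30)$, $(3,4,1,3,30)$, $(1,6,1,3,30)$, $(3,1,4,3,30)$, $(1,3,4,3,30)$, $(1,2,5,3,30)$, $(1,1,6,3,30)$, $(3,3,1,4,30)$, $(3,1,3,4,30)$, $(1,3,3,4,30)$, $(3,3,0,5,30)$, $(1,3,2,5,30)$, $(3,0,3,5,30)$, $(0,3,3,5,30)$, $(3,1,1,6,30)$, $(1,3,1,6,30)$, $(1,1,3,6,30)$, $(1,1,2,7,30)$. *)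

(* Defs.v *)
From HB Require Import structures.
From mathcomp Require Import all_boot all_order all_fingroup all_algebra.
From mathcomp Require Import generic_quotient ring_quotient.
From mathcomp.classical Require Import boolp.
From mathcomp.multinomials Require Import mpoly.

Set Implicit Arguments.
Unset Strict Implicit.
Unset Printing Implicit Defensive.

Import GRing.Theory.

Local Open Scope ring_scope.
Local Open Scope quotient_scope.

Notation P5 := {mpoly 'F_2[5]}.

(* The total square \sum_k Sq^k t^k is the ring morphism P5 -> P5[t] with
   x_j |-> x_j + x_j^2 t; Sq k is its coefficient of t^k. The properties
   determining the Steenrod squares are proved below: additivity (SqD),
   Sq^k (x_j^n) = binom(n, k) x_j^(n + k) (Sq_Xn), and the Cartan formula
   (Sq_Cartan). The variables x_1, ..., x_5 are 'X_0, ..., 'X_4. *)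
Definition total_sq : P5 -> {poly P5} :=
  mmap (polyC \o @mpolyC 5 'F_2) (fun j => ('X_j)%:P + ('X_j ^+ 2)%:P * 'X).

HB.instance Definition _ := GRing.RMorphism.on total_sq.

Definition Sq (k : nat) (f : P5) : P5 := (total_sq f)`_k.

Lemma SqD k : {morph Sq k : f g / f + g}.
Proof. by move=> f g; rewrite /Sq rmorphD coefD. Qed.

Lemma Sq0 k : Sq k 0 = 0.
Proof. by rewrite /Sq rmorph0 coef0. Qed.

Lemma total_sqX j : total_sq 'X_j = ('X_j)%:P + ('X_j ^+ 2)%:P * 'X.
Proof. by rewrite /total_sq mmapX mmap1U. Qed.

Lemma Sq_Xn k n (j : 'I_5) : Sq k ('X_j ^+ n) = 'X_j ^+ (n + k) *+ 'C(n, k).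
Proof.
rewrite /Sq rmorphXn /= total_sqX.
rewrite exprDn coef_sum.
under eq_bigr => i _.
  rewrite exprMn mulrA -!rmorphXn -rmorphM -mulrnAl -rmorphMn coefCM coefXn /=.
  over.
case: (leqP k n) => [le_kn|lt_nk]; last first.
  rewrite bin_small // mulr0n big1 // => i _.
  by rewrite gtn_eqF ?mulr0 // (leq_trans (ltn_ord i)).
rewrite (bigD1 (Ordinal (le_kn : k < n.+1)%N)) //= eqxx mulr1 big1 ?addr0.
  by rewrite -exprM -exprD mul2n -addnn addnA subnK.
by move=> i; rewrite -val_eqE /= eq_sym => /negPf->; rewrite mulr0.
Qed.

Lemma Sq_Cartan k f g : Sq k (f * g) = \sum_(i < k.+1) Sq i f * Sq (k - i) g.
Proof. by rewrite /Sq rmorphM coefM. Qed.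

(* steenrod d theta: theta is the operator by which some element of degree d
   of the Steenrod algebra acts on P5. As that algebra is generated by the
   Sq^k, these operators are the sums of composites of Sq^k of total degree d. *)
Inductive steenrod : nat -> (P5 -> P5) -> Prop :=
| steenrod_Sq k : steenrod k (Sq k)
| steenrod_comp d e a b :
    steenrod d a -> steenrod e b -> steenrod (d + e) (fun f => a (b f))
| steenrod_zero d : steenrod d (fun=> 0)
| steenrod_add d a b :
    steenrod d a -> steenrod d b -> steenrod d (fun f => a f + b f).

(* The product of the positive-degree part of the Steenrod algebra with P5:
   all finite sums of theta f with theta of positive degree. *)
Inductive hit : P5 -> Prop :=
| hit_zero : hit 0
| hit_add d theta f h :
    (0 < d)%N -> steenrod d theta -> hit h -> hit (theta f + h).

Lemma hitD f g : hit f -> hit g -> hit (f + g).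
Proof.
move=> hf hg; elim: hf => [|d th u h d0 sth _ ih]; first by rewrite add0r.
by rewrite -addrA; apply: hit_add d0 sth ih.
Qed.

Lemma F2_01 (c : 'F_2) : c = 0 \/ c = 1.
Proof. by case: c => [[|[|//]] ?]; [left|right]; apply/val_inj. Qed.

Lemma hitZ (c : 'F_2) f : hit f -> hit (c *: f).
Proof.
move=> hf; have [->|->] := F2_01 c; last by rewrite scale1r.
by rewrite scale0r; apply: hit_zero.
Qed.

Notation P5deg n := (dhomog 5 'F_2 n).

Section Q.

Variable n : nat.

Definition hit_pred : {pred (P5deg n)} := fun f => `[< hit f >].

Lemma hit_predP (f : P5deg n) : reflect (hit f) (f \in hit_pred).
Proof. exact: asboolP. Qed.

Fact hit_pred_closed : submod_closed hit_pred.
Proof.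
split=> [|c f g /hit_predP hf /hit_predP hg]; apply/hit_predP.
  exact: hit_zero.
by apply: hitD => //; apply: hitZ.
Qed.

HB.instance Definition _ :=
  GRing.isSubmodClosed.Build 'F_2 (P5deg n) hit_pred hit_pred_closed.

Definition Q : Type := {ideal_quot hit_pred}.

HB.instance Definition _ := EqQuotient.on Q.
HB.instance Definition _ := GRing.Zmodule.on Q.
HB.instance Definition _ := ZmodQuotient.copy Q {ideal_quot hit_pred}.

Definition cls (f : P5deg n) : Q := \pi_Q f.

Lemma clsK (q : Q) : cls (repr q) = q.
Proof. exact: reprK. Qed.

Lemma cls_eqP (f g : P5deg n) : reflect (cls f = cls g) (f - g \in hit_pred).
Proof. by rewrite Quotient.idealrBE; apply: eqP. Qed.

Lemma clsD : {morph cls : f g / f + g}.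
Proof. by move=> f g; rewrite /cls raddfD. Qed.

Definition scaleQ (c : 'F_2) (q : Q) : Q := cls (c *: repr q).

Lemma scaleQ_cls c f : cls (c *: f) = scaleQ c (cls f).
Proof.
apply/cls_eqP; rewrite -scalerBr rpredZ //; apply/cls_eqP.
by rewrite clsK.
Qed.

Fact scaleQA a b q : scaleQ a (scaleQ b q) = scaleQ (a * b) q.
Proof. by rewrite -[q]clsK -!scaleQ_cls scalerA. Qed.

Fact scale1Q : left_id 1 scaleQ.
Proof. by move=> q; rewrite -[q]clsK -scaleQ_cls scale1r. Qed.

Fact scaleQDr : right_distributive scaleQ +%R.
Proof.
by move=> c q r; rewrite -[q]clsK -[r]clsK -clsD -!scaleQ_cls -clsD scalerDr.
Qed.

Fact scaleQDl q : {morph scaleQ^~ q : a b / a + b}.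
Proof. by move=> a b; rewrite -[q]clsK -!scaleQ_cls -clsD scalerDl. Qed.

HB.instance Definition _ := GRing.Zmodule_isLmodule.Build 'F_2 Q
  scaleQA scale1Q scaleQDr scaleQDl.

Lemma clsZ c f : cls (c *: f) = c *: cls f.
Proof. exact: scaleQ_cls. Qed.

End Q.

Notation GL5 := {'GL_5['F_2]}.

(* g acts by the substitution x_j |-> \sum_i g_ij x_i, which makes act a left
   action (act1g, actM). *)
Definition lin_form (g : GL5) (j : 'I_5) : P5 :=
  \sum_(i < 5) (GLval g i j : 'F_2) *: 'X_i.

Definition act (g : GL5) (f : P5) : P5 := f \mPo [tuple lin_form g j | j < 5].

HB.instance Definition _ g := GRing.RMorphism.copy (act g)
  (comp_mpoly [tuple lin_form g j | j < 5]).

Lemma actD g : {morph act g : f h / f + h}.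
Proof. by move=> f h; rewrite /act comp_mpolyD. Qed.

Lemma actZ g c f : act g (c *: f) = c *: act g f.
Proof. exact: comp_mpolyZ. Qed.

Lemma actX g j : act g 'X_j = lin_form g j.
Proof. by rewrite /act comp_mpolyXU -tnth_nth tnth_mktuple. Qed.

Lemma act1g f : act 1%g f = f.
Proof.
have E i k : GLval (1%g : GL5) i k = (i == k)%:R.
  by rewrite GL_1E -[1]/(1%:M) !mxE.
have lin1 j : lin_form 1%g j = 'X_j.
  rewrite /lin_form (bigD1 j) // E eqxx scale1r big1 => [|i ne_ij].
    exact: addr0.
  by rewrite E (negPf ne_ij) scale0r.
rewrite /act (_ : mktuple _ = [tuple 'X_j | j < 5]) ?comp_mpoly_id //.
by apply: eq_from_tnth => j; rewrite !tnth_mktuple lin1.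
Qed.

Lemma act_lin_form g h j : act g (lin_form h j) = lin_form (g * h)%g j.
Proof.
rewrite /lin_form /act linear_sum /=.
under eq_bigr => i _.
  rewrite linearZ /= comp_mpolyXU -tnth_nth tnth_mktuple scaler_sumr.
  over.
rewrite exchange_big; apply: eq_bigr => i _ /=.
rewrite mxE scaler_suml; apply: eq_bigr => k _.
by rewrite scalerA mulrC.
Qed.

Lemma actM g h f : act (g * h)%g f = act g (act h f).
Proof.
rewrite {1 3}/act (comp_mpolyE f) (comp_mpolyE f) /act linear_sum.
apply: eq_bigr => m _; rewrite linearZ /= rmorph_prod; congr (_ *: _).
apply: eq_bigr => j _; rewrite rmorphXn /= !tnth_mktuple.
by rewrite -/(act _ _) act_lin_form.
Qed.

Lemma total_sq_lin_form g j :
  total_sq (lin_form g j)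
  = (lin_form g j)%:P + (lin_form g j ^+ 2)%:P * 'X.
Proof.
have char2 (f : P5) : f *+ 2 = 0.
  by rewrite -scaler_nat (_ : 2%:R = 0 :> 'F_2) ?scale0r //; apply/val_inj.
pose ok f := total_sq f = f%:P + (f ^+ 2)%:P * 'X.
have ok0 : ok 0.
  by rewrite /ok /total_sq raddf0 expr0n /= !polyC0 mul0r addr0.
have okD f h : ok f -> ok h -> ok (f + h).
  rewrite /ok => okf okh; rewrite {1}/total_sq raddfD /= -!/(total_sq _) okf okh.
  by rewrite sqrrD char2 addr0 !polyCD mulrDl addrACA.
have okX (c : 'F_2) i : ok (c *: 'X_i).
  have [->|->] := F2_01 c; first by rewrite scale0r.
  by rewrite scale1r; apply: total_sqX.
rewrite -[total_sq _ = _]/(ok (lin_form g j)) /lin_form.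
elim/big_rec: _ => [|i f _ okf].
  exact: ok0.
apply: okD.
  exact: okX.
exact: okf.
Qed.

Lemma total_sq_act g f : total_sq (act g f) = map_poly (act g) (total_sq f).
Proof.
have Z c h : total_sq (c *: h) = (c%:MP_[5])%:P * total_sq h.
  by rewrite /total_sq mmapZ.
have prodX m : total_sq (act g 'X_[m]) = map_poly (act g) (total_sq 'X_[m]).
  rewrite mpolyXE_id (rmorph_prod (act g)) 2!(rmorph_prod total_sq).
  rewrite (rmorph_prod (map_poly (act g))); apply: eq_bigr => i _.
  rewrite !rmorphXn /= actX total_sq_lin_form total_sqX.
  rewrite (rmorphD (map_poly (act g))) (rmorphM (map_poly (act g))) /=.
  by rewrite !map_polyC map_polyX /= (rmorphXn (act g)) /= actX.
elim/mpolyind: f => [|c m f _ _ ih]; first by rewrite !rmorph0.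
rewrite !rmorphD /= actZ !Z prodX ih rmorphM /= map_polyC /=.
by rewrite /act comp_mpolyC.
Qed.

Lemma Sq_act k g f : Sq k (act g f) = act g (Sq k f).
Proof.
by rewrite /Sq total_sq_act coef_map_id0 // /act raddf0.
Qed.

Lemma steenrod_act d theta g f :
  steenrod d theta -> theta (act g f) = act g (theta f).
Proof.
move=> s; elim: s f => {d theta} [k|d e a b _ ia _ ib|d|d a b _ ia _ ib] f.
- exact: Sq_act.
- by rewrite ib ia.
- by rewrite /act raddf0.
- by rewrite ia ib actD.
Qed.

Lemma hit_act g f : hit f -> hit (act g f).
Proof.
elim=> [|d th u h d0 sth _ ih]; first by rewrite /act raddf0; constructor.
by rewrite actD -(steenrod_act _ _ sth); apply: hit_add d0 sth ih.
Qed.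

Lemma act_homog g n f : f \is n.-homog -> act g f \is n.-homog.
Proof.
move=> /dhomogP hf; rewrite /act comp_mpolyE big_seq.
apply: rpred_sum => m /hf <-; apply: rpredZ.
rewrite mfE; elim/big_rec2: _ => [|j d p _ hp]; first exact: dhomog1.
have hl : lin_form g j \is 1.-homog.
  apply: rpred_sum => i _; apply: rpredZ.
  by rewrite dhomogX; apply/eqP/mdeg1.
apply: dhomogM => //; rewrite tnth_mktuple.
by have := dhomogMn (m j) hl; rewrite mul1n /= mdeg1 muln1.
Qed.

Section ActQ.

Variable n : nat.

Definition act_deg (g : GL5) (f : P5deg n) : P5deg n :=
  DHomog (act_homog g (dhomog_is_dhomog f)).

Definition actQ (g : GL5) (q : Q n) : Q n := cls (act_deg g (repr q)).

Lemma actQ_cls g (f : P5deg n) : actQ g (cls f) = cls (act_deg g f).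
Proof.
apply/cls_eqP/hit_predP; have /cls_eqP/hit_predP h := clsK (cls f).
rewrite raddfB /= in h *.
by rewrite -(rmorphB (act g)); apply: hit_act.
Qed.

Definition GL5_invariant (q : Q n) : Prop := forall g : GL5, actQ g q = q.

End ActQ.

Definition phi (u : P5) : P5 := (\prod_(j < 5) 'X_j) * u ^+ 2.

Lemma phi_homog n u : u \is n.-homog -> phi u \is (5 + n * 2).-homog.
Proof.
move=> hu; apply: dhomogM; last exact: dhomogMn.
rewrite (_ : \prod_j _ = 'X_[[multinom 1%N | j < 5]]).
  by rewrite dhomogX /= mdegE; apply/eqP; rewrite !big_ord_recl big_ord0 !mnmE.
by rewrite mpolyXE_id; apply: eq_bigr => j _; rewrite mnmE expr1.
Qed.

(* (a, b, c, d, e) encodes x_1^a x_2^b x_3^c x_4^d x_5^e. *)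
Definition mono (t : nat * nat * nat * nat * nat) : 'X_{1..5} :=
  let: (a, b, c, d, e) := t in Multinom [tuple a; b; c; d; e].

Definition poly_of (s : seq (nat * nat * nat * nat * nat)) : P5 :=
  \sum_(t <- s) 'X_[mono t].

Lemma poly_of_homog n s :
  all (fun t => let: (a, b, c, d, e) := t in a + b + c + d + e == n)%N s ->
  poly_of s \is n.-homog.
Proof.
move=> /allP hs; rewrite /poly_of big_seq; apply: rpred_sum.
move=> [[[[a b] c] d] e] /hs /eqP <-.
by rewrite dhomogX /= mdegE !big_ord_recl big_ord0 addn0 !addnA.
Qed.

Definition xi18 : P5 := poly_of [::
    (3,5,8,2,0); (3,1,12,2,0); (1,3,12,2,0); (1,1,14,2,0); (3,5,2,8,0);
    (1,1,6,10,0); (3,1,2,12,0); (1,3,2,12,0); (1,1,2,14,0); (3,5,8,1,1);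
    (3,1,12,1,1); (1,3,12,1,1); (1,1,14,1,1); (3,5,1,8,1); (3,1,1,12,1);
    (1,3,1,12,1); (1,1,1,14,1); (3,5,8,0,2); (3,1,12,0,2); (1,3,12,0,2);
    (1,1,14,0,2); (3,5,0,8,2); (3,0,5,8,2); (1,2,5,8,2); (0,3,5,8,2);
    (1,2,4,9,2); (3,1,0,12,2); (1,3,0,12,2); (3,0,1,12,2); (0,3,1,12,2);
    (1,0,3,12,2); (0,1,3,12,2); (1,1,0,14,2); (1,0,1,14,2); (0,1,1,14,2);
    (3,5,2,4,4); (3,5,2,0,8); (3,5,1,1,8); (3,5,0,2,8); (3,0,5,2,8);
    (1,2,5,2,8); (0,3,5,2,8); (1,1,6,2,8); (3,1,2,4,8); (1,3,2,4,8);
    (1,2,1,6,8); (1,1,6,0,10); (1,2,4,1,10); (1,2,1,4,10); (1,1,2,4,10);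
    (1,1,0,6,10); (1,0,1,6,10); (0,1,1,6,10); (3,1,2,0,12); (1,3,2,0,12);
    (3,1,1,1,12); (1,3,1,1,12); (3,1,0,2,12); (1,3,0,2,12); (3,0,1,2,12);
    (0,3,1,2,12); (1,0,3,2,12); (0,1,3,2,12); (1,1,2,0,14); (1,1,1,1,14);
    (1,1,0,2,14); (1,0,1,2,14); (0,1,1,2,14)
  ].

Definition xi41 : P5 := poly_of [::
    (15,19,7,0,0); (7,27,7,0,0); (15,7,19,0,0); (7,7,27,0,0); (15,19,1,6,0);
    (7,27,1,6,0); (15,3,17,6,0); (7,11,17,6,0); (3,15,17,6,0); (15,1,19,6,0);
    (3,13,19,6,0); (1,15,19,6,0); (7,1,27,6,0); (3,5,27,6,0); (1,7,27,6,0);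
    (3,3,29,6,0); (15,19,0,7,0); (7,27,0,7,0); (15,1,18,7,0); (3,13,18,7,0);
    (1,15,18,7,0); (15,0,19,7,0); (1,14,19,7,0); (0,15,19,7,0); (7,1,26,7,0);
    (3,5,26,7,0); (1,7,26,7,0); (7,0,27,7,0); (1,6,27,7,0); (0,7,27,7,0);
    (7,7,11,16,0); (15,7,1,18,0); (15,3,5,18,0); (7,11,5,18,0); (3,15,5,18,0);
    (15,1,7,18,0); (3,13,7,18,0); (1,15,7,18,0); (15,7,0,19,0); (15,1,6,19,0);
    (3,13,6,19,0); (1,15,6,19,0); (15,0,7,19,0); (1,14,7,19,0); (0,15,7,19,0);
    (7,7,8,19,0); (7,1,14,19,0); (3,5,14,19,0); (1,7,14,19,0); (7,1,11,22,0);
    (3,5,11,22,0); (1,7,11,22,0); (7,7,1,26,0); (7,1,7,26,0); (3,5,7,26,0);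
    (1,7,7,26,0); (7,7,0,27,0); (7,1,6,27,0); (3,5,6,27,0); (1,7,6,27,0);
    (7,0,7,27,0); (1,6,7,27,0); (0,7,7,27,0); (3,3,5,30,0); (7,11,17,4,2);
    (7,3,25,4,2); (3,7,25,4,2); (3,3,29,4,2); (7,11,16,5,2); (7,3,24,5,2);
    (3,7,24,5,2); (3,3,28,5,2); (15,3,5,16,2); (7,11,5,16,2); (3,15,5,16,2);
    (3,5,15,16,2); (15,3,1,20,2); (7,11,1,20,2); (3,15,1,20,2); (15,1,3,20,2);
    (1,15,3,20,2); (3,3,13,20,2); (3,1,15,20,2); (1,3,15,20,2); (3,13,2,21,2);
    (3,3,12,21,2); (15,1,1,22,2); (3,13,1,22,2); (1,15,1,22,2); (7,1,9,22,2);
    (3,1,13,22,2); (1,1,15,22,2); (3,5,8,23,2); (3,1,12,23,2); (1,3,12,23,2);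
    (1,1,14,23,2); (7,1,7,24,2); (3,5,7,24,2); (3,7,4,25,2); (3,5,6,25,2);
    (3,4,7,25,2); (1,6,7,25,2); (3,7,1,28,2); (7,1,3,28,2); (1,7,3,28,2);
    (3,1,7,28,2); (1,3,7,28,2); (3,5,2,29,2); (3,4,3,29,2); (1,6,3,29,2);
    (3,3,4,29,2); (3,1,6,29,2); (7,1,1,30,2); (3,5,1,30,2); (1,7,1,30,2);
    (3,1,5,30,2); (1,3,5,30,2); (1,3,28,6,3); (1,2,29,6,3); (7,7,8,16,3);
    (3,1,14,20,3); (3,1,12,22,3); (7,1,6,24,3); (3,5,6,24,3); (1,7,2,28,3);
    (1,3,6,28,3); (1,3,4,30,3); (1,2,5,30,3); (1,1,6,30,3); (15,19,1,2,4);
    (7,27,1,2,4); (15,3,17,2,4); (7,11,17,2,4); (3,15,17,2,4); (15,1,19,2,4);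
    (3,13,19,2,4); (1,15,19,2,4); (7,1,27,2,4); (3,5,27,2,4); (1,7,27,2,4);
    (3,3,29,2,4); (15,3,1,18,4); (3,15,1,18,4); (15,1,3,18,4); (3,13,3,18,4);
    (1,15,3,18,4); (7,1,11,18,4); (3,5,11,18,4); (1,7,11,18,4); (3,3,13,18,4);
    (3,1,15,18,4); (1,3,15,18,4); (15,1,2,19,4); (3,13,2,19,4); (1,15,2,19,4);
    (3,1,14,19,4); (1,3,14,19,4); (1,2,15,19,4); (7,3,1,26,4); (3,7,1,26,4);
    (7,1,3,26,4); (3,5,3,26,4); (1,3,7,26,4); (7,1,2,27,4); (3,5,2,27,4);
    (1,7,2,27,4); (3,3,4,27,4); (3,1,6,27,4); (1,3,6,27,4); (1,2,7,27,4);
    (3,3,3,28,4); (3,1,3,30,4); (15,19,1,0,6); (7,27,1,0,6); (15,3,17,0,6);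
    (7,11,17,0,6); (3,15,17,0,6); (15,1,19,0,6); (3,13,19,0,6); (1,15,19,0,6);
    (7,1,27,0,6); (3,5,27,0,6); (1,7,27,0,6); (3,3,29,0,6); (15,19,0,1,6);
    (7,27,0,1,6); (7,11,16,1,6); (15,1,18,1,6); (3,13,18,1,6); (1,15,18,1,6);
    (15,0,19,1,6); (1,14,19,1,6); (0,15,19,1,6); (7,3,24,1,6); (3,7,24,1,6);
    (7,1,26,1,6); (3,5,26,1,6); (1,7,26,1,6); (7,0,27,1,6); (1,6,27,1,6);
    (0,7,27,1,6); (3,3,28,1,6); (1,3,28,3,6); (1,2,29,3,6); (15,3,1,16,6);
    (7,11,1,16,6); (3,15,1,16,6); (15,1,3,16,6); (3,13,3,16,6); (1,15,3,16,6);
    (7,3,9,16,6); (7,1,11,16,6); (3,5,11,16,6); (1,7,11,16,6); (3,1,15,16,6);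
    (1,3,15,16,6); (15,3,0,17,6); (7,11,0,17,6); (3,15,0,17,6); (15,1,2,17,6);
    (1,15,2,17,6); (15,0,3,17,6); (1,14,3,17,6); (0,15,3,17,6); (7,3,8,17,6);
    (7,1,10,17,6); (3,5,10,17,6); (1,7,10,17,6); (7,0,11,17,6); (3,4,11,17,6);
    (0,7,11,17,6); (3,3,12,17,6); (3,1,14,17,6); (1,3,14,17,6); (3,0,15,17,6);
    (1,2,15,17,6); (0,3,15,17,6); (1,3,13,18,6); (15,1,0,19,6); (3,13,0,19,6);
    (1,15,0,19,6); (15,0,1,19,6); (1,14,1,19,6); (0,15,1,19,6); (1,3,12,19,6);
    (3,0,13,19,6); (1,2,13,19,6); (0,3,13,19,6); (1,0,15,19,6); (0,1,15,19,6);
    (3,5,3,24,6); (1,7,3,24,6); (3,1,7,24,6); (7,1,2,25,6); (3,5,2,25,6);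
    (1,7,2,25,6); (3,3,4,25,6); (1,7,1,26,6); (1,1,7,26,6); (7,1,0,27,6);
    (3,5,0,27,6); (1,7,0,27,6); (7,0,1,27,6); (3,4,1,27,6); (0,7,1,27,6);
    (1,3,4,27,6); (3,0,5,27,6); (1,2,5,27,6); (0,3,5,27,6); (1,0,7,27,6);
    (0,1,7,27,6); (3,1,3,28,6); (3,3,0,29,6); (1,3,2,29,6); (3,0,3,29,6);
    (0,3,3,29,6); (1,3,1,30,6); (1,1,3,30,6); (15,19,0,0,7); (7,27,0,0,7);
    (15,1,18,0,7); (3,13,18,0,7); (1,15,18,0,7); (15,0,19,0,7); (1,14,19,0,7);
    (0,15,19,0,7); (7,1,26,0,7); (3,5,26,0,7); (1,7,26,0,7); (7,0,27,0,7);
    (1,6,27,0,7); (0,7,27,0,7); (15,1,2,16,7); (3,13,2,16,7); (1,15,2,16,7);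
    (3,5,10,16,7); (3,1,14,16,7); (1,3,14,16,7); (1,2,15,16,7); (15,1,0,18,7);
    (3,13,0,18,7); (1,15,0,18,7); (15,0,1,18,7); (1,14,1,18,7); (0,15,1,18,7);
    (3,1,12,18,7); (1,3,12,18,7); (3,0,13,18,7); (1,2,13,18,7); (0,3,13,18,7);
    (1,1,14,18,7); (1,0,15,18,7); (0,1,15,18,7); (15,0,0,19,7); (1,14,0,19,7);
    (0,15,0,19,7); (1,2,12,19,7); (1,0,14,19,7); (0,1,14,19,7); (0,0,15,19,7);
    (7,1,2,24,7); (1,7,2,24,7); (1,2,7,24,7); (7,1,0,26,7); (3,5,0,26,7);
    (1,7,0,26,7); (7,0,1,26,7); (1,6,1,26,7); (0,7,1,26,7); (3,1,4,26,7);
    (1,3,4,26,7); (3,0,5,26,7); (1,2,5,26,7); (0,3,5,26,7); (1,0,7,26,7);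
    (0,1,7,26,7); (7,0,0,27,7); (1,6,0,27,7); (0,7,0,27,7); (1,2,4,27,7);
    (1,0,6,27,7); (0,1,6,27,7); (0,0,7,27,7); (3,1,2,28,7); (1,3,2,28,7);
    (1,1,2,30,7); (7,7,11,0,16); (15,7,1,2,16); (7,11,5,2,16); (15,1,7,2,16);
    (3,13,7,2,16); (1,15,7,2,16); (7,7,9,2,16); (3,5,15,2,16); (7,7,8,3,16);
    (15,3,1,6,16); (7,11,1,6,16); (3,15,1,6,16); (15,1,3,6,16); (7,9,3,6,16);
    (1,15,3,6,16); (7,1,11,6,16); (3,5,11,6,16); (1,7,11,6,16); (3,1,15,6,16);
    (1,3,15,6,16); (15,1,2,7,16); (3,13,2,7,16); (1,15,2,7,16); (3,5,10,7,16);
    (3,1,14,7,16); (1,3,14,7,16); (1,2,15,7,16); (7,7,1,10,16); (3,7,5,10,16);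
    (7,7,0,11,16); (3,5,6,11,16); (1,7,6,11,16); (7,0,7,11,16); (1,6,7,11,16);
    (0,7,7,11,16); (3,7,3,12,16); (7,1,3,14,16); (3,5,3,14,16); (1,7,3,14,16);
    (1,3,7,14,16); (3,5,2,15,16); (15,7,1,0,18); (15,3,5,0,18); (7,11,5,0,18);
    (3,15,5,0,18); (15,1,7,0,18); (3,13,7,0,18); (1,15,7,0,18); (15,7,0,1,18);
    (15,1,6,1,18); (3,13,6,1,18); (1,15,6,1,18); (15,0,7,1,18); (1,14,7,1,18);
    (0,15,7,1,18); (15,3,1,4,18); (3,15,1,4,18); (15,1,3,4,18); (7,9,3,4,18);
    (1,15,3,4,18); (7,3,9,4,18); (7,1,11,4,18); (3,5,11,4,18); (1,7,11,4,18);
    (3,3,13,4,18); (3,1,15,4,18); (1,3,15,4,18); (15,3,0,5,18); (7,11,0,5,18);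
    (3,15,0,5,18); (15,1,2,5,18); (7,9,2,5,18); (3,13,2,5,18); (1,15,2,5,18);
    (15,0,3,5,18); (1,14,3,5,18); (0,15,3,5,18); (7,1,10,5,18); (3,5,10,5,18);
    (1,7,10,5,18); (7,0,11,5,18); (3,4,11,5,18); (0,7,11,5,18); (3,1,14,5,18);
    (1,3,14,5,18); (3,0,15,5,18); (1,2,15,5,18); (0,3,15,5,18); (15,1,1,6,18);
    (3,13,1,6,18); (1,15,1,6,18); (7,1,9,6,18); (1,3,13,6,18); (1,1,15,6,18);
    (15,1,0,7,18); (3,13,0,7,18); (1,15,0,7,18); (15,0,1,7,18); (1,14,1,7,18);
    (0,15,1,7,18); (3,1,12,7,18); (1,3,12,7,18); (3,0,13,7,18); (1,2,13,7,18);
    (0,3,13,7,18); (1,1,14,7,18); (1,0,15,7,18); (0,1,15,7,18); (7,7,1,8,18);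
    (3,7,5,8,18); (7,3,4,9,18); (3,7,4,9,18); (7,1,6,9,18); (3,5,6,9,18);
    (1,7,6,9,18); (3,7,1,12,18); (3,5,3,12,18); (3,5,2,13,18); (3,1,6,13,18);
    (3,5,1,14,18); (1,7,1,14,18); (3,1,5,14,18); (1,1,6,15,18); (15,7,0,0,19);
    (15,1,6,0,19); (3,13,6,0,19); (1,15,6,0,19); (15,0,7,0,19); (1,14,7,0,19);
    (0,15,7,0,19); (7,7,8,0,19); (7,1,14,0,19); (3,5,14,0,19); (1,7,14,0,19);
    (15,1,2,4,19); (3,13,2,4,19); (1,15,2,4,19); (3,5,10,4,19); (3,1,14,4,19);
    (1,3,14,4,19); (1,2,15,4,19); (15,1,0,6,19); (3,13,0,6,19); (1,15,0,6,19);
    (15,0,1,6,19); (1,14,1,6,19); (0,15,1,6,19); (3,1,12,6,19); (1,3,12,6,19);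
    (3,0,13,6,19); (1,2,13,6,19); (0,3,13,6,19); (1,1,14,6,19); (1,0,15,6,19);
    (0,1,15,6,19); (15,0,0,7,19); (1,14,0,7,19); (0,15,0,7,19); (1,2,12,7,19);
    (1,0,14,7,19); (0,1,14,7,19); (0,0,15,7,19); (7,7,0,8,19); (3,5,6,8,19);
    (1,7,6,8,19); (7,0,7,8,19); (1,6,7,8,19); (0,7,7,8,19); (1,7,2,12,19);
    (1,2,7,12,19); (7,1,0,14,19); (3,5,0,14,19); (1,7,0,14,19); (7,0,1,14,19);
    (1,6,1,14,19); (0,7,1,14,19); (1,3,4,14,19); (3,0,5,14,19); (1,2,5,14,19);
    (0,3,5,14,19); (1,1,6,14,19); (1,0,7,14,19); (0,1,7,14,19); (15,3,1,2,20);
    (7,11,1,2,20); (3,15,1,2,20); (15,1,3,2,20); (7,9,3,2,20); (3,13,3,2,20);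
    (1,15,3,2,20); (7,3,9,2,20); (3,3,13,2,20); (3,1,15,2,20); (1,3,15,2,20);
    (3,5,10,3,20); (3,1,14,3,20); (3,7,3,8,20); (3,3,7,8,20); (7,3,1,10,20);
    (7,1,3,10,20); (3,5,3,10,20); (3,3,5,10,20); (1,7,2,11,20); (1,2,7,11,20);
    (3,3,1,14,20); (1,3,3,14,20); (3,1,2,15,20); (1,3,2,15,20); (7,1,11,0,22);
    (3,5,11,0,22); (1,7,11,0,22); (3,13,2,1,22); (3,3,12,1,22); (15,1,1,2,22);
    (7,9,1,2,22); (3,13,1,2,22); (1,15,1,2,22); (7,1,9,2,22); (3,1,13,2,22);
    (1,1,15,2,22); (1,1,14,3,22); (7,3,1,8,22); (7,1,3,8,22); (3,5,3,8,22);
    (1,7,3,8,22); (3,3,5,8,22); (1,3,7,8,22); (3,5,2,9,22); (3,1,6,9,22);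
    (1,7,1,10,22); (3,1,5,10,22); (1,1,7,10,22); (7,1,0,11,22); (3,5,0,11,22);
    (1,7,0,11,22); (7,0,1,11,22); (1,6,1,11,22); (0,7,1,11,22); (1,3,4,11,22);
    (3,0,5,11,22); (1,2,5,11,22); (0,3,5,11,22); (1,1,6,11,22); (1,0,7,11,22);
    (0,1,7,11,22); (3,3,1,12,22); (1,3,3,12,22); (3,1,1,14,22); (1,3,1,14,22);
    (1,1,3,14,22); (1,1,2,15,22); (3,5,8,2,23); (3,1,12,2,23); (1,3,12,2,23);
    (1,1,14,2,23); (3,5,2,8,23); (1,1,6,10,23); (3,1,2,12,23); (1,3,2,12,23);
    (1,1,2,14,23); (1,7,7,2,24); (7,1,6,3,24); (3,5,6,3,24); (3,7,3,4,24);
    (3,3,7,4,24); (7,3,1,6,24); (3,3,5,6,24); (3,1,7,6,24); (7,1,2,7,24);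
    (1,7,2,7,24); (1,2,7,7,24); (7,7,1,0,26); (7,1,7,0,26); (3,5,7,0,26);
    (1,7,7,0,26); (7,7,0,1,26); (3,7,4,1,26); (7,1,6,1,26); (1,7,6,1,26);
    (7,0,7,1,26); (3,4,7,1,26); (0,7,7,1,26); (7,1,3,4,26); (3,3,5,4,26);
    (7,1,2,5,26); (3,5,2,5,26); (1,7,2,5,26); (3,4,3,5,26); (1,6,3,5,26);
    (1,3,6,5,26); (7,1,1,6,26); (1,3,5,6,26); (7,1,0,7,26); (3,5,0,7,26);
    (1,7,0,7,26); (7,0,1,7,26); (1,6,1,7,26); (0,7,1,7,26); (3,1,4,7,26);
    (1,3,4,7,26); (3,0,5,7,26); (1,2,5,7,26); (0,3,5,7,26); (1,0,7,7,26);
    (0,1,7,7,26); (7,7,0,0,27); (7,1,6,0,27); (3,5,6,0,27); (1,7,6,0,27);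
    (7,0,7,0,27); (1,6,7,0,27); (0,7,7,0,27); (7,1,2,4,27); (3,5,2,4,27);
    (1,7,2,4,27); (3,1,6,4,27); (1,3,6,4,27); (1,2,7,4,27); (7,1,0,6,27);
    (3,5,0,6,27); (1,7,0,6,27); (7,0,1,6,27); (1,6,1,6,27); (0,7,1,6,27);
    (3,1,4,6,27); (1,3,4,6,27); (3,0,5,6,27); (1,2,5,6,27); (0,3,5,6,27);
    (1,0,7,6,27); (0,1,7,6,27); (7,0,0,7,27); (1,6,0,7,27); (0,7,0,7,27);
    (1,2,4,7,27); (1,0,6,7,27); (0,1,6,7,27); (0,0,7,7,27); (7,1,3,2,28);
    (3,5,3,2,28); (1,7,3,2,28); (3,1,7,2,28); (1,7,2,3,28); (3,3,4,3,28);
    (1,3,6,3,28); (3,3,1,6,28); (3,1,3,6,28); (3,1,2,7,28); (1,3,2,7,28);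
    (3,3,5,0,30); (3,5,2,1,30); (3,4,3,1,30); (1,6,3,1,30); (3,3,4,1,30);
    (3,1,6,1,30); (7,1,1,2,30); (1,7,1,2,30); (3,4,1,3,30); (1,6,1,3,30);
    (3,1,4,3,30); (1,3,4,3,30); (1,2,5,3,30); (1,1,6,3,30); (3,3,1,4,30);
    (3,1,3,4,30); (1,3,3,4,30); (3,3,0,5,30); (1,3,2,5,30); (3,0,3,5,30);
    (0,3,3,5,30); (3,1,1,6,30); (1,3,1,6,30); (1,1,3,6,30); (1,1,2,7,30)
  ].

Lemma xi18_homog : xi18 \is 18.-homog.
Proof. exact: poly_of_homog. Qed.

Lemma xi41_homog : xi41 \is 41.-homog.
Proof. exact: poly_of_homog. Qed.

Lemma phi_xi18_xi41_homog : phi xi18 + xi41 \is 41.-homog.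
Proof. exact: rpredD (phi_homog xi18_homog) xi41_homog. Qed.

(* Main.v *)
(* Let K be an extension of the field with two elements containing a root z of
   t^5 + t^2 + 1, and let the total square act on K[y_0, ..., y_4] by
   y_i |-> y_i + y_(i-1)^2 t. The embedding x_j |-> sum_i z^(j 2^i) y_i commutes with
   the squares and diagonalizes the Singer cycle of GL5, so that a subgroup of
   order 155 acts by rescaling the y_i and permuting them cyclically. Averaging an
   invariant class over this group, whose order is odd, leaves a combination of
   cyclic orbit sums of monomials y^m with 31 dividing sum_i m_i 2^i. Explicit
   relations reduce these modulo the hits to the span of 5 (degree 18) or 17
   (degree 41) orbit sums, and invariance under one further element of GL5, the
   substitution y_i |-> y_i + y_(i-1) + y_(i-2), cuts that span down to a line,
   as is seen on the values of functionals vanishing on the hits. A linear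
   coordinate on K brings the conclusion back to the field with two elements.

   Conversely the given classes are invariant under a transvection and a 5-cycle,
   which generate GL5, by explicit relations; and they are not zero, because a
   functional vanishing on the hits takes the value 1 on them. The relations are
   shortened by discarding the monomials of low weight, which are hit by the
   chi-trick: modulo hits, u Sq^d(v) is chi(Sq^d)(u) v. *)

Require Import Defs.
From Stdlib Require Import NArith PArith Ascii String.
From HB Require Import structures.
From mathcomp Require Import all_boot all_order all_fingroup all_algebra all_field.
From mathcomp Require Import ring zify.
From mathcomp.multinomials Require Import mpoly.

Set Implicit Arguments.
Unset Strict Implicit.
Unset Printing Implicit Defensive.

Import GRing.Theory.

Local Open Scope ring_scope.

Local Notation act := Defs.act.

(** * Monomials and their expansions *)

(** In degree 41 there are 148995 monomials, and the quotient is too large to be handled through a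
    basis. The eigenvector coordinates are chosen because the Singer cycle and the Frobenius
    together leave only about a thousand cyclic orbits of monomials to reduce. The scalars of K do
    not complicate the computation: in the coordinates y_i the twisted squares, the cyclic
    permutation and the substitution y_i |-> y_i + y_(i-1) + y_(i-2) all have coefficients 0 and 1,
    and powers of z occur only in the passage between x and y and in the rescaling. A list of
    exponents taken modulo two therefore represents a polynomial over every field with 1 + 1 = 0,
    and one set of checks serves both K and the field with two elements. The extra group element is
    chosen to commute with the cyclic permutation, so that it acts on orbit sums. Evidence is of two
    kinds only: explicit squares, which put a class in a span, and functionals killing the hits,
    which separate classes. The orbit sums of the base have to span but may be dependent; a line
    that contains one nonzero known class is spanned by it. *)

Inductive expo := Expo of N & N & N & N & N.

Definition emon (z : expo) : 'X_{1..5} :=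
  let: Expo a b c d e := z in
  mono (N.to_nat a, N.to_nat b, N.to_nat c, N.to_nat d, N.to_nat e).

Definition addv (v : nat) (n : N) (z : expo) : expo :=
  if n is N0 then z else
  let: Expo a b c d e := z in
  match v with
  | 0 => Expo (N.add a n) b c d e
  | 1 => Expo a (N.add b n) c d e
  | 2 => Expo a b (N.add c n) d e
  | 3 => Expo a b c (N.add d n) e
  | _ => Expo a b c d (N.add e n)
  end.

(* An option (v, e, w) stands for the monomial X_v^e t^w. *)
Definition opt := (nat * N * nat)%type.

Definition double_opt (o : opt) : opt :=
  let: (v, e, w) := o in (v, N.double e, (w + w)%N).

(** In characteristic two f^p is the product of the f^(2^i) over the binary digits of p, and f^(2^i)
    has as many terms as f. Expanding these factors produces no binomial coefficients and few
    repeated terms. *)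
Fixpoint pow_opts (f : seq opt) (p : positive) : seq (seq opt) :=
  match p with
  | xH => [:: f]
  | xO q => pow_opts [seq double_opt o | o <- f] q
  | xI q => f :: pow_opts [seq double_opt o | o <- f] q
  end.

Definition npow_opts (f : seq opt) (n : N) : seq (seq opt) :=
  if n is Npos p then pow_opts f p else [::].

Definition factors (W : nat -> seq opt) (z : expo) : seq (seq opt) :=
  let: Expo a b c d e := z in
  npow_opts (W 0%N) a ++ npow_opts (W 1%N) b ++ npow_opts (W 2%N) c
    ++ npow_opts (W 3%N) d ++ npow_opts (W 4%N) e.

Fixpoint sub_opt (k w : nat) : option nat :=
  match w, k with
  | 0, _ => Some k
  | w'.+1, k'.+1 => sub_opt k' w'
  | _.+1, 0 => None
  end.

(** Choosing one option in each factor, [k] is the t-weight still to be spent, and a branch is cut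
    as soon as an option would exceed it. The results are put in front of [tl], which spares
    concatenations. *)
Fixpoint terms (fs : seq (seq opt)) (k : nat) (acc : expo) (tl : seq expo)
    : seq expo :=
  if fs is f :: fs' then
    (fix choices (f : seq opt) : seq expo :=
       if f is (v, e, w) :: f' then
         if sub_opt k w is Some k'
         then terms fs' k' (addv v e acc) (choices f')
         else choices f'
       else tl) f
  else if k is 0 then acc :: tl else tl.

Lemma sub_optE k w : sub_opt k w = if (w <= k)%N then Some (k - w)%N else None.
Proof. by elim: w k => [|w IH] [|k] //=; rewrite ?subn0 // IH ltnS subSS. Qed.

Lemma emon_addv v n z : (v < 5)%N ->
  emon (addv v n z) = (emon z + U_(inord v) *+ N.to_nat n)%MM.
Proof.
move=> v5; have -> : emon (addv v n z) =
    emon (let: Expo a b c d e := z in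
  match v with
  | 0 => Expo (N.add a n) b c d e
  | 1 => Expo a (N.add b n) c d e
  | 2 => Expo a b (N.add c n) d e
  | 3 => Expo a b c (N.add d n) e
  | _ => Expo a b c d (N.add e n)
  end).
  case: n z => [|n] [a b c d e] //=.
  by case: v v5 => [|[|[|[|v]]]] _ /=; rewrite N.add_0_r.
apply/mnmP => i; rewrite mnmDE mulmnE mnm1E -val_eqE /= inordK //.
case: z => a b c d e; move: v5.
case: i => [[|[|[|[|[|//]]]]] Hi]; case: v => [|[|[|[|[|//]]]]] _ /=;
  by rewrite !multinomE /= ?(tnth_nth 0%N) /= ?N2Nat.inj_add ?mul0n ?mul1n
     ?addn0.
Qed.

Lemma emon0 : emon (Expo 0 0 0 0 0) = 0%MM.
Proof.
by apply/mnmP => i; rewrite mnm0E multinomE (tnth_nth 0%N);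
  case: i => [[|[|[|[|[|//]]]]] Hi].
Qed.

Section Char2.

Variable F : fieldType.
Hypothesis F2 : (1 + 1 : F) = 0.

Notation P := {mpoly F[5]}.

Lemma mpoly_addxx (x : P) : x + x = 0.
Proof.
have -> : x + x = (1 + 1 : F) *: x by rewrite scalerDl !scale1r.
by rewrite F2 scale0r.
Qed.

Lemma poly_addxx (x : {poly P}) : x + x = 0.
Proof. by apply/polyP => i; rewrite coefD coef0 mpoly_addxx. Qed.

Lemma sqr_sum (T : Type) (s : seq T) (G : T -> {poly P}) :
  (\sum_(i <- s) G i) ^+ 2 = \sum_(i <- s) (G i) ^+ 2.
Proof.
elim: s => [|x s IH]; first by rewrite !big_nil expr0n.
by rewrite !big_cons sqrrD mulr2n poly_addxx addr0 IH.
Qed.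

Definition opt_val (o : opt) : {poly P} :=
  let: (v, e, w) := o in ('X_(inord v) ^+ N.to_nat e)%:P * 'X^w.

Definition opts_val (f : seq opt) : {poly P} := \sum_(o <- f) opt_val o.

Lemma opt_val_double o : opt_val (double_opt o) = opt_val o ^+ 2.
Proof.
case: o => [[v e] w] /=.
by rewrite exprMn -rmorphXn /= -!exprM N2Nat.inj_double mulnC muln2 addnn.
Qed.

Lemma opts_val_double f :
  opts_val [seq double_opt o | o <- f] = opts_val f ^+ 2.
Proof.
rewrite /opts_val sqr_sum big_map; apply: eq_bigr => o _.
exact: opt_val_double.
Qed.

Lemma pow_optsE f p :
  \prod_(g <- pow_opts f p) opts_val g = opts_val f ^+ Pos.to_nat p.
Proof.
elim: p f => [q IH|q IH|] f /=; last by rewrite big_seq1.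
- by rewrite big_cons IH opts_val_double -exprM -exprS mulnC Pos2Nat.inj_xI
     -[(2 * _)%coq_nat]/(2 * _)%N mulnC.
- by rewrite IH opts_val_double -exprM Pos2Nat.inj_xO.
Qed.

Lemma npow_optsE f n :
  \prod_(g <- npow_opts f n) opts_val g = opts_val f ^+ N.to_nat n.
Proof. by case: n => [|p] /=; rewrite ?big_nil ?expr0 // pow_optsE. Qed.

Lemma factorsE W z :
  \prod_(g <- factors W z) opts_val g
  = \prod_(i < 5) opts_val (W i) ^+ emon z i.
Proof.
case: z => a b c d e; rewrite /factors !big_cat !npow_optsE /=.
rewrite !big_ord_recl big_ord0 mulr1 !multinomE !(tnth_nth 0%N) /=.
by rewrite !mulrA.
Qed.

Definition opt_ok (o : opt) : bool := (o.1.1 < 5)%N.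

Lemma termsE fs k acc tl :
  all (all opt_ok) fs ->
  \sum_(m <- terms fs k acc tl) 'X_[emon m]
  = 'X_[emon acc] * (\prod_(f <- fs) opts_val f)`_k
    + \sum_(m <- tl) 'X_[emon m] :> P.
Proof.
elim: fs k acc tl => [|f fs IH] k acc tl.
  move=> _; rewrite big_nil coef1; case: k => [|k] /=.
    by rewrite mulr1 big_cons.
  by rewrite mulr0 add0r.
case/andP => okf okfs; rewrite big_cons /= {1}/opts_val mulr_suml coef_sum.
elim: f okf => [|[[v e] w] f IHf]; first by rewrite !big_nil mulr0 add0r.
case/andP => v5 okf; rewrite big_cons mulrDr -addrA -IHf //= sub_optE.
rewrite -mulrA coefCM coefXnM; case: leqP => [le_wk|lt_kw]; last first.
  by rewrite mulr0 mulr0 add0r.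
by rewrite IH // emon_addv // mpolyXD mulrA mpolyXn.
Qed.

End Char2.

(** * Binary tries as sets of monomials modulo two *)

Inductive trie := Leaf | Node of trie & bool & trie.

Fixpoint toggle (p : positive) (t : trie) : trie :=
  match p, t with
  | xH, Leaf => Node Leaf true Leaf
  | xH, Node l b r => Node l (~~ b) r
  | xO q, Leaf => Node (toggle q Leaf) false Leaf
  | xO q, Node l b r => Node (toggle q l) b r
  | xI q, Leaf => Node Leaf false (toggle q Leaf)
  | xI q, Node l b r => Node l b (toggle q r)
  end.

Fixpoint tmem (p : positive) (t : trie) : bool :=
  match p, t with
  | _, Leaf => false
  | xH, Node _ b _ => b
  | xO q, Node l _ _ => tmem q l
  | xI q, Node _ _ r => tmem q r
  end.

(** The function [c] records the path from the root: it rebuilds a full key from the part of it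
    below the current node. *)
Fixpoint telts (t : trie) (c : positive -> positive) (tl : seq positive) :=
  if t is Node l b r then
    let tl' := telts l (fun q => c (xO q)) (telts r (fun q => c (xI q)) tl) in
    if b then c xH :: tl' else tl'
  else tl.

Definition elements (t : trie) : seq positive := telts t id [::].

Fixpoint parity_trie (s : seq positive) (t : trie) : trie :=
  if s is p :: s' then parity_trie s' (toggle p t) else t.

Lemma pos_eqP : Equality.axiom Pos.eqb.
Proof. by move=> p q; apply: (iffP idP) => /Pos.eqb_eq. Qed.
HB.instance Definition _ := hasDecEq.Build positive pos_eqP.

Lemma tmem_Leaf q : tmem q Leaf = false. Proof. by case: q. Qed.

Lemma tmem_toggle p q t : tmem q (toggle p t) = (q == p) (+) tmem q t.
Proof.
by elim: p q t => [p IH|p IH|] [q|q|] [|l b r] //=;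
  rewrite ?IH ?tmem_Leaf ?addbF.
Qed.

Lemma tmem_parity q s t :
  tmem q (parity_trie s t) = odd (count_mem q s) (+) tmem q t.
Proof.
elim: s t => [|p s IH] t //=; rewrite IH tmem_toggle oddD.
by rewrite [p == q]eq_sym; case: (q == p); case: (odd _); case: (tmem _ _).
Qed.

Lemma telts_perm (t : trie) c tl :
  perm_eq (telts t c tl) (map c (telts t id [::]) ++ tl).
Proof.
elim: t c tl => [|l IHl b r IHr] c tl //=.
have h : perm_eq (telts l (fun q => c (xO q)) (telts r (fun q => c (xI q)) tl))
   (map c (telts l xO (telts r xI [::])) ++ tl).
  apply: (perm_trans (IHl _ _)).
  have := perm_map c (IHl xO (telts r xI [::])).
  rewrite map_cat -map_comp => h1; rewrite perm_sym.
  apply: (perm_trans (perm_cat h1 (perm_refl tl))); rewrite -catA perm_cat2l.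
  have := perm_map c (IHr xI [::]); rewrite cats0 -map_comp => h2.
  apply: (perm_trans (perm_cat h2 (perm_refl tl))).
  by rewrite perm_sym; apply: IHr.
by case: b => //=; rewrite perm_cons.
Qed.

Lemma mem_elements q t : (q \in elements t) = tmem q t.
Proof.
rewrite /elements; elim: t q => [|l IHl b r IHr] q; first by case: q.
have -> : (q \in telts (Node l b r) id [::]) =
   (b && (q == xH)) || (q \in map xO (telts l id [::]) ++ map xI (telts r id [::])).
  rewrite /=; have hp := perm_mem (perm_trans (telts_perm l xO (telts r xI [::]))
     (perm_cat (perm_refl _) (telts_perm r xI [::]))).
  rewrite cats0 in hp; case: b; first by rewrite inE hp.
  by rewrite hp.
rewrite mem_cat; case: q => [q|q|] /=.
- rewrite andbF /= -IHr; rewrite mem_map; last by move=> ? ? [].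
  rewrite [_ \in map xO _](_ : _ = false) //.
  by apply/mapP => -[].
- rewrite andbF /= -IHl mem_map; last by move=> ? ? [].
  rewrite [_ \in map xI _](_ : _ = false) ?orbF //.
  by apply/mapP => -[].
- rewrite eqxx andbT; case: b => //=.
  by apply/negbTE; rewrite negb_or; apply/andP; split; apply/mapP => -[].
Qed.

Lemma elements_uniq t : uniq (elements t).
Proof.
rewrite /elements; elim: t => [|l IHl b r IHr] //.
have hp := (perm_trans (telts_perm l xO (telts r xI [::]))
     (perm_cat (perm_refl _) (telts_perm r xI [::]))).
rewrite cats0 in hp.
have u : uniq (telts l xO (telts r xI [::])).
  rewrite (perm_uniq hp) cat_uniq !map_inj_uniq ?IHl ?IHr //=; try by move=> ? ? [].
  by rewrite andbT; apply/hasPn => x /mapP[y _ ->]; apply/mapP => -[].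
rewrite /=; case: b => //=; rewrite u andbT (perm_mem hp) mem_cat negb_or.
by apply/andP; split; apply/mapP => -[].
Qed.

(* In characteristic two a sum only depends on the parities of the
   multiplicities. *)
Lemma sum_parity (V : nmodType) (G : positive -> V) s :
  (forall x : V, x + x = 0) ->
  \sum_(p <- s) G p = \sum_(p <- elements (parity_trie s Leaf)) G p.
Proof.
move=> V2; pose H (t : trie) := \sum_(p <- elements t) G p.
have Htog p t : H (toggle p t) = G p + H t.
  have [pt|npt] := boolP (tmem p t).
    have hp : perm_eq (elements t) (p :: elements (toggle p t)).
      apply: uniq_perm; rewrite ?elements_uniq //=.
        by rewrite mem_elements tmem_toggle eqxx pt elements_uniq.
      move=> q; rewrite inE !mem_elements tmem_toggle.
      by case: eqP => [->|] //=; rewrite ?pt.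
    by rewrite /H (perm_big _ hp) big_cons /= addrA V2 add0r.
  have hp : perm_eq (elements (toggle p t)) (p :: elements t).
    apply: uniq_perm; rewrite ?elements_uniq //=.
      by rewrite mem_elements npt elements_uniq.
    move=> q; rewrite inE !mem_elements tmem_toggle.
    by case: eqP => [->|] //=; rewrite ?(negbTE npt).
  by rewrite /H (perm_big _ hp) big_cons.
have E t : \sum_(p <- s) G p + H t = H (parity_trie s t).
  elim: s t => [|p s IH] t; first by rewrite big_nil add0r.
  by rewrite big_cons /= -IH Htog addrCA addrA.
by have := E Leaf; rewrite {1}/H /elements /= big_nil addr0.
Qed.

(** * Packing five exponents into one binary number *)

Fixpoint push (k : nat) (n : N) (rest : positive) : positive :=
  if k is k'.+1 then
    match n with
    | N0 => xO (push k' N0 rest)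
    | Npos xH => xI (push k' N0 rest)
    | Npos (xO q) => xO (push k' (Npos q) rest)
    | Npos (xI q) => xI (push k' (Npos q) rest)
    end
  else rest.

Fixpoint pop (k : nat) (p : positive) : N * positive :=
  if k is k'.+1 then
    match p with
    | xO q => let: (n, r) := pop k' q in (N.double n, r)
    | xI q => let: (n, r) := pop k' q in (N.succ_double n, r)
    | xH => (N0, xH)
    end
  else (N0, p).

(* Six bits per exponent, so that decoding inverts encoding only when all the
   exponents are below 64. *)
Definition encode (z : expo) : positive :=
  let: Expo a b c d e := z in
  push 6 a (push 6 b (push 6 c (push 6 d (push 6 e xH)))).

Definition decode (p : positive) : expo :=
  let: (a, p) := pop 6 p in let: (b, p) := pop 6 p in
  let: (c, p) := pop 6 p in let: (d, p) := pop 6 p in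
  let: (e, _) := pop 6 p in Expo a b c d e.

Lemma pop_push k n r : (N.to_nat n < 2 ^ k)%N -> pop k (push k n r) = (n, r).
Proof.
elim: k n => [|k IH] n; first case: n => // p.
  by rewrite /= expn0 ltnS leqNgt; move/ltP: (Pos2Nat.is_pos p) => ->.
have k0 : (N.to_nat 0 < 2 ^ k)%N by rewrite expn_gt0.
case: n => [|[q|q|]] /=; rewrite ?(IH _ k0) //.
- rewrite Pos2Nat.inj_xI -[(2 * _)%coq_nat]/(2 * _)%N expnS => h.
  by rewrite IH // -(ltn_pmul2l (isT : 0 < 2)%N); apply: leq_trans h; apply: leqnSn.
- rewrite Pos2Nat.inj_xO -[(2 * _)%coq_nat]/(2 * _)%N expnS => h.
  by rewrite IH // -(ltn_pmul2l (isT : 0 < 2)%N).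
Qed.

Lemma mdeg_emon a b c d e : mdeg (emon (Expo a b c d e)) =
  (N.to_nat a + (N.to_nat b + (N.to_nat c + (N.to_nat d + N.to_nat e))))%N.
Proof.
rewrite mdegE !big_ord_recl big_ord0 addn0.
by rewrite /emon /mono !multinomE !(tnth_nth 0%N).
Qed.

Lemma encodeK z : (mdeg (emon z) < 64)%N -> decode (encode z) = z.
Proof.
case: z => a b c d e; rewrite mdeg_emon (_ : 64%N = (2 ^ 6)%N) // => h.
have lt m n l : (m + n < l -> m < l /\ n < l)%N.
  by move=> mn; split; apply: leq_ltn_trans mn; rewrite ?leq_addr ?leq_addl.
have [ha {}h] := lt _ _ _ h; have [hb {}h] := lt _ _ _ h.
have [hc {}h] := lt _ _ _ h; have [hd he] := lt _ _ _ h.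
by rewrite /decode /encode; do 5 rewrite pop_push //.
Qed.

Lemma emon_inj : injective emon.
Proof.
move=> [a b c d e] [a' b' c' d' e'] /mnmP h.
have:= h 0; have:= h 1; have:= h (inord 2); have:= h (inord 3); have:= h (inord 4).
rewrite !multinomE !(tnth_nth 0%N) /= !inordK //=.
by do 5 move=> /N2Nat.inj ->.
Qed.

HB.instance Definition _ := Equality.copy expo (inj_type emon_inj).

(** * Twisted Steenrod squares and the chi-trick *)

Lemma mpoly_rmorph_ext (R : nzRingType) (S : nzRingType) n
    (f g : {rmorphism {mpoly R[n]} -> S}) :
  (forall c, f c%:MP = g c%:MP) -> (forall i, f 'X_i = g 'X_i) -> f =1 g.
Proof.
move=> hC hX p; rewrite (mpolyE p) !rmorph_sum; apply: eq_bigr => m _ /=.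
rewrite -mul_mpolyC !rmorphM /= hC; congr (_ * _).
rewrite mpolyXE_id !rmorph_prod; apply: eq_bigr => i _ /=.
by rewrite !rmorphXn /= hX.
Qed.

Section TotalSquare.

Variable F : fieldType.
Hypothesis F2 : (1 + 1 : F) = 0.

Notation P := {mpoly F[5]}.

Section Tau.

Variable tau : 'I_5 -> 'I_5.

(* For tau = id these are the Steenrod squares with coefficients in F. *)
Definition tsq : P -> {poly P} :=
  mmap (polyC \o @mpolyC 5 F)
    (fun j => ('X_j)%:P + ('X_(tau j) ^+ 2)%:P * 'X).

HB.instance Definition _ := GRing.RMorphism.on tsq.

Definition sqt (k : nat) (f : P) : P := (tsq f)`_k.

Lemma tsqX j : tsq 'X_j = ('X_j)%:P + ('X_(tau j) ^+ 2)%:P * 'X.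
Proof. by rewrite /tsq mmapX mmap1U. Qed.

Lemma tsqC c : tsq c%:MP = (c%:MP)%:P.
Proof. by rewrite /tsq mmapC. Qed.

Lemma tsqZ c f : tsq (c *: f) = (c%:MP)%:P * tsq f.
Proof. by rewrite /tsq mmapZ. Qed.

Lemma sqtD k : {morph sqt k : f g / f + g}.
Proof. by move=> f g; rewrite /sqt rmorphD coefD. Qed.

Lemma sqtZ k c f : sqt k (c *: f) = c *: sqt k f.
Proof. by rewrite /sqt tsqZ coefCM mul_mpolyC. Qed.

Lemma sqt0 k : sqt k 0 = 0.
Proof. by rewrite /sqt rmorph0 coef0. Qed.

Lemma sqt_sum k (I : Type) (r : seq I) (Q : pred I) (G : I -> P) :
  sqt k (\sum_(i <- r | Q i) G i) = \sum_(i <- r | Q i) sqt k (G i).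
Proof.
exact: (big_morph _ (sqtD k) (sqt0 k)).
Qed.

Lemma sqt_deg0 f : sqt 0 f = f.
Proof.
rewrite /sqt -horner_coef0 -[LHS]/((horner_eval 0 \o tsq) f) -[RHS]/(idfun f).
apply: mpoly_rmorph_ext => [c|i] /=.
  by rewrite tsqC /horner_eval hornerC.
by rewrite tsqX /horner_eval !hornerE.
Qed.

(* The image of the squares of positive degree; hitP below identifies it with
   hit when F is the field with two elements and tau = id. *)
Definition hits (f : P) : Prop :=
  exists s : seq (nat * P), f = \sum_(p <- s) sqt p.1.+1 p.2.

Lemma hits0 : hits 0.
Proof. by exists [::]; rewrite big_nil. Qed.

Lemma hitsD f g : hits f -> hits g -> hits (f + g).
Proof. by move=> [s ->] [t ->]; exists (s ++ t); rewrite big_cat. Qed.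

Lemma hitsZ c f : hits f -> hits (c *: f).
Proof.
move=> [s ->]; exists [seq (p.1, c *: p.2) | p <- s].
by rewrite scaler_sumr big_map; apply: eq_bigr => p _; rewrite sqtZ.
Qed.

Lemma hits_sum (I : Type) (r : seq I) (Q : pred I) (G : I -> P) :
  (forall i, Q i -> hits (G i)) -> hits (\sum_(i <- r | Q i) G i).
Proof.
move=> h; elim/big_rec: _ => [|i f Qi hf]; first exact: hits0.
exact: hitsD (h i Qi) hf.
Qed.

Lemma hits_sqt k f : (0 < k)%N -> hits (sqt k f).
Proof. by case: k => // k _; exists [:: (k, f)]; rewrite big_seq1. Qed.

Lemma hits_subst f g : hits (f + g) -> hits g -> hits f.
Proof.
by move=> hfg hg; rewrite -[f]addr0 -(mpoly_addxx F2 g) addrA; apply: hitsD.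
Qed.

(** For the identity twist this is Milnor's formula: the conjugate of the total square sends x to
    the sum of the x^(2^a) t^(2^a - 1). The first omitted term has t-weight 63, whence
    [chi_bound]. *)
Definition chi_gen (i : 'I_5) : {poly P} :=
  \sum_(a < 6) ('X_(iter a tau i) ^+ (2 ^ a))%:P * 'X^(2 ^ a - 1).

(* The conjugate of the total square, truncated above degree 62. *)
Definition tchi : P -> {poly P} := mmap (polyC \o @mpolyC 5 F) chi_gen.

HB.instance Definition _ := GRing.RMorphism.on tchi.

Definition chit (k : nat) (f : P) : P := (tchi f)`_k.

(** The extension of the total square to P[t] that fixes t; with it the total square can be composed
    with its conjugate. *)
Definition tsq_ext : {poly P} -> {poly P} := horner_eval 'X \o map_poly tsq.

HB.instance Definition _ := GRing.RMorphism.on tsq_ext.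

Lemma tchiD f g : tchi (f + g) = tchi f + tchi g.
Proof. exact: rmorphD. Qed.

Lemma tchiM f g : tchi (f * g) = tchi f * tchi g.
Proof. exact: rmorphM. Qed.

Lemma tsq_extD f g : tsq_ext (f + g) = tsq_ext f + tsq_ext g.
Proof. exact: rmorphD. Qed.

Lemma tsq_extM f g : tsq_ext (f * g) = tsq_ext f * tsq_ext g.
Proof. exact: rmorphM. Qed.

Lemma tsq_extC (f : P) : tsq_ext f%:P = tsq f.
Proof. by rewrite /tsq_ext /= map_polyC /horner_eval hornerC. Qed.

Lemma tsq_extXn n : tsq_ext 'X^n = 'X^n.
Proof. by rewrite rmorphXn /= /tsq_ext /= map_polyX /horner_eval hornerX. Qed.

Lemma coef_tsq_ext (p : {poly P}) k :
  (tsq_ext p)`_k = \sum_(i < k.+1) sqt (k - i) p`_i.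
Proof.
have E : tsq_ext p = \sum_(i < size p) tsq p`_i * 'X^i.
  rewrite /tsq_ext /horner_eval /= map_polyE.
  rewrite (@horner_coef_wide _ (size p)); last first.
    by apply: leq_trans (size_Poly _) _; rewrite size_map.
  apply: eq_bigr => i _; congr (_ * _).
  by rewrite coef_Poly (nth_map 0).
rewrite E coef_sum.
rewrite (eq_bigr (fun i : 'I_(size p) => if (i <= k)%N then sqt (k - i) p`_i else 0)).
  have [le|lt] := leqP (size p) k.+1.
    rewrite (big_ord_widen_cond k.+1 xpredT
      (fun i => if (i <= k)%N then sqt (k - i) p`_i else 0)) //.
    rewrite big_mkcond; apply: eq_bigr => i _ /=.
    have -> : (i <= k)%N by rewrite -ltnS.
    by case: ltnP => // hi; rewrite (nth_default _ hi) sqt0.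
  rewrite (big_ord_widen_cond (size p) xpredT (fun i => sqt (k - i) p`_i)); last exact: ltnW.
  by rewrite [RHS]big_mkcond /=; apply: eq_bigr => i _; rewrite ltnS.
by move=> i _; rewrite coefMXn ltnNge; case: leqP.
Qed.

Definition chi_bound : nat := 63.

(** The polynomials with this property are closed under sums and products and contain the constants.
    On a variable the extended square sends the term a of [chi_gen] to the sum of the terms a and a
    + 1, so that the total telescopes to the terms 0 and 6. *)
Lemma tsq_chi u : exists q, tsq_ext (tchi u) = u%:P + 'X^chi_bound * q.
Proof.
have [n nE] : {n | n = chi_bound} by exists chi_bound.
rewrite -nE.
have okD f g : (exists q, tsq_ext (tchi f) = f%:P + 'X^n * q) ->
    (exists q, tsq_ext (tchi g) = g%:P + 'X^n * q) ->
    (exists q, tsq_ext (tchi (f + g)) = (f + g)%:P + 'X^n * q).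
  move=> [q hq] [r hr]; exists (q + r).
  rewrite tchiD tsq_extD; apply: etrans (congr2 +%R hq hr) _.
  by rewrite polyCD mulrDr addrACA.
have okM f g : (exists q, tsq_ext (tchi f) = f%:P + 'X^n * q) ->
    (exists q, tsq_ext (tchi g) = g%:P + 'X^n * q) ->
    (exists q, tsq_ext (tchi (f * g)) = (f * g)%:P + 'X^n * q).
  move=> [q hq] [r hr]; exists (q * (g%:P + 'X^n * r) + f%:P * r).
  rewrite tchiM tsq_extM; apply: etrans (congr2 *%R hq hr) _; rewrite polyCM.
  move: f%:P g%:P 'X^n => x y z.
  by ring.
have okC c : exists q, tsq_ext (tchi c%:MP) = (c%:MP)%:P + 'X^n * q.
  exists 0; rewrite mulr0 addr0 /tchi mmapC /= tsq_extC tsqC.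
  by [].
have okX i : exists q, tsq_ext (tchi 'X_i) = ('X_i)%:P + 'X^n * q.
  (* The term a = 6, the first one that [chi_gen] lacks, is the error. *)
  exists (('X_(iter 6 tau i) ^+ (2 ^ 6))%:P); rewrite /tchi mmapX mmap1U.
  rewrite /chi_gen (big_morph _ tsq_extD (rmorph0 tsq_ext)).
  have E a : tsq_ext (('X_(iter a tau i) ^+ (2 ^ a))%:P * 'X^(2 ^ a - 1)) =
      ('X_(iter a tau i) ^+ (2 ^ a))%:P * 'X^(2 ^ a - 1)
      + ('X_(iter a.+1 tau i) ^+ (2 ^ a.+1))%:P * 'X^(2 ^ a.+1 - 1).
    rewrite tsq_extM tsq_extC tsq_extXn (rmorphXn tsq) /= tsqX.
    have fr (x y : {poly P}) : (x + y) ^+ (2 ^ a) = x ^+ (2 ^ a) + y ^+ (2 ^ a).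
      elim: a => [|a IH]; rewrite ?expn0 ?expr1 // expnSr !exprM IH.
      by rewrite sqrrD mulr2n (poly_addxx F2) addr0.
    rewrite fr exprMn mulrDl -!rmorphXn /= -exprM -expnS -mulrA -exprD.
    congr (_ + _ * 'X^_); rewrite expnS mul2n -addnn addnBA ?expn_gt0 //.
  under eq_bigr => a _ do rewrite E.
  rewrite !big_ord_recr big_ord0 /= add0r.
  rewrite -!addrA; congr (_ + _).
    by rewrite expr1 subnn mulr1.
  do 5 (rewrite addrA (poly_addxx F2) add0r).
  by rewrite mulrC nE.
rewrite (mpolyE u); elim/big_rec: _ => [|m f _ okf].
  by exists 0; rewrite /tchi mmap0 -[0]polyC0 tsq_extC /tsq mmap0 mulr0 addr0.
refine (okD _ _ _ okf); rewrite -mul_mpolyC; refine (okM _ _ (okC _) _).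
have ok1 : exists q, tsq_ext (tchi 1) = 1%:P + 'X^n * q.
  by have := okC 1; rewrite mpolyC1.
rewrite mpolyXE_id; elim/big_rec: _ => [|i g _ okg]; first exact: ok1.
refine (okM _ _ _ okg); elim: (m i) => [|k IH]; first exact: ok1.
by rewrite exprS; exact: okM (okX i) IH.
Qed.

(** Compare two expressions for the coefficient of t^k in the extended square of chi(u) v. By
    [tsq_chi] it is u Sq^k(v); expanded over the coefficients of chi(u) v, it is a sum of squares of
    positive degree and of the term chi_k(u) v. *)
Lemma chi_trick k u v : (0 < k < chi_bound)%N -> hits (u * sqt k v + chit k u * v).
Proof.
move=> /andP[k0 k63]; have [q hq] := tsq_chi u.
have E1 : (tsq_ext (tchi u * v%:P))`_k = u * sqt k v.
  rewrite tsq_extM hq tsq_extC.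
  by rewrite mulrDl coefD coefCM -mulrA coefXnM k63 addr0.
have := coef_tsq_ext (tchi u * v%:P) k.
rewrite E1 big_ord_recr /= subnn sqt_deg0 coefMC => ->.
rewrite -addrA (mpoly_addxx F2) addr0; apply: hits_sum => i _.
by apply: hits_sqt; rewrite subn_gt0.
Qed.

(** The total square of a variable has degree one in t, so the coefficient at t^(deg w) is the
    product of the top coefficients. The predicate [top] pairs a bound on the size with the
    coefficient there, and such pairs multiply. *)
Lemma sqt_top (w : 'X_{1..5}) :
  sqt (mdeg w) 'X_[w] = \prod_(i < 5) 'X_(tau i) ^+ (2 * w i).
Proof.
have size_mulX_leq (c : P) : (size ('X * c%:P : {poly P})%R <= 2)%N.
  apply: leq_trans (size_polyMleq _ _) _.
  by rewrite size_polyX; exact: size_polyC_leq1.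
pose top (p : {poly P}) d e := (size p <= d.+1)%N /\ p`_d = e.
have topM p q d d' e e' : top p d e -> top q d' e' -> top (p * q) (d + d')%N (e * e').
  move=> [sp pd] [sq qd]; split.
    by apply: leq_trans (size_polyMleq _ _) _; rewrite -subn1 leq_subLR;
      apply: leq_trans (leq_add sp sq) _; rewrite addSn addnS add1n.
  have dd : (d < (d + d')%N.+1)%N by rewrite ltnS leq_addr.
  rewrite coefM (bigD1 (Ordinal dd)) //= addKn pd qd.
  rewrite big1 ?addr0 // => i /eqP ne.
  have [lt|le] := ltnP i d.
    rewrite [q`_ _]nth_default ?mulr0 //; apply: leq_trans sq _.
    by rewrite ltn_subRL ltn_add2r.
  rewrite [p`_ _]nth_default ?mul0r //; apply: leq_trans sp _.
  rewrite ltn_neqAle le andbT; apply/eqP => di; apply: ne.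
  exact/val_inj.
have top1 : top 1 0%N 1 by split; rewrite ?size_poly1 ?coef1.
have topX i : top (tsq 'X_i) 1%N ('X_(tau i) ^+ 2).
  rewrite tsqX; split.
    apply: leq_trans (size_polyD _ _) _; rewrite geq_max.
    rewrite (leq_trans (size_polyC_leq1 _)) // mulrC size_mulX_leq //.
  by rewrite coefD coefC coefMX coefC /= add0r.
have -> : sqt (mdeg w) 'X_[w] = (tsq 'X_[w])`_(mdeg w) by [].
suff : top (tsq 'X_[w]) (mdeg w) (\prod_(i < 5) 'X_(tau i) ^+ (2 * w i)) by case.
rewrite mpolyXE_id rmorph_prod /= mdegE.
elim/big_rec3: _ => [|i e d p _ IH]; first exact: top1.
apply: (topM _ _ _ _ _ _ _ IH); rewrite rmorphXn /=.
elim: (w i) => [|k IHk]; first by rewrite muln0 !expr0.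
rewrite exprS mulnS exprD; exact: (topM _ _ 1%N k _ _ (topX i) IHk).
Qed.

Fixpoint chi_chain (r d : nat) (u : P) : P :=
  if r is r'.+1 then chi_chain r' d (chit (2 ^ r' * d) u) else u.

(* A^(2^(r+1)) is the top square of A^(2^r) up to tau, and chi_trick moves it
   across u. *)
Lemma chi_chain_hits r d u (w : 'X_{1..5}) :
  injective tau -> (0 < d)%N -> mdeg w = d -> (2 ^ r * d < 2 * chi_bound)%N ->
  chi_chain r d u = 0 -> hits (u * 'X_[w *+ 2 ^ r]).
Proof.
move=> tau_inj d0; elim: r u w => [|r IH] u w wd rd /=.
  by move=> ->; rewrite mul0r; apply: hits0.
(* The top square moves the exponent of a variable to its image under [tau], so the preimage of w
   carries at i the exponent of w at [tau i]. *)
move=> chi0; pose w' := [multinom w (tau i) | i < 5].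
have w'd : mdeg w' = d.
  rewrite -wd !mdegE [RHS](reindex_inj tau_inj) /=.
  by apply: eq_bigr => i _; rewrite mnmE.
have w'r : mdeg (w' *+ 2 ^ r) = (2 ^ r * d)%N by rewrite mdegMn w'd mulnC.
have E : 'X_[w *+ 2 ^ r.+1] = sqt (2 ^ r * d) 'X_[w' *+ 2 ^ r] :> P.
  rewrite -w'r sqt_top mpolyXE_id (reindex_inj tau_inj) /=.
  apply: eq_bigr => i _; rewrite !mulmnE mnmE expnS; congr (_ ^+ _).
  by rewrite mulnCA mulnA mulnC mulnA.
rewrite E; apply: hits_subst (IH _ _ w'd _ chi0).
  apply: chi_trick; rewrite muln_gt0 expn_gt0 d0 /=.
  by move: rd; rewrite expnS -mulnA ltn_pmul2l.
by apply: leq_ltn_trans rd; rewrite leq_mul2r leq_exp2l // leqnSn orbT.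
Qed.

End Tau.

End TotalSquare.

(** * Computing squares of monomials *)

Definition zero_expo : expo := Expo 0 0 0 0 0.

(* tau_nat sh is the identity or, when sh holds, the cyclic shift
   i |-> i - 1 of {0, ..., 4}. *)
Definition tau_nat (sh : bool) (i : nat) : nat :=
  if sh then (if i is i'.+1 then i' else 4%N) else i.

Definition tau (sh : bool) (i : 'I_5) : 'I_5 := inord (tau_nat sh i).

Definition sq_opts (sh : bool) (i : nat) : seq opt :=
  [:: (i, 1%num, 0%N); (tau_nat sh i, 2%num, 1%N)].

Definition chi_opts (sh : bool) (i : nat) : seq opt :=
  [seq (iter a (tau_nat sh) i, N.of_nat (2 ^ a), (2 ^ a - 1)%N) | a <- iota 0 6].

Definition lin_opts (vs : nat -> seq nat) (i : nat) : seq opt :=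
  [seq (v, 1%num, 0%N) | v <- vs i].

Definition expand (W : nat -> seq opt) (k : nat) (z : expo) (tl : seq expo) :=
  terms (factors W z) k zero_expo tl.

Definition sq_list (sh : bool) (c : seq (nat * expo)) : seq expo :=
  foldr (fun kz => expand (sq_opts sh) kz.1 kz.2) [::] c.

Definition edeg (z : expo) : N :=
  let: Expo a b c d e := z in N.add a (N.add b (N.add c (N.add d e))).

Lemma edegE z : mdeg (emon z) = N.to_nat (edeg z).
Proof. by case: z => a b c d e; rewrite mdeg_emon /= !N2Nat.inj_add. Qed.

Lemma tau_nat_lt sh i : (i < 5)%N -> (tau_nat sh i < 5)%N.
Proof. by case: sh i => [] [|i] //=; apply: ltnW. Qed.

Lemma val_tau sh (i : 'I_5) : tau sh i = tau_nat sh i :> nat.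
Proof. by rewrite inordK // tau_nat_lt. Qed.

Lemma tau_inj sh : injective (tau sh).
Proof.
move=> i j /(congr1 val); rewrite /= !val_tau => e; apply/val_inj => /=.
by case: sh i j e => [] [[|i] hi] [[|j] hj] //=; lia.
Qed.

Lemma val_iter_tau sh a (i : 'I_5) :
  iter a (tau sh) i = iter a (tau_nat sh) i :> nat.
Proof. by elim: a => //= a IH; rewrite val_tau IH. Qed.

Lemma iter_tau_nat_lt sh a i : (i < 5)%N -> (iter a (tau_nat sh) i < 5)%N.
Proof. by move=> hi; elim: a => //= a; apply: tau_nat_lt. Qed.

(* Every option used below raises the degree by as much as its t-weight. *)
Definition opt_hom (s : nat) (o : opt) : bool :=
  (N.to_nat o.1.2 == s + o.2)%N && opt_ok o.

Definition table_ok (W : nat -> seq opt) : Prop :=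
  forall i, (i < 5)%N -> all (opt_hom 1) (W i).

Lemma sq_opts_ok sh : table_ok (sq_opts sh).
Proof. by move=> i hi; rewrite /= /opt_hom /opt_ok /= hi tau_nat_lt. Qed.

Lemma chi_opts_ok sh : table_ok (chi_opts sh).
Proof.
move=> i hi; rewrite /chi_opts all_map; apply/allP => a _ /=.
by rewrite /opt_hom /opt_ok /= Nat2N.id addnC subnK ?expn_gt0 ?eqxx //= iter_tau_nat_lt.
Qed.

Lemma lin_opts_ok vs : (forall i, (i < 5)%N -> all (fun v => v < 5)%N (vs i)) ->
  table_ok (lin_opts vs).
Proof.
move=> h i /h; rewrite /lin_opts all_map; apply: sub_all => v /= hv.
by rewrite /opt_hom /opt_ok /= hv.
Qed.

(** Each factor adds its own s plus the t-weight of the chosen option, so a product of total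
    t-weight k has degree D + k. *)
Fixpoint factor_deg (fs : seq (seq opt)) (D : nat) : Prop :=
  if fs is f :: fs' then
    exists s D', [/\ all (opt_hom s) f, factor_deg fs' D' & D = (s + D')%N]
  else D = 0%N.

Lemma factor_deg_cat fs fs' D D' :
  factor_deg fs D -> factor_deg fs' D' -> factor_deg (fs ++ fs') (D + D').
Proof.
elim: fs D => [|f fs IH] D /=; first by move=> ->.
move=> [s [E [hf hE ->]]] h; exists s, (E + D')%N; split => //.
  exact: IH.
by rewrite addnA.
Qed.

Lemma pow_opts_deg s f p : all (opt_hom s) f ->
  factor_deg (pow_opts f p) (s * Pos.to_nat p).
Proof.
have dbl t g : all (opt_hom t) g -> all (opt_hom (t + t)) [seq double_opt o | o <- g].
  rewrite all_map; apply: sub_all => -[[v e] w] /andP[/eqP /= he ok].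
  rewrite /opt_hom /= /opt_ok /= in ok *; rewrite ok andbT N2Nat.inj_double he.
  by apply/eqP; lia.
elim: p s f => [q IH|q IH|] s f hf /=.
- exists s, ((s + s) * Pos.to_nat q)%N; split => //; first exact/IH/dbl.
  by rewrite Pos2Nat.inj_xI; lia.
- have -> : (s * Pos.to_nat q~0 = (s + s) * Pos.to_nat q)%N.
    by rewrite Pos2Nat.inj_xO; lia.
  exact/IH/dbl.
- by exists s, 0%N; split => //; lia.
Qed.

Lemma npow_opts_deg f n : all (opt_hom 1) f -> factor_deg (npow_opts f n) (N.to_nat n).
Proof. by case: n => [|p] //= h; have := pow_opts_deg p h; rewrite mul1n. Qed.

Lemma factors_deg W z : table_ok W -> factor_deg (factors W z) (mdeg (emon z)).
Proof.
move=> h; case: z => a b c d e; rewrite mdeg_emon.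
by do 4 ? apply: factor_deg_cat; apply: npow_opts_deg; apply: h.
Qed.

Lemma terms_deg fs D k acc tl n :
  factor_deg fs D -> n = (mdeg (emon acc) + D + k)%N ->
  all (fun m => mdeg (emon m) == n) tl ->
  all (fun m => mdeg (emon m) == n) (terms fs k acc tl).
Proof.
elim: fs D k acc tl => [|f fs IH] D k acc tl /=.
  move=> -> -> htl; case: k htl => [|k] // htl.
  by rewrite /= !addn0 eqxx; move: htl; rewrite !addn0.
move=> [s [E [hf hE ->]]] hn htl.
elim: f hf => [|[[v e] w] f IHf] // /andP[/andP[/eqP /= he ho] hf].
rewrite sub_optE; case: leqP => hw; last exact: IHf.
apply: (IH _ _ _ _ hE _ (IHf hf)).
by rewrite hn emon_addv // mdegD mdegMn mdeg1 he; lia.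
Qed.

Lemma expand_deg W k z tl n :
  table_ok W -> n = (mdeg (emon z) + k)%N ->
  all (fun m => mdeg (emon m) == n) tl ->
  all (fun m => mdeg (emon m) == n) (expand W k z tl).
Proof.
move=> hW hn; apply: terms_deg (factors_deg z hW) _.
by rewrite emon0 mdeg0 add0n.
Qed.

Lemma table_all_ok W z : table_ok W -> all (all opt_ok) (factors W z).
Proof.
move=> h; have : forall fs D, factor_deg fs D -> all (all opt_ok) fs.
  elim=> [|f fs IH] D //= [s [E [hf /IH -> _]]]; rewrite andbT.
  by apply: sub_all hf => o /andP[].
by apply; apply: factors_deg h.
Qed.

Section Eval.

Variable F : fieldType.
Hypothesis F2 : (1 + 1 : F) = 0.

Notation P := {mpoly F[5]}.

Definition psum (l : seq expo) : P := \sum_(z <- l) 'X_[emon z].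

Lemma psum_cat l l' : psum (l ++ l') = psum l + psum l'.
Proof. by rewrite /psum big_cat. Qed.

Lemma expandE W k z tl (sigma : {rmorphism P -> {poly P}}) :
  table_ok W -> (forall i : 'I_5, opts_val F (W i) = sigma 'X_i) ->
  psum (expand W k z tl) = (sigma 'X_[emon z])`_k + psum tl.
Proof.
move=> hW hs; rewrite /psum /expand termsE ?table_all_ok //.
rewrite emon0 mpolyX0 mul1r factorsE // [in RHS]mpolyXE_id.
rewrite (rmorph_prod sigma).
by congr ((polyseq _)`_k + _); apply: eq_bigr => i _; rewrite hs rmorphXn.
Qed.

Lemma expand_lin W z tl (g : {rmorphism P -> P}) :
  table_ok W -> (forall i : 'I_5, opts_val F (W i) = (g 'X_i)%:P) ->
  psum (expand W 0 z tl) = g 'X_[emon z] + psum tl.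
Proof.
move=> hW hs; rewrite (@expandE _ _ _ _ (polyC \o g)) //=.
by rewrite coefC.
Qed.

Lemma expand_sq sh k z tl :
  psum (expand (sq_opts sh) k z tl) = sqt (tau sh) k 'X_[emon z] + psum tl.
Proof.
apply: (@expandE _ _ _ _ (tsq (tau sh))); first exact: sq_opts_ok.
move=> i; rewrite /= tsqX /opts_val !big_cons big_nil /= addr0 expr0 mulr1 !expr1.
by rewrite inord_val.
Qed.

Lemma expand_chi sh k z tl :
  psum (expand (chi_opts sh) k z tl) = chit (tau sh) k 'X_[emon z] + psum tl.
Proof.
apply: (@expandE _ _ _ _ (tchi (tau sh))); first exact: chi_opts_ok.
move=> i; rewrite /= /tchi mmapX mmap1U /chi_gen /opts_val big_map.
rewrite -[iota 0 6]/(index_iota 0 6) big_mkord; apply: eq_bigr => a _ /=.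
have -> : inord (iter a (tau_nat sh) i) = iter a (tau sh) i.
  by apply/val_inj; rewrite /= val_iter_tau inordK // iter_tau_nat_lt.
by rewrite Nat2N.id.
Qed.

Lemma psum_sq_list sh c :
  psum (sq_list sh c) = \sum_(kz <- c) sqt (tau sh) kz.1 'X_[emon kz.2].
Proof.
elim: c => [|kz c IH]; first by rewrite /psum !big_nil.
by rewrite big_cons -IH -expand_sq.
Qed.

Lemma sq_list_hits sh c : all (fun kz => 0 < kz.1)%N c ->
  hits (tau sh) (psum (sq_list sh c)).
Proof.
rewrite psum_sq_list => /allP h; elim: c h => [|kz c IH] h.
  by rewrite big_nil; apply: hits0.
rewrite big_cons; apply: hitsD; first by apply/hits_sqt/h/mem_head.
by apply: IH => x xc; apply: h; rewrite inE xc orbT.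
Qed.

Definition valid (z : expo) : bool := (mdeg (emon z) < 64)%N.

Definition ptrie (l : seq expo) : trie := parity_trie [seq encode z | z <- l] Leaf.

Lemma psum_elements l : all valid l ->
  psum l = \sum_(p <- elements (ptrie l)) 'X_[emon (decode p)].
Proof.
move=> /allP hl; rewrite -(sum_parity (fun p => 'X_[emon (decode p)] : P)).
  rewrite big_map /psum; elim: l hl => [|z l IH] hl; rewrite ?big_nil //.
  rewrite !big_cons encodeK ?IH //; last exact: hl (mem_head _ _).
  by move=> x xl; apply: hl; rewrite inE xl orbT.
exact: mpoly_addxx.
Qed.

Lemma natr_odd n : n%:R = (odd n)%:R :> F.
Proof.
rewrite -[in LHS](odd_double_half n) natrD -addnn natrD -mulr2n.
by rewrite -[_ *+ 2]mulr_natl mulr2n F2 mul0r addr0.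
Qed.

Lemma coef_psum l m :
  (psum l)@_m = (count (fun z => emon z == m) l)%:R.
Proof.
rewrite /psum raddf_sum /=; elim: l => [|z l IH]; first by rewrite big_nil.
by rewrite big_cons IH mcoeffX natrD.
Qed.

Lemma count_encode l z : all valid l -> valid z ->
  count_mem (encode z) [seq encode y | y <- l]
  = count (fun y => emon y == emon z) l.
Proof.
move=> /allP hl hz; rewrite count_map; apply: eq_in_count => y /hl hy /=.
apply/eqP/eqP => [e|/emon_inj -> //].
by rewrite -(encodeK hy) e encodeK.
Qed.

Lemma coef_psum_mem l z : all valid l -> valid z ->
  (psum l)@_(emon z) = (tmem (encode z) (ptrie l))%:R.
Proof.
move=> hl hz; rewrite coef_psum natr_odd -count_encode //.
by rewrite tmem_parity tmem_Leaf addbF.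
Qed.

End Eval.

(** * Monomials of low weight *)

Definition odds (z : expo) : expo :=
  let: Expo a b c d e := z in
  Expo (N.b2n (N.odd a)) (N.b2n (N.odd b)) (N.b2n (N.odd c))
       (N.b2n (N.odd d)) (N.b2n (N.odd e)).

Definition halves (z : expo) : expo :=
  let: Expo a b c d e := z in
  Expo (N.div2 a) (N.div2 b) (N.div2 c) (N.div2 d) (N.div2 e).

Definition add_double (m u : expo) : expo :=
  let: Expo a b c d e := m in let: Expo a' b' c' d' e' := u in
  Expo (N.add a (N.double a')) (N.add b (N.double b')) (N.add c (N.double c'))
       (N.add d (N.double d')) (N.add e (N.double e')).

Definition masks : seq expo :=
  let bits := [:: 0%num; 1%num] in
  [seq f e | f <- [seq f d | f <- [seq f c | f <- [seq Expo a b | a <- bits, b <- bits],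
    c <- bits], d <- bits], e <- bits].

(* A pattern lists the first terms of a weight vector: the numbers of exponents
   with odd 0th, 1st, ... binary digit. *)
Fixpoint prefixes (pat : seq N) : seq expo :=
  if pat is c :: pat' then
    [seq add_double m u | m <- [seq m <- masks | N.eqb (edeg m) c],
                          u <- prefixes pat']
  else [:: zero_expo].

Fixpoint low (pat : seq N) (z : expo) : bool :=
  if pat is c :: pat' then
    if N.eqb (edeg (odds z)) c then low pat' (halves z) else false
  else true.

Definition is_low (pats : seq (seq N)) (z : expo) : bool :=
  has (fun pat => low pat z) pats.

Definition edeg_nat (z : expo) : nat := N.to_nat (edeg z).

Definition reduce (l : seq expo) : seq expo :=
  [seq decode p | p <- elements (ptrie l)].

Fixpoint chain_list (sh : bool) (r d : nat) (l : seq expo) : seq expo :=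
  if r is r'.+1 then
    chain_list sh r' d (reduce (foldr (expand (chi_opts sh) (2 ^ r' * d)) [::] l))
  else l.

(** A monomial of degree n with this pattern is u A^(2^r), where u comes from [prefixes] and A has
    degree d; the division is then exact. The chain must annihilate u. It raises the degree of u by
    d (2^(r-1) + ... + 1), and the bound 64 keeps the encoding faithful along the way. *)
Definition low_ok (sh : bool) (n : nat) (pat : seq N) : bool :=
  let r := size pat in
  all (fun u => let d := ((n - edeg_nat u) %/ 2 ^ r)%N in
    [&& 0 < d, 2 ^ r * d < 2 * chi_bound, edeg_nat u + (2 ^ r - 1) * d < 64 &
        nilp (chain_list sh r d [:: u])]%N)
    (prefixes pat).

(** Adding the squares listed in [c] to [l] and cancelling modulo two may leave only monomials of
    low weight, which are hit by the chi-trick. *)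
Definition hit_cert (sh : bool) (n : nat) (pats : seq (seq N))
    (c : seq (nat * expo)) (l : seq expo) : bool :=
  [&& all (fun kz => (0 < kz.1) && (edeg_nat kz.2 + kz.1 == n))%N c,
      all (fun z => edeg_nat z == n) l &
      all (fun p => is_low pats (decode p)) (elements (ptrie (l ++ sq_list sh c)))].

Lemma emonE a b c d e (i : 'I_5) :
  emon (Expo a b c d e) i = N.to_nat (nth 0%num [:: a; b; c; d; e] i).
Proof.
rewrite /emon /mono multinomE (tnth_nth 0%N) /=.
by case: i => [[|[|[|[|[|]]]]]].
Qed.

Lemma emon_add_double m u : emon (add_double m u) = (emon m + emon u *+ 2)%MM.
Proof.
apply/mnmP => i; rewrite mnmDE mulmnE.
case: m u => a b c d e [a' b' c' d' e']; rewrite !emonE.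
case: i => [[|[|[|[|[|//]]]]] hi]; rewrite /= N2Nat.inj_add N2Nat.inj_double; lia.
Qed.

Lemma odds_halves z : z = add_double (odds z) (halves z).
Proof.
case: z => a b c d e /=; have h x : x = N.add (N.b2n (N.odd x)) (N.double (N.div2 x)).
  by rewrite N.add_comm N.double_spec -N.div2_odd.
by rewrite -!h.
Qed.

Lemma odds_masks z : odds z \in masks.
Proof.
by case: z => a b c d e /=; do 5 case: (N.odd _).
Qed.

Lemma low_cons c pat z : low (c :: pat) z =
  if N.eqb (edeg (odds z)) c then low pat (halves z) else false.
Proof. by []. Qed.

Lemma prefixes_cons c pat : prefixes (c :: pat) =
  [seq add_double m u | m <- [seq m <- masks | N.eqb (edeg m) c],
                        u <- prefixes pat].
Proof. by []. Qed.

Lemma low_split pat z : low pat z ->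
  exists2 u, u \in prefixes pat &
  exists w, emon z = (emon u + emon w *+ 2 ^ size pat)%MM.
Proof.
elim: pat z => [|c pat IH] z.
  by move=> _; exists zero_expo; rewrite ?inE //; exists z; rewrite emon0 mulm1n add0m.
rewrite low_cons prefixes_cons.
case: ifP => // hc /IH[u hu [w hw]]; exists (add_double (odds z) u).
  by apply/allpairsP; exists (odds z, u); rewrite mem_filter hc odds_masks.
exists w; rewrite {1}(odds_halves z) !emon_add_double hw.
apply/mnmP => i; rewrite !(mnmDE, mulmnE) -[size (c :: pat)]/((size pat).+1) expnS.
by rewrite mulnDl addnA -mulnA [(2 ^ _ * 2)%N]mulnC.
Qed.

Lemma elements_ptrie l p : p \in elements (ptrie l) ->
  exists2 z, z \in l & p = encode z.
Proof.
rewrite mem_elements tmem_parity tmem_Leaf addbF => h.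
have : p \in [seq encode z | z <- l].
  by rewrite -has_pred1 has_count; case: (count _ _) h.
by case/mapP => z zl ->; exists z.
Qed.

Lemma sq_list_deg sh n c : all (fun kz => edeg_nat kz.2 + kz.1 == n)%N c ->
  all (fun z => mdeg (emon z) == n) (sq_list sh c).
Proof.
elim: c => [|kz c IH] //= /andP[/eqP hk hc].
by apply: expand_deg (sq_opts_ok sh) _ (IH hc); rewrite edegE.
Qed.

Section Checks.

Variable F : fieldType.
Hypothesis F2 : (1 + 1 : F) = 0.

Notation P := {mpoly F[5]}.

Lemma chitD t k (f g : P) : chit t k (f + g) = chit t k f + chit t k g.
Proof. by rewrite /chit tchiD coefD. Qed.

Lemma chit0 t k : chit t k (0 : P) = 0.
Proof. by rewrite /chit /tchi mmap0 coef0. Qed.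

Lemma psum_reduce l : all valid l -> psum F (reduce l) = psum F l.
Proof. by move=> vl; rewrite (psum_elements F2 vl) /psum big_map. Qed.

Lemma all_reduce (Q : pred expo) l : all valid l -> all Q l -> all Q (reduce l).
Proof.
move=> /allP vl /allP hl; rewrite all_map; apply/allP => p /elements_ptrie[y yl ->] /=.
by rewrite encodeK ?hl //; apply: vl.
Qed.

Lemma psum_chain sh r d l D : all (fun z => mdeg (emon z) == D) l ->
  (D + (2 ^ r - 1) * d < 64)%N ->
  psum F (chain_list sh r d l) = chi_chain (tau sh) r d (psum F l).
Proof.
elim: r l D => [|r IH] l D hl hD //; rewrite [chain_list _ _ _ _]/=.
have e : (D + (2 ^ r.+1 - 1) * d = (D + 2 ^ r * d) + (2 ^ r - 1) * d)%N.
  have : (0 < 2 ^ r)%N by rewrite expn_gt0.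
  by rewrite expnS; nia.
set l' := foldr _ _ _.
have hl' : all (fun z => mdeg (emon z) == D + 2 ^ r * d)%N l'.
  rewrite /l'; elim: l hl {l'} => [|z l IHl] //= /andP[/eqP hz hl].
  by apply: expand_deg (chi_opts_ok sh) _ (IHl hl); rewrite hz.
have vl' : all valid l'.
  apply: sub_all hl' => z /eqP hz; rewrite /valid hz.
  by apply: leq_ltn_trans hD; rewrite e leq_addr.
rewrite (IH _ (D + 2 ^ r * d)%N) -?e //; last exact: all_reduce.
rewrite psum_reduce //= /l'; congr (chi_chain _ _ _ _).
elim: l {hl l' hl' vl'} => [|z l IHl] /=; first by rewrite /psum big_nil chit0.
have -> : psum F (z :: l) = 'X_[emon z] + psum F l by rewrite /psum big_cons.
rewrite (chitD _ _ 'X_[emon z]) -IHl; exact: expand_chi.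
Qed.

Lemma low_hits sh n pat z : low_ok sh n pat -> low pat z ->
  mdeg (emon z) = n -> hits (tau sh) ('X_[emon z] : P).
Proof.
move=> /allP ok /low_split[u /ok hu [w hw]] hz.
case/and4P: hu; set d := (_ %/ _)%N; move=> d0 db d64 /nilP hnil.
rewrite hw mpolyXD; apply: chi_chain_hits d0 _ db _ => //; first exact: tau_inj.
  by rewrite /d -hz hw mdegD mdegMn /edeg_nat -edegE addKn mulnK ?expn_gt0.
have du : all (fun y => mdeg (emon y) == mdeg (emon u)) [:: u] by rewrite /= eqxx.
have := psum_chain sh (d := d) (r := size pat) du; rewrite edegE => /(_ d64).
by rewrite {2}/psum big_seq1 hnil /psum big_nil => <-.
Qed.

Lemma hit_cert_hits sh n pats c l : (n < 64)%N ->
  all (low_ok sh n) pats -> hit_cert sh n pats c l -> hits (tau sh) (psum F l).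
Proof.
move=> n64 /allP okp /and3P[/allP okc okl /allP h].
have degl : all (fun z => mdeg (emon z) == n) (l ++ sq_list sh c).
  rewrite all_cat; apply/andP; split.
    by apply: sub_all okl => z; rewrite edegE.
  by apply: sq_list_deg; apply/allP => kz /okc/andP[].
have hs : hits (tau sh) (psum F (sq_list sh c)).
  by apply: sq_list_hits => //; apply/allP => kz /okc/andP[].
apply: (hits_subst F2 _ hs).
rewrite -psum_cat psum_elements //; last first.
  by apply: sub_all degl => z /eqP hz; rewrite /valid hz.
rewrite big_seq; apply: hits_sum => p pt; have /hasP[pat /okp ok lp] := h p pt.
have [z zl pz] := elements_ptrie pt.
apply: low_hits ok lp _; rewrite pz encodeK; first exact/eqP/(allP degl).
by rewrite (eqP (allP degl _ zl)).
Qed.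

End Checks.

(** * The transpose of the total square *)

Fixpoint disjoint_pos (p q : positive) : bool :=
  match p, q with
  | xO p', xO q' | xO p', xI q' | xI p', xO q' => disjoint_pos p' q'
  | xO _, xH | xH, xO _ => true
  | _, _ => false
  end.

(** By Lucas's theorem this is the parity of the binomial coefficient C(m + n, n), as
    [disjoint_bitsE] shows. *)
Definition disjoint_bits (m n : N) : bool :=
  match m, n with
  | Npos p, Npos q => disjoint_pos p q
  | _, _ => true
  end.

(** The splittings c = 2 q + r of an exponent of the target monomial, as pairs (q, r): 2 q comes
    from squared variables and r from variables left as they are. *)
Definition pairs (c : N) : seq (N * N) :=
  let m := N.to_nat c in
  [seq (N.of_nat j, N.of_nat (m - 2 * j)) | j <- iota 0 (m./2).+1].

(** The squares that land on X_i come from X_i itself or, with the shift, from X_(i+1). Hence t is q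
    or q moved by one place, the exponents of the source are r_i + t_i, and its coefficient is the
    product of the C(r_i + t_i, t_i). *)
Definition preterm (sh : bool) (p0 p1 p2 p3 p4 : N * N) : seq expo :=
  let: (q0, r0) := p0 in let: (q1, r1) := p1 in let: (q2, r2) := p2 in
  let: (q3, r3) := p3 in let: (q4, r4) := p4 in
  let: (t0, t1, t2, t3, t4) :=
    if sh then (q4, q0, q1, q2, q3) else (q0, q1, q2, q3, q4) in
  if [&& disjoint_bits r0 t0, disjoint_bits r1 t1, disjoint_bits r2 t2,
         disjoint_bits r3 t3 & disjoint_bits r4 t4]
  then [:: Expo (N.add r0 t0) (N.add r1 t1) (N.add r2 t2) (N.add r3 t3)
                (N.add r4 t4)]
  else [::].

(* All z such that emon m occurs in the total square of 'X_[emon z]. *)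
Definition preterms (sh : bool) (m : expo) : seq expo :=
  let: Expo a b c d e := m in
  flatten [seq flatten [seq flatten [seq flatten [seq flatten
    [seq preterm sh p0 p1 p2 p3 p4 | p4 <- pairs e]
    | p3 <- pairs d] | p2 <- pairs c] | p1 <- pairs b] | p0 <- pairs a].

(** The functional sums the coefficients at the monomials of [A]. Composed with the total square it
    becomes the sum of the coefficients at all preterms; it kills the hits when the preterms of
    degree other than n cancel modulo two. *)
Definition functional_ok (sh : bool) (n : nat) (A : seq expo) : bool :=
  all (fun z => edeg_nat z == n) A &&
  all (fun p => edeg_nat (decode p) == n)
    (elements (ptrie (flatten [seq preterms sh m | m <- A]))).

Lemma odd_bin_double n k :
  odd 'C(2 * n, 2 * k) = odd 'C(n, k) /\ odd 'C(2 * n, (2 * k).+1) = false.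
Proof.
elim: n k => [|n IH] k; first by case: k => [|k]; rewrite ?muln0 ?bin0n.
have step m j : odd 'C(m.+2, j.+2) = odd 'C(m, j) (+) odd 'C(m, j.+2).
  rewrite !binS !oddD; case: (odd 'C(m, j.+2)); case: (odd 'C(m, j.+1)) => //=;
    by case: (odd 'C(m, j)).
rewrite mulnS add2n; case: k => [|k]; rewrite ?muln0 ?bin0 ?bin1.
  by split => //; rewrite /= oddM.
rewrite mulnS add2n step; have [h1 h2] := IH k; have [h3 h4] := IH k.+1.
rewrite h1; move: h3 h4; rewrite mulnS add2n => -> h4; split.
  by rewrite binS oddD addbC.
by rewrite step h2 h4.
Qed.

Lemma disjoint_posE p q :
  odd 'C(Pos.to_nat p + Pos.to_nat q, Pos.to_nat q) = disjoint_pos p q.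
Proof.
have dbl := odd_bin_double.
have dblS n k : odd 'C((2 * n).+1, 2 * k) = odd 'C(n, k) /\
                odd 'C((2 * n).+1, (2 * k).+1) = odd 'C(n, k).
  have [h1 h2] := dbl n k; split; last by rewrite binS oddD h1 h2.
  case: k h1 {h2} => [|k]; first by rewrite muln0 !bin0.
  rewrite mulnS add2n binS oddD => ->; have [_ ->] := dbl n k; exact: addbF.
elim: p q => [p IH|p IH|] [q|q|] /=;
  rewrite ?Pos2Nat.inj_xI ?Pos2Nat.inj_xO ?Pos2Nat.inj_1 -?IH.
- have -> : ((2 * Pos.to_nat p).+1 + (2 * Pos.to_nat q).+1 =
     2 * (Pos.to_nat p + Pos.to_nat q).+1)%N by lia.
  exact: (dbl _ _).2.
- have -> : ((2 * Pos.to_nat p).+1 + (2 * Pos.to_nat q) =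
     (2 * (Pos.to_nat p + Pos.to_nat q)).+1)%N by lia.
  exact: (dblS _ _).1.
- have -> : ((2 * Pos.to_nat p).+1 + 1 = 2 * (Pos.to_nat p).+1)%N by lia.
  exact: (dbl _ 0%N).2.
- have -> : (2 * Pos.to_nat p + (2 * Pos.to_nat q).+1 =
     (2 * (Pos.to_nat p + Pos.to_nat q)).+1)%N by lia.
  exact: (dblS _ _).2.
- have -> : (2 * Pos.to_nat p + 2 * Pos.to_nat q = 2 * (Pos.to_nat p + Pos.to_nat q))%N by lia.
  exact: (dbl _ _).1.
- by rewrite addn1 bin1; lia.
- have -> : (1 + (2 * Pos.to_nat q).+1 = 2 * (Pos.to_nat q).+1)%N by lia.
  exact: (dbl _ _).2.
- by rewrite add1n; have [-> _] := dblS (Pos.to_nat q) (Pos.to_nat q); rewrite binn.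
- by [].
Qed.

Lemma disjoint_bitsE r t :
  odd 'C(N.to_nat r + N.to_nat t, N.to_nat t) = disjoint_bits r t.
Proof.
case: r t => [|p] [|q] //=; rewrite ?bin0 ?add0n ?binn //.
exact: disjoint_posE.
Qed.

(** * Functionals vanishing on the hits *)

Lemma mono_eq a b c d e a' b' c' d' e' :
  (mono (a, b, c, d, e) == mono (a', b', c', d', e'))
  = [&& a == a', b == b', c == c', d == d' & e == e'].
Proof.
apply/eqP/idP => [/mnmP h|/and5P[/eqP-> /eqP-> /eqP-> /eqP-> /eqP->] //].
have ev t (i : 'I_5) : mono t i = let: (a, b, c, d, e) := t in nth e [:: a; b; c; d] i.
  move: t => [[[[? ?] ?] ?] ?]; rewrite multinomE (tnth_nth 0%N).
  by case: i => [[|[|[|[|[|]]]]]].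
have := h (@Ordinal 5 0 isT); have := h (@Ordinal 5 1 isT).
have := h (@Ordinal 5 2 isT); have := h (@Ordinal 5 3 isT).
have := h (@Ordinal 5 4 isT).
by rewrite !ev /= => -> -> -> -> ->; rewrite !eqxx.
Qed.

Definition expo_of (w : 'X_{1..5}) : expo :=
  let n i := N.of_nat (w (inord i)) in Expo (n 0%N) (n 1%N) (n 2%N) (n 3%N) (n 4%N).

Lemma expo_ofK w : emon (expo_of w) = w.
Proof.
apply/mnmP => i; rewrite /expo_of emonE.
case: i => [[|[|[|[|[|//]]]]] hi] /=; rewrite Nat2N.id;
  by congr (w _); apply/val_inj; rewrite /= inordK.
Qed.

Lemma bin_match (z t q m : nat) :
  odd 'C(z, t) && (z - t + 2 * q == m)%N
  = [&& 2 * q <= m, odd 'C(m - 2 * q + t, t) & m - 2 * q + t == z]%N.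
Proof.
apply/andP/and3P => [[hc /eqP <-]|[h1 h2 /eqP h3]].
  have tz : (t <= z)%N by rewrite leqNgt; apply/negP => /bin_small e; rewrite e in hc.
  rewrite leq_addl addnK subnK //.
by rewrite -h3 h2 addnK subnK.
Qed.

Lemma sum_pairs (c : N) B (G : N * N -> nat) : (N.to_nat c < B)%N ->
  \sum_(p <- pairs c) G p
  = \sum_(q < B) if (2 * q <= N.to_nat c)%N
                 then G (N.of_nat q, N.of_nat (N.to_nat c - 2 * q)) else 0%N.
Proof.
move=> cB; rewrite /pairs big_map -[X in iota 0 X]subn0 -/(index_iota _ _) big_mkord.
rewrite (big_ord_widen_cond B xpredT
  (fun q => G (N.of_nat q, N.of_nat (N.to_nat c - 2 * q)))); last first.
  by apply: leq_ltn_trans cB; lia.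
rewrite big_mkcond; apply: eq_bigr => q _ /=; congr (if _ then _ else _).
by lia.
Qed.

Lemma sum_nat_flatten (T : Type) (ss : seq (seq T)) (G : T -> nat) :
  \sum_(x <- flatten ss) G x = \sum_(s <- ss) \sum_(x <- s) G x.
Proof. exact: big_flatten. Qed.

Section Functional.

Variable F : fieldType.
Hypothesis F2 : (1 + 1 : F) = 0.

Notation P := {mpoly F[5]}.
Notation x_ k := ('X_(inord k) : P).

Lemma X_mono a b c d e : 'X_[mono (a, b, c, d, e)] =
  x_ 0 ^+ a * (x_ 1 ^+ b * (x_ 2 ^+ c * (x_ 3 ^+ d * x_ 4 ^+ e))).
Proof.
transitivity (\prod_(i < 5) x_ i ^+ mono (a, b, c, d, e) i).
  by rewrite mpolyXE_id; apply: eq_bigr => i _; rewrite inord_val.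
by rewrite !big_ord_recl big_ord0 mulr1 !multinomE !(tnth_nth 0%N).
Qed.

Lemma prod5 B (f0 f1 f2 f3 f4 : nat -> P) :
  (\sum_(q < B) f0 q) * ((\sum_(q < B) f1 q) * ((\sum_(q < B) f2 q) *
    ((\sum_(q < B) f3 q) * (\sum_(q < B) f4 q))))
  = \sum_(q0 < B) \sum_(q1 < B) \sum_(q2 < B) \sum_(q3 < B) \sum_(q4 < B)
      f0 q0 * (f1 q1 * (f2 q2 * (f3 q3 * f4 q4))).
Proof.
have H (x : P) (f : nat -> P) R :
    x * ((\sum_(q < B) f q) * R) = \sum_(q < B) x * f q * R.
  by rewrite mulr_suml mulr_sumr; apply: eq_bigr => q _; rewrite mulrA.
rewrite -[LHS]mul1r H; apply: eq_bigr => q0 _.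
rewrite H; apply: eq_bigr => q1 _; rewrite H; apply: eq_bigr => q2 _.
rewrite H; apply: eq_bigr => q3 _; rewrite mulr_sumr.
by apply: eq_bigr => q4 _; rewrite mul1r !mulrA.
Qed.

Definition bin_term (i j : 'I_5) (n q : nat) : P :=
  'C(n, q)%:R *: ('X_i ^+ (n - q) * 'X_j ^+ (2 * q)).

Lemma factor_expand B n (i j : 'I_5) : (n < B)%N ->
  ('X_i + 'X_j ^+ 2) ^+ n = \sum_(q < B) bin_term i j n q.
Proof.
move=> nB; rewrite exprDn /bin_term.
rewrite (big_ord_widen_cond B xpredT
   (fun q => 'X_i ^+ (n - q) * 'X_j ^+ 2 ^+ q *+ 'C(n, q))) //.
rewrite big_mkcond; apply: eq_bigr => q _ /=; rewrite ltnS.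
case: leqP => h; first by rewrite -exprM scaler_nat.
by rewrite bin_small // scale0r.
Qed.

Definition stotal (sh : bool) (Z : 'X_{1..5}) : P :=
  \prod_(i < 5) ('X_i + 'X_(tau sh i) ^+ 2) ^+ Z i.

(** Modulo two both sides count the tuples (q_0, ..., q_4) for which 2 q_i is the part of the
    exponent of X_i in m that comes from squares. *)
Lemma stotal_coef sh z m :
  (stotal sh (emon z))@_(emon m)
  = (count (fun y => emon y == emon z) (preterms sh m))%:R.
Proof.
(* One bound above all exponents lets every sum range over the same interval; the terms added are
   zero. *)
pose B := (mdeg (emon z) + mdeg (emon m)).+1.
case: z @B => z0 z1 z2 z3 z4; case: m => m0 m1 m2 m3 m4 B.
have [hz0 hz1 hz2 hz3 hz4] : [/\ (N.to_nat z0 < B)%N, (N.to_nat z1 < B)%N,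
    (N.to_nat z2 < B)%N, (N.to_nat z3 < B)%N & (N.to_nat z4 < B)%N].
  by rewrite /B !mdeg_emon; split; lia.
have [hm0 hm1 hm2 hm3 hm4] : [/\ (N.to_nat m0 < B)%N, (N.to_nat m1 < B)%N,
    (N.to_nat m2 < B)%N, (N.to_nat m3 < B)%N & (N.to_nat m4 < B)%N].
  by rewrite /B !mdeg_emon; split; lia.
rewrite -sum1_count big_mkcond /preterms !sum_nat_flatten.
rewrite big_map (sum_pairs _ hm0).
under [in RHS]eq_bigr => q0 _.
  rewrite sum_nat_flatten big_map (sum_pairs _ hm1).
  under eq_bigr => q1 _.
    rewrite sum_nat_flatten big_map (sum_pairs _ hm2).
    under eq_bigr => q2 _.
      rewrite sum_nat_flatten big_map (sum_pairs _ hm3).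
      under eq_bigr => q3 _.
        rewrite sum_nat_flatten big_map (sum_pairs _ hm4).
        over.
      over.
    over.
  over.
(* A variable of exponent z, squared t times and receiving q squares, ends with exponent m, and does
   so an odd number of times. *)
pose L (z : N) (t q : nat) (m : N) : bool :=
  odd 'C(N.to_nat z, t) && (N.to_nat z - t + 2 * q == N.to_nat m)%N.
have L0 z t q m : (N.to_nat m < 2 * q)%N -> L z t q m = false.
  by rewrite ltnNge => /negbTE h; rewrite /L bin_match h.
pose term (q0 q1 q2 q3 q4 t0 t1 t2 t3 t4 : nat) : bool :=
  [&& L z0 t0 q0 m0, L z1 t1 q1 m1, L z2 t2 q2 m2, L z3 t3 q3 m3 & L z4 t4 q4 m4].
pose T (q0 q1 q2 q3 q4 : nat) : bool := if sh
  then term q0 q1 q2 q3 q4 q4 q0 q1 q2 q3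
  else term q0 q1 q2 q3 q4 q0 q1 q2 q3 q4.
transitivity ((\sum_(q0 < B) \sum_(q1 < B) \sum_(q2 < B) \sum_(q3 < B)
   \sum_(q4 < B) (T q0 q1 q2 q3 q4 : nat))%N%:R : F); last first.
  congr (_%:R); apply: eq_bigr => q0 _.
  case: leqP => h0; last first.
    by do 4 (rewrite big1 // => ? _); rewrite /T /term !(L0 _ _ _ _ h0); case: (sh).
  apply: eq_bigr => q1 _; case: leqP => h1; last first.
    by do 3 (rewrite big1 // => ? _); rewrite /T /term !(L0 _ _ _ _ h1) !andbF; case: (sh).
  apply: eq_bigr => q2 _; case: leqP => h2; last first.
    by do 2 (rewrite big1 // => ? _); rewrite /T /term !(L0 _ _ _ _ h2) !andbF; case: (sh).
  apply: eq_bigr => q3 _; case: leqP => h3; last first.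
    by rewrite big1 // => ? _; rewrite /T /term !(L0 _ _ _ _ h3) !andbF; case: (sh).
  apply: eq_bigr => q4 _; case: leqP => h4; last first.
    by rewrite /T /term !(L0 _ _ _ _ h4) !andbF; case: (sh).
  have hL z t q m : (2 * q <= N.to_nat m)%N -> L z t q m =
      disjoint_bits (N.of_nat (N.to_nat m - 2 * q)) (N.of_nat t)
      && (N.to_nat (N.add (N.of_nat (N.to_nat m - 2 * q)) (N.of_nat t)) == N.to_nat z).
    move=> h; rewrite /L bin_match h -disjoint_bitsE N2Nat.inj_add !Nat2N.id.
    by [].
  rewrite /T /term !hL // /preterm; case: (sh);
    do 5 case: (disjoint_bits _ _) => //=; rewrite ?andbF ?big_nil //;
    rewrite big_seq1 /emon mono_eq; by do 5 case: (_ == _).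
have Cmon : forall t0 t1 t2 t3 t4 q0 q1 q2 q3 q4 : nat,
  (('C(N.to_nat z0, t0)%:R * ('C(N.to_nat z1, t1)%:R * ('C(N.to_nat z2, t2)%:R
    * ('C(N.to_nat z3, t3)%:R * 'C(N.to_nat z4, t4)%:R)))) *:
    'X_[mono (N.to_nat z0 - t0 + 2 * q0, N.to_nat z1 - t1 + 2 * q1,
    N.to_nat z2 - t2 + 2 * q2, N.to_nat z3 - t3 + 2 * q3,
    N.to_nat z4 - t4 + 2 * q4)%N] : P)@_(emon (Expo m0 m1 m2 m3 m4))
  = (term q0 q1 q2 q3 q4 t0 t1 t2 t3 t4)%:R.
  move=> *; rewrite mcoeffZ mcoeffX /emon mono_eq /term /L !(natr_odd F2 'C(_, _)).
  by do 5 case: (odd 'C(_, _)); rewrite ?mul0r ?mulr0 ?mul0r ?mul1r //=; rewrite ?andbF.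
have EA i : (i < 5)%N -> 'X_(tau sh (inord i)) = x_ (tau_nat sh i).
  by move=> i5; rewrite /tau inordK.
have E : stotal sh (emon (Expo z0 z1 z2 z3 z4)) =
    (x_ 0 + x_ (tau_nat sh 0) ^+ 2) ^+ N.to_nat z0 *
   ((x_ 1 + x_ (tau_nat sh 1) ^+ 2) ^+ N.to_nat z1 *
   ((x_ 2 + x_ (tau_nat sh 2) ^+ 2) ^+ N.to_nat z2 *
   ((x_ 3 + x_ (tau_nat sh 3) ^+ 2) ^+ N.to_nat z3 *
    (x_ 4 + x_ (tau_nat sh 4) ^+ 2) ^+ N.to_nat z4))).
  rewrite /stotal; under eq_bigr => i _ do rewrite -[i in 'X_i]inord_val emonE /tau.
  by rewrite !big_ord_recl big_ord0 mulr1.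
have rsum (G : 'I_B -> P) M : (\sum_(q < B) G q)@_M = \sum_(q < B) (G q)@_M.
  exact: raddf_sum.
rewrite E /T {E EA T}; case: (sh) => /=.
  (* With the shift, the squares from X_(i+1) land on X_i. The factor of X_0 is moved to the end, so
     that the order of expansion is that of q_0, ..., q_4. *)
  rewrite mulrC -!mulrA; do 5 rewrite (@factor_expand B) //.
  rewrite prod5 rsum natr_sum; apply: eq_bigr => q0 _.
  rewrite rsum natr_sum; apply: eq_bigr => q1 _.
  rewrite rsum natr_sum; apply: eq_bigr => q2 _.
  rewrite rsum natr_sum; apply: eq_bigr => q3 _.
  rewrite rsum natr_sum; apply: eq_bigr => q4 _.
  rewrite -Cmon; congr (_@_ _); rewrite X_mono /bin_term -!mul_mpolyC !mpolyCM !exprD.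
  by ring.
do 5 rewrite (@factor_expand B) //.
rewrite prod5 rsum natr_sum; apply: eq_bigr => q0 _.
rewrite rsum natr_sum; apply: eq_bigr => q1 _.
rewrite rsum natr_sum; apply: eq_bigr => q2 _.
rewrite rsum natr_sum; apply: eq_bigr => q3 _.
rewrite rsum natr_sum; apply: eq_bigr => q4 _.
rewrite -Cmon; congr (_@_ _); rewrite X_mono /bin_term -!mul_mpolyC !mpolyCM !exprD.
by ring.
Qed.

Lemma sqt_monomial_deg sh k Z m : (sqt (tau sh) k ('X_[Z] : P))@_m != 0 ->
  mdeg m = (mdeg Z + k)%N.
Proof.
rewrite -(expo_ofK Z); have := expand_sq F2 sh k (expo_of Z) [::].
rewrite [X in _ + X]/psum big_nil addr0 => <-; rewrite coef_psum => h.
have /hasP[y hy /eqP <-] : has (fun y => emon y == m)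
    (expand (sq_opts sh) k (expo_of Z) [::]).
  by rewrite has_count lt0n; apply: contraNneq h => ->.
by apply/eqP; apply: (allP (expand_deg (sq_opts_ok sh) (erefl _) _) y hy).
Qed.

(** Setting t = 1 loses nothing: the square of degree k is the part of the total square of degree
    deg Z + k. *)
Lemma stotal_sqt sh k (Z M : 'X_{1..5}) : mdeg M = (mdeg Z + k)%N ->
  (sqt (tau sh) k ('X_[Z] : P))@_M = (stotal sh Z)@_M.
Proof.
move=> hM; have -> : stotal sh Z = (tsq (tau sh) ('X_[Z] : P)).[1].
  rewrite -[RHS]/((horner_eval 1 \o tsq (tau sh)) _) mpolyXE_id rmorph_prod.
  apply: eq_bigr => i _; rewrite rmorphXn /= tsqX /horner_eval !hornerE.
  by [].
have sz : (k < (size (tsq (tau sh) ('X_[Z] : P)) + k).+1)%N by rewrite ltnS leq_addl.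
rewrite (@horner_coef_wide _ (size (tsq (tau sh) ('X_[Z] : P)) + k).+1); last first.
  by rewrite leqW // leq_addr.
rewrite raddf_sum (bigD1 (Ordinal sz)) //= expr1n mulr1 big1 ?addr0 //.
move=> i /negP ne; rewrite expr1n mulr1; apply/eqP; apply/negPn/negP => /sqt_monomial_deg.
rewrite hM => /addnI e; apply: ne; apply/eqP/val_inj; exact/esym.
Qed.

Definition funct (A : seq expo) (f : P) : F := \sum_(m <- A) f@_(emon m).

Lemma funct_is_additive A : additive (funct A).
Proof.
move=> f g; rewrite /funct -sumrB; apply: eq_bigr => m _; exact: mcoeffB.
Qed.

HB.instance Definition _ A := GRing.isAdditive.Build P F (funct A)
  (funct_is_additive A).

Lemma functZ A c f : funct A (c *: f) = c * funct A f.
Proof. by rewrite /funct mulr_sumr; apply: eq_bigr => m _; rewrite mcoeffZ. Qed.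

Lemma preterms_deg sh m : all (fun y => edeg_nat y <= edeg_nat m)%N (preterms sh m).
Proof.
apply/allP => y; rewrite /preterms; case: m => m0 m1 m2 m3 m4.
have pairsP c p : p \in pairs c -> (N.to_nat p.2 + 2 * N.to_nat p.1 <= N.to_nat c)%N.
  case/mapP => q; rewrite mem_iota => hq -> /=; rewrite !Nat2N.id; lia.
case/flattenP => s /mapP[p0 /pairsP h0 ->].
case/flattenP => {}s /mapP[p1 /pairsP h1 ->].
case/flattenP => {}s /mapP[p2 /pairsP h2 ->].
case/flattenP => {}s /mapP[p3 /pairsP h3 ->].
case/flattenP => {}s /mapP[p4 /pairsP h4 ->].
case: p0 p1 p2 p3 p4 h0 h1 h2 h3 h4 => q0 r0 [q1 r1] [q2 r2] [q3 r3] [q4 r4] /=.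
move=> h0 h1 h2 h3 h4; rewrite /preterm; case: sh; case: ifP => // _;
  rewrite inE => /eqP ->; rewrite /edeg_nat /edeg !N2Nat.inj_add; lia.
Qed.

Lemma funct_hits sh n A f : (n < 64)%N -> functional_ok sh n A ->
  hits (tau sh) f -> funct A f = 0.
Proof.
move=> n64 /andP[/allP hA /allP hE] [s ->]; rewrite raddf_sum big1 // => -[k u] _ /=.
rewrite (mpolyE u) sqt_sum // raddf_sum big1 // => Z _.
rewrite /= sqtZ functZ; apply/eqP; rewrite mulf_eq0; apply/orP; right; apply/eqP.
have hdeg m : m \in A -> mdeg (emon m) = n.
  by move=> /hA /eqP; rewrite /edeg_nat -edegE.
have [hn|hn] := eqVneq (mdeg Z + k.+1)%N n; last first.
  rewrite /funct big_seq big1 // => m /hdeg hm; apply/eqP; apply/negPn/negP.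
  by move/sqt_monomial_deg; rewrite hm => e; rewrite -e eqxx in hn.
(* The value at the square of X^Z is the multiplicity of Z among all preterms of [A]. As Z has
   degree less than n, [functional_ok] makes it even. *)
transitivity ((count (fun y => emon y == Z) (flatten [seq preterms sh m | m <- A]))%:R : F).
  rewrite count_flatten -map_comp sumnE big_map natr_sum /funct.
  rewrite big_seq [RHS]big_seq; apply: eq_bigr => m /hdeg hm /=.
  by rewrite stotal_sqt ?hm // -(expo_ofK Z) stotal_coef.
rewrite natr_odd // -(expo_ofK Z).
have vl : all valid (flatten [seq preterms sh m | m <- A]).
  apply/allP => y /flattenP[l /mapP[m mA ->]] /(allP (preterms_deg sh m)).
  rewrite /valid edegE -/(edeg_nat y) => h; apply: leq_ltn_trans h _.
  by rewrite (eqP (hA m mA)).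
have vz : valid (expo_of Z).
  rewrite /valid expo_ofK; apply: leq_ltn_trans n64; rewrite -hn; exact: leq_addr.
rewrite -count_encode //.
have := tmem_parity (encode (expo_of Z))
  [seq encode y | y <- flatten [seq preterms sh m | m <- A]] Leaf.
rewrite tmem_Leaf addbF => <-; rewrite -mem_elements.
case: (boolP (_ \in _)) => // /hE; rewrite encodeK // /edeg_nat -edegE expo_ofK -hn.
by rewrite -[X in X == _]addn0 eqn_add2l.
Qed.

End Functional.

(** * Cyclic orbit sums *)

Definition rot_expo (z : expo) : expo :=
  let: Expo a b c d e := z in Expo b c d e a.

Definition rotations (z : expo) : seq expo :=
  let: Expo a b c d e := z in
  [:: z; Expo b c d e a; Expo c d e a b; Expo d e a b c; Expo e a b c d].

Definition canon_key (z : expo) : positive :=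
  foldr (fun y p => Pos.min (encode y) p) (encode z) (behead (rotations z)).

(* If the orbit sum of the combination c of squares involves exactly one orbit
   that is neither low nor already known to be good, that orbit is good too. *)
Definition add_good (pats : seq (seq N)) (good : trie) (c : seq (nat * expo)) : trie :=
  let t := parity_trie [seq canon_key z | z <- sq_list true c] Leaf in
  if [seq p <- elements t | ~~ (is_low pats (decode p) || tmem p good)] is [:: p]
  then toggle p good else good.

(** The order of [red] matters: a relation contributes only when all but one of its orbits are low
    or were reached before. *)
Definition good_trie (pats : seq (seq N)) (B : seq expo)
    (red : seq (seq (nat * expo))) : trie :=
  foldl (add_good pats) (parity_trie [seq canon_key z | z <- B] Leaf) red.

(* As 8 * 4 = 1 and 30 = -1 modulo 31, the last exponent of a monomial of
   weight zero is determined modulo 31 by the first three exponents and the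
   degree. *)
Definition weight0_check (n : nat) (ok : expo -> bool) : bool :=
  all (fun a => let A := N.of_nat a in
  all (fun b => let B := N.of_nat b in
  all (fun c => let C := N.of_nat c in
    let s := N.of_nat (n - a - b - c) in
    let e0 := N.modulo (N.mul 30 (N.add s
      (N.mul 4 (N.add A (N.add (N.mul 2 B) (N.mul 4 C)))))) 31 in
    let test e := if N.leb e s then ok (Expo A B C (N.sub s e) e) else true in
    test e0 && test (N.add e0 31))
  (iota 0 (n - a - b).+1)) (iota 0 (n - a).+1)) (iota 0 n.+1).

Definition weight (m : 'X_{1..5}) : nat := (\sum_(i < 5) m i * 2 ^ i)%N.

Definition red_check (n : nat) (pats : seq (seq N)) (B : seq expo)
    (red : seq (seq (nat * expo))) : bool :=
  let good := good_trie pats B red in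
  [&& all (fun z => edeg_nat z == n) B,
      all (all (fun kz => (0 < kz.1) && (edeg_nat kz.2 + kz.1 == n)))%N red &
      weight0_check n (fun z => is_low pats z || tmem (canon_key z) good)].

Definition norm_vars (i : nat) : seq nat :=
  [:: i; tau_nat true i; tau_nat true (tau_nat true i)].

(* The terms of the image of a monomial under the substitution norm, computed
   along the binary digits of its exponents. *)
Fixpoint norm_terms (k : nat) (b : expo) : seq expo :=
  if k is k'.+1 then
    let hs := norm_terms k' (halves b) in
    let ms := reduce (expand (lin_opts norm_vars) 0 (odds b) [::]) in
    reduce [seq add_double m h | m <- ms, h <- hs]
  else [:: zero_expo].

Definition norm_trie (b : expo) : trie := ptrie (b :: norm_terms 6 b).

Definition matrix_row (As : seq (seq positive)) (b : expo) : seq bool :=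
  let t := norm_trie b in
  [seq odd (count (fun p => tmem p t) A) | A <- As].

Fixpoint bool_dot (r w : seq bool) : bool :=
  match r, w with
  | x :: r', y :: w' => (x && y) (+) bool_dot r' w'
  | _, _ => false
  end.

Definition rotation_keys (A : seq expo) : seq positive :=
  flatten [seq [seq encode y | y <- rotations z] | z <- A].

(* The matrix of the values of the functionals As on norm s + s, for s the orbit
   sum of an element of B; W is a right inverse to its rows but the last. *)
Definition matrix_check (As : seq (seq expo)) (W : seq (seq bool)) (B : seq expo) : bool :=
  let keys := [seq rotation_keys A | A <- As] in
  [seq let r := matrix_row keys b in [seq bool_dot r w | w <- W] | b <- take (size B).-1 B]
  == [seq [seq i == j | j <- iota 0 (size B).-1] | i <- iota 0 (size B).-1].

Lemma weight0_checkP n ok : weight0_check n ok -> (n < 62)%N ->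
  forall z, mdeg (emon z) = n -> (31 %| weight (emon z))%N -> ok z.
Proof.
move=> /allP h n62 [a b c d e]; rewrite mdeg_emon => hn.
rewrite /weight !big_ord_recl big_ord0 !emonE /= => hw.
have := h (N.to_nat a); rewrite mem_iota => /(_ ltac:(lia)) /allP/(_ (N.to_nat b)).
rewrite mem_iota => /(_ ltac:(lia)) /allP/(_ (N.to_nat c)).
rewrite mem_iota => /(_ ltac:(lia)); cbv zeta; rewrite !N2Nat.id.
set s := N.of_nat _; set e0 := N.modulo _ _ => /andP[h0 h1].
have hs : s = N.add d e by rewrite /s; lia.
(* The last exponent is at most n < 62 and is known modulo 31, which leaves two candidates. *)
have [ee|ee] : e = e0 \/ e = N.add e0 31.
  have [k hk] : exists k, N.add (N.add a (N.add (N.mul 2 b) (N.mul 4 c)))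
      (N.add (N.mul 8 d) (N.mul 16 e)) = N.mul 31 k.
    case/dvdnP: hw => k hk; exists (N.of_nat k); move: hk.
    rewrite -[bump 0 0]/1%N -[bump 0 1]/2%N -[bump 0 2]/3%N -[bump 0 3]/4%N.
    rewrite -[(2 ^ 0)%N]/1%N -[(2 ^ 1)%N]/2%N -[(2 ^ 2)%N]/4%N -[(2 ^ 3)%N]/8%N.
    by rewrite -[(2 ^ 4)%N]/16%N; lia.
  have := N.div_mod (N.mul 30 (N.add s
     (N.mul 4 (N.add a (N.add (N.mul 2 b) (N.mul 4 c)))))) 31 ltac:(done).
  have := N.mod_lt (N.mul 30 (N.add s
     (N.mul 4 (N.add a (N.add (N.mul 2 b) (N.mul 4 c)))))) 31 ltac:(done).
  rewrite -/e0; move: (N.div _ _) => q; lia.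
  move: h0; rewrite -ee; have -> : N.leb e s by lia.
  by have -> : N.sub s e = d by lia.
move: h1; rewrite -ee; have -> : N.leb e s by lia.
by have -> : N.sub s e = d by lia.
Qed.

Section Commute.

Variables (F F' : fieldType).
Notation P := {mpoly F[5]}.
Notation P' := {mpoly F'[5]}.
Variables (iota : {rmorphism F -> F'}) (g : {rmorphism P -> P'}).
Variables (t t' : 'I_5 -> 'I_5).
Hypothesis gC : forall c, g c%:MP = (iota c)%:MP.
Hypothesis gX : forall j, map_poly g (tsq t 'X_j) = tsq t' (g 'X_j).

(** Both composites are ring morphisms, so constants and variables decide. The map [iota] allows a
    change of fields and the pair [t], [t'] a change of twist, as both occur in passing between x
    and y. *)
Lemma tsq_comm f : tsq t' (g f) = map_poly g (tsq t f).
Proof.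
rewrite -[LHS]/((tsq t' \o g) f) -[RHS]/((map_poly g \o tsq t) f).
apply: mpoly_rmorph_ext => [c|i] /=; last by rewrite gX.
by rewrite gC !tsqC map_polyC /= gC.
Qed.

Lemma sqt_comm k f : sqt t' k (g f) = g (sqt t k f).
Proof. by rewrite /sqt tsq_comm coef_map. Qed.

Lemma hits_comm f : hits t f -> hits t' (g f).
Proof.
move=> [s ->]; exists [seq (p.1, g p.2) | p <- s].
by rewrite rmorph_sum big_map; apply: eq_bigr => p _; rewrite -sqt_comm.
Qed.

End Commute.

Section YWorld.

Variable F : fieldType.
Hypothesis F2 : (1 + 1 : F) = 0.

Notation P := {mpoly F[5]}.
Notation sigma := (tau true).

Definition rho : P -> P := mmap (@mpolyC 5 F) (fun i => 'X_(sigma i)).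
HB.instance Definition _ := GRing.RMorphism.on rho.

Definition norm : P -> P := mmap (@mpolyC 5 F)
  (fun i => 'X_i + 'X_(sigma i) + 'X_(sigma (sigma i))).
HB.instance Definition _ := GRing.RMorphism.on norm.

Lemma rhoX i : rho 'X_i = 'X_(sigma i).
Proof. by rewrite /rho mmapX mmap1U. Qed.

Lemma rhoC c : rho c%:MP = c%:MP.
Proof. by rewrite /rho mmapC. Qed.

Lemma rhoZ c f : rho (c *: f) = c *: rho f.
Proof. by rewrite -mul_mpolyC rmorphM /= rhoC mul_mpolyC. Qed.

Lemma normX i : norm 'X_i = 'X_i + 'X_(sigma i) + 'X_(sigma (sigma i)).
Proof. by rewrite /norm mmapX mmap1U. Qed.

Lemma normC c : norm c%:MP = c%:MP.
Proof. by rewrite /norm mmapC. Qed.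

Lemma rho_mon z : rho 'X_[emon z] = 'X_[emon (rot_expo z)].
Proof.
case: z => a b c d e; rewrite /emon !X_mono !rmorphM !rmorphXn /= !rhoX /tau.
by rewrite !inordK //= mulrC -!mulrA.
Qed.

Lemma hits_rho f : hits sigma f -> hits sigma (rho f).
Proof.
apply: (@hits_comm _ _ idfun rho) => [c|j]; first exact: rhoC.
by rewrite /= tsqX rhoX tsqX rmorphD rmorphM /= !map_polyC map_polyX /= rmorphXn /= !rhoX.
Qed.

Lemma mpoly_sqrD (x y : P) : (x + y) ^+ 2 = x ^+ 2 + y ^+ 2.
Proof. by rewrite sqrrD mulr2n mpoly_addxx // addr0. Qed.

Lemma mpoly_sqr_sum (I : Type) (r : seq I) (G : I -> P) :
  (\sum_(i <- r) G i) ^+ 2 = \sum_(i <- r) G i ^+ 2.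
Proof.
by apply: (big_morph (fun x => x ^+ 2)) => [x y|]; rewrite ?mpoly_sqrD ?expr0n.
Qed.

Lemma hits_norm f : hits sigma f -> hits sigma (norm f).
Proof.
apply: (@hits_comm _ _ idfun norm) => [c|j]; first exact: normC.
rewrite /= tsqX rmorphD rmorphM /= !map_polyC map_polyX /= rmorphXn /= !normX.
rewrite !(rmorphD (tsq sigma)) /= !tsqX !mpoly_sqrD !polyCD !mulrDl.
have ac (a b c a' b' c' : {poly P}) :
  a + b + c + (a' + b' + c') = a + a' + (b + b') + (c + c') by ring.
exact: ac.
Qed.

Definition orbit_sum (f : P) : P := \sum_(t < 5) iter t rho f.

Lemma iter_rhoD t f g : iter t rho (f + g) = iter t rho f + iter t rho g.
Proof. by elim: t => //= t ->; rewrite rmorphD. Qed.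

Lemma iter_rhoZ t c f : iter t rho (c *: f) = c *: iter t rho f.
Proof. by elim: t => //= t ->; rewrite rhoZ. Qed.

Lemma orbit_sumD f g : orbit_sum (f + g) = orbit_sum f + orbit_sum g.
Proof.
by rewrite /orbit_sum -big_split; apply: eq_bigr => t _; rewrite iter_rhoD.
Qed.

Lemma orbit_sumZ c f : orbit_sum (c *: f) = c *: orbit_sum f.
Proof.
by rewrite /orbit_sum scaler_sumr; apply: eq_bigr => t _; rewrite iter_rhoZ.
Qed.

Lemma orbit_sum0 : orbit_sum 0 = 0.
Proof.
rewrite /orbit_sum big1 // => t _; elim: (val t) => //= k ->.
by rewrite rmorph0.
Qed.

Lemma hits_orbit_sum f : hits sigma f -> hits sigma (orbit_sum f).
Proof.
move=> h; apply: hits_sum => t _; elim: (val t) => //= k; exact: hits_rho.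
Qed.

Lemma orbit_sum_mon z :
  orbit_sum 'X_[emon z] = psum F (rotations z).
Proof.
rewrite /orbit_sum /psum !big_ord_recl big_ord0 /= !rho_mon.
by case: z => a b c d e; rewrite /= !big_cons big_nil.
Qed.

Lemma orbit_sum_rot z y : y \in rotations z ->
  orbit_sum 'X_[emon y] = orbit_sum 'X_[emon z].
Proof.
rewrite !orbit_sum_mon => h; apply: perm_big; move: h.
case: z => a b c d e; rewrite !inE => /or4P[|||/orP[]] /eqP -> //=;
  apply/seq.permP => p /=; lia.
Qed.

Lemma canon_keyP z : exists2 y, y \in rotations z & canon_key z = encode y.
Proof.
rewrite /canon_key; have : {subset behead (rotations z) <= rotations z}.
  by move=> y; apply: mem_behead.
have : z \in rotations z by case: z => *; rewrite inE eqxx.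
elim: (behead _) => [|y l IH] hz hl /=; first by exists z.
have [|u hu ->] := IH hz; first by move=> x xl; apply: hl; rewrite inE xl orbT.
case: (Pos.min_spec (encode y) (encode u)) => -[_ ->]; last by exists u.
by exists y => //; apply: hl; apply: mem_head.
Qed.

Lemma rotations_deg z y : y \in rotations z -> mdeg (emon y) = mdeg (emon z).
Proof.
case: z => a b c d e; rewrite !inE => /or4P[|||/orP[]] /eqP -> //;
  rewrite !mdeg_emon; lia.
Qed.

Lemma orbit_sum_canon z : valid z ->
  orbit_sum 'X_[emon (decode (canon_key z))] = orbit_sum 'X_[emon z].
Proof.
move=> vz; have [y hy ->] := canon_keyP z.
by rewrite encodeK ?(orbit_sum_rot hy) // (rotations_deg hy).
Qed.

Lemma mcoeff_rho f z : (rho f)@_(emon (rot_expo z)) = f@_(emon z).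
Proof.
rewrite (mpolyE f) rmorph_sum !raddf_sum; apply: eq_bigr => m _ /=.
rewrite rhoZ !mcoeffZ -(expo_ofK m) rho_mon !mcoeffX; congr (_ * _%:R).
move: (expo_of m) => y; congr (nat_of_bool _).
case: y z => a b c d e [a' b' c' d' e'].
by apply/eqP/eqP => /emon_inj [-> -> -> -> ->].
Qed.

Lemma mcoeff_orbit_sum f z :
  (orbit_sum f)@_(emon z) = \sum_(y <- rotations z) f@_(emon y).
Proof.
have it t y : (iter t rho f)@_(emon (iter t rot_expo y)) = f@_(emon y).
  by elim: t => //= t; rewrite mcoeff_rho.
rewrite /orbit_sum raddf_sum !big_ord_recl big_ord0 /=.
case: z => a b c d e /=; rewrite !big_cons big_nil; congr (_ + _).
have h1 := it 1%N (Expo e a b c d); have h2 := it 2%N (Expo d e a b c).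
have h3 := it 3%N (Expo c d e a b); have h4 := it 4%N (Expo b c d e a).
apply: etrans (congr2 +%R h1 (congr2 +%R h2 (congr2 +%R h3 (congr2 +%R h4 erefl)))) _.
by move: f@_(emon _) f@_(emon _) f@_(emon _) f@_(emon _) => *; ring.
Qed.

(** On the variables [norm] is 1 + rho + rho^2, so it commutes with [rho]; this makes the test of
    invariance one on orbit sums. *)
Lemma norm_orbit_sum f : norm (orbit_sum f) = orbit_sum (norm f).
Proof.
rewrite /orbit_sum rmorph_sum; apply: eq_bigr => t _ /=.
elim: (val t) => //= k <-.
rewrite -[LHS]/((norm \o rho) _) -[RHS]/((rho \o norm) _).
apply: mpoly_rmorph_ext => [c|i] /=; first by rewrite rhoC !normC rhoC.
by rewrite rhoX !normX !rmorphD /= !rhoX.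
Qed.

(** * Reduction to a few orbit sums and the linear system of invariance *)

Section Span.

Variable B : seq expo.

Notation b_ i := (orbit_sum 'X_[emon (nth zero_expo B i)]).

(* Congruence modulo the hits to a combination of the orbit sums of B. *)
Definition in_span (f : P) : Prop :=
  exists c : nat -> F, hits sigma (f + \sum_(i < size B) c i *: b_ i).

Lemma in_spanD f g : in_span f -> in_span g -> in_span (f + g).
Proof.
move=> [c hc] [d hd]; exists (fun i => c i + d i).
under eq_bigr => i _ do rewrite scalerDl.
by rewrite big_split /= addrACA; apply: hitsD.
Qed.

Lemma in_spanZ a f : in_span f -> in_span (a *: f).
Proof.
move=> [c hc]; exists (fun i => a * c i).
under eq_bigr => i _ do rewrite -scalerA.
by rewrite -scaler_sumr -scalerDr; apply: hitsZ.
Qed.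

Lemma in_span_hits f : hits sigma f -> in_span f.
Proof.
move=> h; exists (fun=> 0); rewrite big1 ?addr0 // => i _; exact: scale0r.
Qed.

Lemma in_span_sum (I : Type) (r : seq I) (Q : pred I) (G : I -> P) :
  (forall i, Q i -> in_span (G i)) -> in_span (\sum_(i <- r | Q i) G i).
Proof.
move=> h; elim/big_rec: _ => [|i f Qi hf]; first exact/in_span_hits/hits0.
exact: in_spanD (h i Qi) hf.
Qed.

Lemma in_span_base i : (i < size B)%N -> in_span (b_ i).
Proof.
move=> hi; exists (fun j => (j == i)%:R).
rewrite (bigD1 (Ordinal hi)) //= eqxx scale1r big1 => [|j]; last first.
  by rewrite -val_eqE /= => /negPf ->; rewrite scale0r.
by rewrite addr0 mpoly_addxx //; apply: hits0.
Qed.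

(** Invariant of the loop over the relations: every orbit in the trie has its orbit sum in the span.
    It holds for the base, and each relation that extends the trie can be solved for its one new
    orbit. *)
Lemma red_check_span n pats red : (n < 62)%N ->
  all (low_ok true n) pats -> red_check n pats B red ->
  forall z, mdeg (emon z) = n -> (31 %| weight (emon z))%N ->
  in_span (orbit_sum 'X_[emon z]).
Proof.
move=> n62 /allP okp /and3P[/allP hB /allP hred hw].
have n64 : (n < 64)%N by apply: leq_trans n62 _.
pose good_ok (t : trie) := forall p, tmem p t ->
  in_span (orbit_sum 'X_[emon (decode p)]).
have low_span z : mdeg (emon z) = n -> is_low pats z -> in_span (orbit_sum 'X_[emon z]).
  move=> hz /hasP[pat /okp ok lz]; apply/in_span_hits/hits_orbit_sum.
  exact: low_hits ok lz hz.
have vdeg z : mdeg (emon z) = n -> valid z by rewrite /valid => ->.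
have degB z : z \in B -> mdeg (emon z) = n by move=> /hB /eqP; rewrite edegE.
suff good_final : good_ok (good_trie pats B red).
  move=> z hz wz; have /orP[lz|gz] := weight0_checkP hw n62 hz wz.
    exact: low_span.
  by rewrite -orbit_sum_canon; [apply: good_final | apply: vdeg].
have good0 : good_ok (parity_trie [seq canon_key z | z <- B] Leaf).
  move=> p; rewrite tmem_parity tmem_Leaf addbF => hodd.
  have /mapP[z zB ->] : p \in [seq canon_key z | z <- B].
    by rewrite -has_pred1 has_count; case: (count _ _) hodd.
  rewrite orbit_sum_canon; last exact/vdeg/degB.
  by rewrite -(nth_index zero_expo zB); apply: in_span_base; rewrite index_mem.
rewrite /good_trie; move: (parity_trie _ _) good0.
elim: red hred {hw} => [|c red IH] hred t ht //=.
apply: IH; first by move=> x xr; apply: hred; rewrite inE xr orbT.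
have /allP hc := hred c (mem_head _ _).
rewrite /add_good; set l := [seq canon_key z | z <- sq_list true c].
have degl : all (fun z => mdeg (emon z) == n) (sq_list true c).
  by apply: sq_list_deg; apply/allP => kz /hc/andP[].
have Esum : orbit_sum (psum F (sq_list true c)) =
    \sum_(p <- elements (parity_trie l Leaf)) orbit_sum 'X_[emon (decode p)].
  rewrite -(sum_parity (fun p => orbit_sum 'X_[emon (decode p)])); last exact: mpoly_addxx.
  rewrite /l big_map; elim: (sq_list true c) degl => [|z s IHs] /=.
    by rewrite /psum !big_nil orbit_sum0.
  case/andP => /eqP hz hs; rewrite big_cons -IHs // orbit_sum_canon; last exact: vdeg.
  by rewrite -orbit_sumD /psum big_cons.
have hsum : hits sigma (orbit_sum (psum F (sq_list true c))).
  by apply/hits_orbit_sum/sq_list_hits => //; apply/allP => kz /hc/andP[].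
have edegl p : p \in elements (parity_trie l Leaf) -> mdeg (emon (decode p)) = n.
  rewrite mem_elements tmem_parity tmem_Leaf addbF => hodd.
  have /mapP[z zs ->] : p \in l.
    by rewrite -has_pred1 has_count; case: (count _ _) hodd.
  have [y hy ->] := canon_keyP z; have := eqP (allP degl z zs) => hz.
  by have hyd := rotations_deg hy; rewrite encodeK hyd hz.
case E : [seq p <- _ | _] => [|p [|q s]] //.
have pin : p \in elements (parity_trie l Leaf).
  have : p \in [:: p] by rewrite inE.
  by rewrite -E mem_filter => /andP[].
(* In characteristic two the new orbit sum is the sum of the hit element and of all other orbits of
   the relation. *)
have hp : in_span (orbit_sum 'X_[emon (decode p)]).
  have -> : orbit_sum 'X_[emon (decode p)] = orbit_sum (psum F (sq_list true c))
     + \sum_(q <- rem p (elements (parity_trie l Leaf))) orbit_sum 'X_[emon (decode q)].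
    rewrite Esum (perm_big _ (perm_to_rem pin)) big_cons -addrA.
    by rewrite mpoly_addxx // addr0.
  apply: in_spanD; first exact: in_span_hits.
  rewrite big_seq; apply: in_span_sum => q.
  rewrite (mem_rem_uniq _ (elements_uniq _)) inE => /andP[qp qin].
  have : q \notin [:: p] by rewrite inE.
  rewrite -E mem_filter qin andbT negbK => /orP[lq|gq]; last exact: ht.
  by apply: low_span => //; apply: edegl.
move=> q; rewrite tmem_toggle; case: eqP => [->|_] //; exact: ht.
Qed.

Arguments tau_nat : simpl never.

Lemma norm_opts_ok : table_ok (lin_opts norm_vars).
Proof.
apply: lin_opts_ok => i hi; have h := tau_nat_lt true hi.
apply/and4P; split; [exact: hi | exact: h | exact: tau_nat_lt | done].
Qed.

Lemma expand_norm z : psum F (expand (lin_opts norm_vars) 0 z [::]) = norm 'X_[emon z].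
Proof.
rewrite (@expand_lin _ F2 _ _ _ norm) ?[psum _ [::]]big_nil ?addr0 //.
  exact: norm_opts_ok.
move=> i; rewrite /opts_val !big_cons big_nil /= !expr0 !mulr1 !expr1 addr0.
have -> : inord (tau_nat true (tau_nat true i)) = sigma (sigma i).
  by rewrite -val_tau.
by rewrite normX !polyCD inord_val addrA.
Qed.

Lemma norm_termsE k b : (mdeg (emon b) < 2 ^ k)%N -> (k <= 6)%N ->
  psum F (norm_terms k b) = norm 'X_[emon b] /\
  all (fun y => mdeg (emon y) == mdeg (emon b)) (norm_terms k b).
Proof.
elim: k b => [|k IH] b hb k6.
  have -> : emon b = 0%MM by apply/eqP; rewrite -mdeg_eq0; case: (mdeg _) hb.
  rewrite mpolyX0 rmorph1 mdeg0 -[norm_terms 0 b]/[:: zero_expo] /psum big_seq1.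
  by rewrite all_seq1 emon0 mpolyX0 mdeg0.
have bE : emon b = (emon (odds b) + emon (halves b) *+ 2)%MM.
  by rewrite {1}(odds_halves b) emon_add_double.
have db : (mdeg (emon b) = mdeg (emon (odds b)) + mdeg (emon (halves b)) * 2)%N.
  by rewrite bE mdegD mdegMn.
have [||Eh dh] := IH (halves b); [|exact: ltnW|].
  by move: hb; rewrite db expnS; lia.
have b64 : (mdeg (emon b) < 64)%N.
  by apply: leq_trans hb _; rewrite -[64%N]/(2 ^ 6)%N leq_exp2l.
set e := expand (lin_opts norm_vars) 0 (odds b) [::].
have de : all (fun y => mdeg (emon y) == mdeg (emon (odds b))) e.
  have := expand_deg norm_opts_ok (z := odds b) (k := 0) (tl := [::]) (erefl _) isT.
  by rewrite addn0.
have ve : all valid e.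
  apply: sub_all de => y /eqP hy; rewrite /valid hy.
  by apply: leq_ltn_trans b64; rewrite db leq_addr.
rewrite [norm_terms _ _]/=; rewrite -/e; set es := reduce e.
set l := [seq add_double m h | m <- es, h <- norm_terms k (halves b)].
have dl : all (fun y => mdeg (emon y) == mdeg (emon b)) l.
  apply/allP => _ /allpairsP[[m h] /= [/(allP (all_reduce ve de))/eqP hm hh ->]].
  have /eqP e2 := allP dh h hh.
  by rewrite emon_add_double mdegD mdegMn hm e2 -db.
have vl : all valid l by apply: sub_all dl => y /eqP hy; rewrite /valid hy.
split; last exact: all_reduce.
rewrite psum_reduce // bE mpolyXD -mpolyXn rmorphM rmorphXn /= -Eh -expand_norm -/e.
rewrite -(psum_reduce F2 ve) -/es /l; move: (norm_terms k _) es {l dl vl Eh dh} => hs ms.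
rewrite mpoly_sqr_sum /psum big_allpairs_dep /= mulr_suml; apply: eq_bigr => m _.
rewrite mulr_sumr; apply: eq_bigr => y _.
by rewrite emon_add_double mpolyXD mpolyXn.
Qed.

Lemma funct_norm n A b : (n < 64)%N -> mdeg (emon b) = n ->
  all (fun z => edeg_nat z == n) A ->
  funct A (norm (orbit_sum 'X_[emon b]) + orbit_sum 'X_[emon b])
  = (odd (count (fun p => tmem p (norm_trie b)) (rotation_keys A)))%:R :> F.
Proof.
move=> n64 hb hA; set l := b :: norm_terms 6 b; rewrite /norm_trie -/l.
have [Enorm dnorm] : psum F (norm_terms 6 b) = norm 'X_[emon b] /\
    all (fun y => mdeg (emon y) == mdeg (emon b)) (norm_terms 6 b).
  by apply: norm_termsE => //; rewrite hb.
have El : norm 'X_[emon b] + 'X_[emon b] = psum F l.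
  by rewrite -Enorm addrC [RHS]/psum big_cons.
have vl : all valid l.
  apply/andP; split; first by rewrite /valid hb.
  by apply: sub_all dnorm => y /eqP hy; rewrite /valid hy hb.
rewrite norm_orbit_sum -orbit_sumD El /funct /rotation_keys.
rewrite -natr_odd // count_flatten -map_comp sumnE big_map natr_sum.
rewrite big_seq [RHS]big_seq; apply: eq_bigr => z zA /=.
rewrite mcoeff_orbit_sum count_map -sum1_count natr_sum [RHS]big_mkcond.
rewrite big_seq [RHS]big_seq; apply: eq_bigr => y hy /=.
rewrite coef_psum_mem //; first by case: (tmem _ _).
by rewrite /valid (rotations_deg hy) edegE -/(edeg_nat z) (eqP (allP hA z zA)).
Qed.

(** Write f as a combination of the b_i modulo hits. The functionals applied to norm f + f give
    linear equations on the coefficients c_i; the right inverse of all rows but the last solves them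
    for every c_k in terms of the last one, with factors that do not depend on f. *)
Lemma matrix_check_line n As W : (n < 64)%N ->
  all (fun z => edeg_nat z == n) B -> all (functional_ok true n) As ->
  matrix_check As W B ->
  exists e, forall f, in_span f -> hits sigma (norm f + f) ->
  exists c, hits sigma (f + c *: e).
Proof.
move=> n64 /allP hB /allP hAs /eqP hM.
have [B0|B0] := eqVneq (size B) 0%N.
  exists 0 => f [c hc] _; exists 0; move: hc; rewrite B0 big_ord0.
  by rewrite scaler0.
pose d := (size B).-1; have Bd : size B = d.+1 by rewrite /d prednK // lt0n.
have degB i : (i < size B)%N -> mdeg (emon (nth zero_expo B i)) = n.
  by move=> hi; apply/eqP; rewrite edegE; apply/hB/mem_nth.
pose row i := matrix_row [seq rotation_keys A | A <- As] (nth zero_expo B i).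
(* These are the coordinates of the solution whose last coordinate is 1: the equation picked out by
   the k-th vector of [W] reads c_k + c_d u_k = 0. *)
pose u k := bool_dot (row d) (nth [::] W k).
have Erow i : (i < d)%N -> [seq bool_dot (row i) w | w <- W] = [seq i == j | j <- iota 0 d].
  move=> hi; have := congr1 (nth [::] ^~ i) hM; rewrite Bd -[d.+1.-1]/d /=.
  rewrite (nth_map zero_expo) ?nth_take ?size_take ?Bd ?ltnSn // => ->.
  by rewrite (nth_map 0%N) ?size_iota // nth_iota.
have hd k i : (k < d)%N -> (i < d)%N -> bool_dot (row i) (nth [::] W k) = (i == k).
  move=> hk hi; have sW : (k < size W)%N.
    by have := congr1 size (Erow i hi); rewrite !size_map size_iota => ->.
  have := congr1 (nth false ^~ k) (Erow i hi).
  by rewrite /= (nth_map [::]) // (nth_map 0%N) ?size_iota // nth_iota.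
exists (b_ d + \sum_(k < d) (u k)%:R *: b_ k) => f [c hc] hf; exists (c d).
(* Apply norm + 1 to the congruence for f; what happens to f itself is hit by assumption. *)
have h1 : hits sigma (\sum_(i < size B) c i *: (norm (b_ i) + b_ i)).
  under eq_bigr => i _ do rewrite scalerDr.
  rewrite big_split /=; set X := \sum_(i < _) _; set Y := (Y in X + Y).
  have nY : norm Y = X.
    rewrite /Y rmorph_sum; apply: eq_bigr => i _ /=.
    by rewrite -mul_mpolyC rmorphM /= normC mul_mpolyC.
  have -> : X + Y = norm (f + Y) + (f + Y) + (norm f + f).
    rewrite rmorphD /= nY; have ac (x y z w : P) :
      x + y + (z + w) + (x + z) = x + x + (z + z) + (y + w) by ring.
    by rewrite ac !mpoly_addxx // !add0r.
  exact: hitsD (hitsD (hits_norm hc) hc) hf.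
have h2 A : A \in As -> \sum_(i < size B) c i * (odd (count
      (fun p => tmem p (norm_trie (nth zero_expo B i))) (rotation_keys A)))%:R = 0.
  move=> hA; have okA := hAs A hA; rewrite -[RHS](funct_hits F2 n64 okA h1).
  rewrite raddf_sum; apply: eq_bigr => i _ /=; rewrite functZ (@funct_norm n) ?degB //.
  by case/andP: okA.
have h3 w : \sum_(i < size B) c i * (bool_dot (row i) w)%:R = 0.
  rewrite /row /matrix_row; elim: (As) w h2 {hAs hM hd u Erow row} => [|A l IH] w h2.
    by rewrite big1 // => i _; rewrite /= mulr0.
  case: w => [|y w]; first by rewrite big1 // => i _; rewrite /= mulr0.
  have hx (x z : bool) : (x (+) z)%:R = x%:R + z%:R :> F.
    by case: x z => [] [] //=; rewrite ?addr0 ?add0r // F2.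
  under eq_bigr => i _ do rewrite /= hx mulrDr.
  rewrite big_split /= IH ?addr0; last by move=> A' hA'; apply: h2; rewrite inE hA' orbT.
  case: y; last by rewrite big1 // => i _; rewrite andbF mulr0.
  under eq_bigr => i _ do rewrite andbT.
  by apply: h2; apply: mem_head.
have h4 k : (k < d)%N -> c k = c d * (u k)%:R.
  move=> hk; have := h3 (nth [::] W k); rewrite Bd big_ord_recr /=.
  rewrite (bigD1 (Ordinal hk)) //= hd // eqxx mulr1 big1 ?addr0.
    move=> e; rewrite -[LHS]addr0 -e addrA.
    by rewrite -[c k]mulr1 -mulrDr F2 mulr0 add0r.
  move=> i ne; rewrite hd // (_ : (i == k :> nat) = false) ?mulr0 //.
  by apply/negbTE; rewrite -val_eqE in ne.
have -> : f + c d *: (b_ d + \sum_(k < d) (u k)%:R *: b_ k) =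
          f + \sum_(i < size B) c i *: b_ i.
  rewrite Bd big_ord_recr /= scalerDr [c d *: b_ d + _]addrC; congr (_ + (_ + _)).
  rewrite scaler_sumr; apply: eq_bigr => k _.
  by rewrite scalerA -h4.
exact: hc.
Qed.

End Span.

End YWorld.

(** * Invariance under the general linear group *)

Lemma addF2 : (1 + 1 : 'F_2) = 0.
Proof. by apply/val_inj. Qed.

Section Hit.

Notation sid := (tau false).

Lemma tau_id i : sid i = i.
Proof. exact: inord_val. Qed.

Lemma total_sqE f : total_sq f = tsq sid f.
Proof.
apply: (@mpoly_rmorph_ext _ _ _ total_sq (tsq sid)) => [c|i] /=.
  by rewrite tsqC /total_sq mmapC.
by rewrite tsqX total_sqX tau_id.
Qed.

Lemma SqE k f : Sq k f = sqt sid k f.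
Proof. by rewrite /Sq /sqt total_sqE. Qed.

Lemma steenrod_hits d th : steenrod d th ->
  (forall f, hits sid f -> hits sid (th f)) /\
  ((0 < d)%N -> forall f, hits sid (th f)).
Proof.
elim=> {d th} [k|d e a b _ [a1 a2] _ [b1 b2]|d|d a b _ [a1 a2] _ [b1 b2]].
- have h : (0 < k)%N -> forall f, hits sid (Sq k f).
    by move=> k0 f; rewrite SqE; apply: hits_sqt.
  split=> // f hf; have [->|k0] := posnP k; last exact: h.
  by rewrite SqE sqt_deg0.
- split=> [f hf|]; first exact/a1/b1.
  rewrite addn_gt0 => /orP[d0|e0] f; first exact: a2.
  by apply/a1/b2.
- by split=> *; apply: hits0.
- split=> [f hf|d0 f]; first by apply: hitsD; [apply: a1 | apply: b1].
  by apply: hitsD; [apply: a2 | apply: b2].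
Qed.

Lemma hitP f : hit f <-> hits sid f.
Proof.
split=> [|[s ->]]; first elim=> [|d th u h d0 sth _ ih]; first exact: hits0.
  by apply: hitsD ih; have [_] := steenrod_hits sth; apply.
elim: s => [|[k u] s IH]; first by rewrite big_nil; apply: hit_zero.
rewrite big_cons /= -SqE; exact: hit_add (steenrod_Sq k.+1) IH.
Qed.

End Hit.

(** * Row reduction by elementary matrices *)

Section RowReduction.

Variable n : nat.
Implicit Types (A : 'M['F_2]_n) (i j r c : 'I_n).

Lemma row_addE i j A r c :
  ((1%:M + delta_mx i j) *m A) r c = A r c + (r == i)%:R * A j c.
Proof.
rewrite mulmxDl mul1mx mxE; congr (_ + _); rewrite mxE (bigD1 j) //= mxE eqxx andbT.
by rewrite big1 ?addr0 // => k /negPf hk; rewrite mxE hk andbF mul0r.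
Qed.

Lemma row_addK i j A : i != j ->
  (1%:M + delta_mx i j) *m ((1%:M + delta_mx i j) *m A) = A.
Proof.
move=> /negPf ij; apply/matrixP => r c; rewrite !row_addE.
rewrite [j == i]eq_sym ij mul0r addr0 -addrA -mulrDl -[X in X * _]mulr1.
have -> : (r == i)%:R + (r == i)%:R = 0 :> 'F_2.
  by rewrite -[X in X + X]mulr1 -mulrDr addF2 mulr0.
by rewrite !mul0r addr0.
Qed.

Lemma row_add_unit i j A : i != j -> A \in unitmx ->
  (1%:M + delta_mx i j) *m A \in unitmx.
Proof.
move=> ij uA; rewrite unitmx_mul uA andbT.
by have /mulmx1_unit[] := row_addK 1%:M ij; rewrite mulmx1.
Qed.

(** Over the field with two elements row additions suffice: the only nonzero scalar is 1, and a zero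
    pivot is repaired by adding a lower row instead of swapping. The induction is on the number of
    columns not yet equal to those of the identity. *)
Lemma row_reduction (C : 'M['F_2]_n -> Prop) : C 1%:M ->
  (forall i j A, i != j -> C ((1%:M + delta_mx i j) *m A) -> C A) ->
  forall A, A \in unitmx -> C A.
Proof.
move=> C1 CE; pose reduced k A := forall r c, (c < k)%N -> A r c = (r == c)%:R.
suff h k : (k <= n)%N -> forall A, A \in unitmx -> reduced (n - k)%N A -> C A.
  by move=> A uA; apply: (h n) => // r c; rewrite subnn.
elim: k => [|k IH] kn A uA redA.
  suff -> : A = 1%:M by [].
  by apply/matrixP => r c; rewrite mxE redA // subn0 ltn_ord.
have pn : (n - k.+1 < n)%N by rewrite ltn_subrL ltn0Sn (leq_trans _ kn).
pose p : 'I_n := Ordinal pn.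
have pE : (n - k = p.+1)%N by rewrite /= subnS prednK // subn_gt0.
(* Once the pivot is 1, induct on the number of other nonzero entries of its column. *)
have clear m B : B \in unitmx -> reduced p B -> B p p = 1 ->
    #|[pred r | (r != p) && (B r p != 0)]| = m -> C B.
  elim: m B => [|m IHm] B uB redB Bpp.
    move/card0_eq => B0; apply: IH => // [|r c]; first exact: ltnW.
    rewrite pE ltnS leq_eqVlt => /orP[/eqP/val_inj ->|]; last exact: redB.
    have [->|rp] := eqVneq r p; first exact: Bpp.
    by have := B0 r; rewrite inE /= rp /= => /negbT; rewrite negbK => /eqP.
  move=> card; have /card_gt0P[r] : (0 < #|[pred r | (r != p) && (B r p != 0%R)]|)%N.
    by rewrite card.
  rewrite inE /= => /andP[rp Brp]; apply: (CE r p) => //; apply: IHm.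
  - exact: row_add_unit.
  - move=> s c cp; rewrite row_addE redB // [B p c]redB //.
    by rewrite (_ : (p == c) = false) ?mulr0 ?addr0 // -val_eqE /= gtn_eqF.
  - by rewrite row_addE Bpp eq_sym (negPf rp) mul0r addr0.
  move: card; rewrite (cardD1 r) inE /= rp Brp /= => -[<-].
  apply: eq_card => s; rewrite !inE /= row_addE Bpp mulr1.
  have [->|sr] := eqVneq s r; last by rewrite addr0.
  have [/eqP|->] := F2_01 (B r p); first by rewrite (negPf Brp).
  by rewrite addF2 eqxx andbF.
have [Apz|App] := F2_01 (A p p); last exact: (clear _ A).
have [r] : exists r, ((p < r)%N && (A r p != 0)).
  apply/existsP; apply: contraT; rewrite negb_exists => /forallP h0.
  (* If column p vanished from the diagonal down, it would be a combination of the earlier columns,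
     which are unit vectors. That relation is the nonzero vector w in the kernel of A. *)
  pose w : 'cV_n := \col_i (if (i < p)%N then A i p else (i == p)%:R).
  have : A *m w = 0.
    apply/matrixP => r z; rewrite mxE [RHS]mxE (bigID (fun i : 'I_n => (i < p)%N)) /=.
    have -> : \sum_(i < n | (i < p)%N) A r i * w i z = if (r < p)%N then A r p else 0.
      case: (ltnP r p) => rp.
        rewrite (bigD1 r) //= redA // eqxx mul1r mxE rp big1 ?addr0 // => i /andP[ip ir].
        by rewrite redA // eq_sym (negPf ir) mul0r.
      rewrite big1 // => i ip; rewrite redA // (_ : (r == i) = false) ?mul0r //.
      by rewrite -val_eqE /= gtn_eqF // (leq_trans ip).
    have -> : \sum_(i < n | ~~ (i < p)%N) A r i * w i z = A r p.
      rewrite (bigD1 p) /= ?ltnn // mxE ltnn eqxx mulr1 big1 ?addr0 // => i /andP[/negPf ip].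
      by move=> /negPf pi; rewrite mxE ip pi mulr0.
    case: (ltnP r p) => rp.
      by rewrite -[A r p]mulr1 -mulrDr addF2 mulr0.
    rewrite add0r; move: rp; rewrite leq_eqVlt => /orP[/eqP/val_inj <- //|pr].
    by have := h0 r; rewrite pr negbK => /eqP.
  move=> /(congr1 (mulmx (invmx A))); rewrite mulKmx // mulmx0 => /matrixP/(_ p 0).
  by rewrite !mxE ltnn eqxx => /eqP; rewrite oner_eq0.
move=> /andP[pr Arp]; apply: (CE p r); first by rewrite -val_eqE /= ltn_eqF.
apply: clear (erefl _).
- by apply: row_add_unit; rewrite // -val_eqE /= ltn_eqF.
- move=> s c cp; rewrite row_addE redA // [A r c]redA //.
  by rewrite (_ : (r == c) = false) ?mulr0 ?addr0 // -val_eqE /= gtn_eqF // (ltn_trans cp).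
rewrite row_addE eqxx mul1r Apz add0r.
by have [e|//] := F2_01 (A r p); rewrite e eqxx in Arp.
Qed.

End RowReduction.

(* A matrix over the field with two elements, given by its columns. *)
Definition bit_entry (s : seq (seq bool)) (i j : nat) : bool := nth false (nth [::] s j) i.

Definition bit_mx (s : seq (seq bool)) : 'M['F_2]_5 :=
  \matrix_(i < 5, j < 5) (bit_entry s i j)%:R.

Definition bit_tab (f : nat -> nat -> bool) : seq (seq bool) :=
  [seq [seq f i j | i <- iota 0 5] | j <- iota 0 5].

Definition bit_mul (s t : seq (seq bool)) : seq (seq bool) :=
  bit_tab (fun i j =>
    foldr (fun k b => (bit_entry s i k && bit_entry t k j) (+) b) false (iota 0 5)).

Definition bit_id := bit_tab (fun i j => i == j).

Lemma bit_tabE f i j : (i < 5)%N -> (j < 5)%N -> bit_entry (bit_tab f) i j = f i j.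
Proof.
move=> hi hj; rewrite /bit_entry /bit_tab (nth_map 0%N) ?size_iota // nth_iota //.
by rewrite (nth_map 0%N) ?size_iota // nth_iota.
Qed.

Lemma bit_mx_id : bit_mx bit_id = 1%:M.
Proof. by apply/matrixP => i j; rewrite !mxE bit_tabE. Qed.

Lemma natr_addb (R : nzRingType) (x y : bool) : (1 + 1 = 0 :> R) ->
  (x (+) y)%:R = x%:R + y%:R :> R.
Proof. by move=> R2; case: x y => [] [] //=; rewrite ?addr0 ?add0r // R2. Qed.

Lemma bit_mxM s t : bit_mx (bit_mul s t) = bit_mx s *m bit_mx t.
Proof.
apply/matrixP => i j; rewrite !mxE bit_tabE // -[iota 0 5]/(index_iota 0 5).
transitivity (\sum_(0 <= k < 5) (bit_entry s i k)%:R * (bit_entry t k j)%:R : 'F_2).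
  elim: (index_iota 0 5) => [|k l IH]; first by rewrite big_nil.
  by rewrite big_cons -IH /= natr_addb ?addF2 // -mulnb natrM.
by rewrite big_mkord; apply: eq_bigr => k _; rewrite !mxE.
Qed.

Lemma bit_mx_unit s t : bit_mul s t == bit_id -> bit_mx s \in unitmx.
Proof.
move=> /eqP h; have := bit_mxM s t; rewrite h bit_mx_id => /esym.
by move/mulmx1_unit/proj1.
Qed.

Lemma GL5_of_unit (A : 'M['F_2]_5) : A \in unitmx -> exists g : GL5, GLval g = A.
Proof. by move=> uA; exists (FinRing.Unit uA). Qed.

Definition bit_elem i j := bit_tab (fun r c => (r == c) || (r == i) && (c == j)).

Lemma bit_mx_elem (i j : 'I_5) : i != j -> bit_mx (bit_elem i j) = 1%:M + delta_mx i j.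
Proof.
move=> ij; apply/matrixP => r c; rewrite !mxE bit_tabE // val_eqE.
case: eqVneq => [->|_] /=; last by rewrite add0r.
case: andP => [[/eqP e1 /eqP e2]|_]; last by rewrite addr0.
by case/eqP: ij; apply/val_inj; rewrite -e1 -e2.
Qed.

(* The transvection x_2 |-> x_2 + x_3 and the cycle x_i |-> x_(i - 1). *)
Definition transvection := bit_elem 3 2.
Definition cycle5 := bit_tab (fun i j => (i.+1 %% 5 == j)%N).

(* Conjugates of the transvection by the cycle are elementary matrices, and
   commutators of these yield the other ones. *)
Definition sub_word (j : nat) : seq (seq bool) :=
  let a := ((7 - j %% 5) %% 5)%N in
  bit_mul (iter a (bit_mul cycle5) transvection) (iter (5 - a) (bit_mul cycle5) bit_id).

(** Both factors are involutions, so the square of their product is their commutator. The word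
    stands for 1 plus the matrix unit at row j + d + 1 modulo 5 and column j, for d at most 3. *)
Fixpoint elem_word (d j : nat) : seq (seq bool) :=
  if d is d'.+1 then
    let w := bit_mul (sub_word (j + d)) (elem_word d' j) in bit_mul w w
  else sub_word j.

Lemma elem_wordE :
  all (fun i => all (fun j =>
    (i == j) || (elem_word ((i + 4 - j) %% 5) j == bit_elem i j)) (iota 0 5)) (iota 0 5).
Proof. by vm_compute. Qed.

Section Stabilizer.

Variable f : P5.

Definition fixes (A : 'M['F_2]_5) := exists2 g : GL5, GLval g = A & hit (act g f + f).

Lemma fixesM A B : fixes A -> fixes B -> fixes (A *m B).
Proof.
move=> [g <- hg] [h <- hh]; exists (g * h)%g; first exact: GL_MxE.
have E (x y z : P5) : x + y + (y + z) = x + z.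
  by rewrite -addrA [y + (y + z)]addrA (mpoly_addxx addF2) add0r.
by have := hitD (hit_act g hh) hg; rewrite Defs.actD E -Defs.actM.
Qed.

Lemma fixes1 : fixes 1%:M.
Proof.
exists 1%g; first exact: GL_1E.
by rewrite act1g mpoly_addxx ?addF2 //; apply: hit_zero.
Qed.

Hypothesis fixes_transvection : fixes (bit_mx transvection).
Hypothesis fixes_cycle : fixes (bit_mx cycle5).

Lemma fixes_word d j : fixes (bit_mx (elem_word d j)).
Proof.
have fc a s : fixes (bit_mx s) -> fixes (bit_mx (iter a (bit_mul cycle5) s)).
  by move=> hs; elim: a => //= a IH; rewrite bit_mxM; apply: fixesM.
have f0 k : fixes (bit_mx (sub_word k)).
  rewrite bit_mxM; apply: fixesM; apply: fc => //.
  by rewrite bit_mx_id; apply: fixes1.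
elim: d => [|d IH]; first exact: f0.
have hw : fixes (bit_mx (bit_mul (sub_word (j + d.+1)) (elem_word d j))).
  by rewrite bit_mxM; apply: fixesM.
by rewrite [bit_mx _]bit_mxM; apply: fixesM.
Qed.

Lemma fixes_all g : hit (act g f + f).
Proof.
suff : fixes (GLval g) by move=> [h /val_inj ->].
apply: row_reduction (GL_unitmx g); first exact: fixes1.
move=> i j A ij hA; rewrite -(row_addK A ij); apply: fixesM hA.
rewrite -bit_mx_elem //; have /allP/(_ (val i)) := elem_wordE.
rewrite mem_iota ltn_ord => /(_ isT)/allP/(_ (val j)).
rewrite mem_iota ltn_ord => /(_ isT)/orP[/eqP/val_inj e|/eqP <-].
  by rewrite e eqxx in ij.
exact: fixes_word.
Qed.

End Stabilizer.

Definition col_vars (s : seq (seq bool)) (j : nat) : seq nat :=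
  [seq i <- iota 0 5 | bit_entry s i j].

Lemma col_vars_ok s : table_ok (lin_opts (col_vars s)).
Proof.
apply: lin_opts_ok => i _; apply/allP => k; rewrite mem_filter mem_iota.
by case/andP.
Qed.

Lemma lin_form_bits (s : seq (seq bool)) (g : GL5) (j : 'I_5) : GLval g = bit_mx s ->
  opts_val 'F_2 (lin_opts (col_vars s) j) = (act g 'X_j)%:P.
Proof.
move=> hg; rewrite Defs.actX /lin_form hg /opts_val /lin_opts /col_vars big_map big_filter.
rewrite -[iota 0 5]/(index_iota 0 5) big_mkord rmorph_sum /= big_mkcond /=.
apply: eq_bigr => i _; rewrite inord_val expr0 mulr1 expr1 mxE.
by case: (bit_entry _ _ _); rewrite ?scale1r ?scale0r ?polyC0.
Qed.

Lemma psum_act s (g : GL5) l : GLval g = bit_mx s ->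
  psum 'F_2 (foldr (expand (lin_opts (col_vars s)) 0) l l) = act g (psum 'F_2 l) + psum 'F_2 l.
Proof.
move=> hg; elim: l {1 4}l => [|z l IH] t /=; first by rewrite /psum big_nil rmorph0 add0r.
rewrite (@expand_lin _ addF2 _ _ _ (act g)) //; last by move=> i; apply: lin_form_bits.
  by rewrite IH [psum _ (z :: l)]big_cons [act g (_ + _)]rmorphD /= addrA.
exact: col_vars_ok.
Qed.

Lemma cert_fixes s t n pats c l : (n < 64)%N -> all (low_ok false n) pats ->
  bit_mul s t == bit_id ->
  hit_cert false n pats c (foldr (expand (lin_opts (col_vars s)) 0) l l) ->
  fixes (psum 'F_2 l) (bit_mx s).
Proof.
move=> n64 okp /bit_mx_unit/GL5_of_unit[g hg] /(hit_cert_hits addF2 n64 okp).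
by rewrite (psum_act _ hg) => /hitP; exists g.
Qed.

Definition expo_of_tuple (t : nat * nat * nat * nat * nat) : expo :=
  let: (a, b, c, d, e) := t in
  Expo (N.of_nat a) (N.of_nat b) (N.of_nat c) (N.of_nat d) (N.of_nat e).

Lemma poly_ofE s : poly_of s = psum 'F_2 [seq expo_of_tuple t | t <- s].
Proof.
rewrite /poly_of /psum big_map; apply: eq_bigr => -[[[[a b] c] d] e] _ /=.
by rewrite /emon !Nat2N.id.
Qed.

Lemma phi_psum l :
  phi (psum 'F_2 l) = psum 'F_2 [seq add_double (Expo 1 1 1 1 1) z | z <- l].
Proof.
rewrite /phi (mpoly_sqr_sum addF2) mulr_sumr /psum big_map; apply: eq_bigr => z _.
rewrite emon_add_double mpolyXD mpolyXn; congr (_ * _).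
rewrite mpolyXE_id; apply: eq_bigr => i _.
by rewrite emonE; case: i => [[|[|[|[|[|]]]]] //] hi; rewrite expr1.
Qed.

(** * The field with 32 elements *)

(** A splitting field of t^5 + t^2 + 1, with [lam] the coordinate along 1. A root of this polynomial
    has order 31, which [root31] and [root_neq1] derive from the equation alone. *)
Lemma field32 : exists (K : fieldType) (iota : {rmorphism 'F_2 -> K})
  (lam : {additive K -> 'F_2}) (z : K), lam 1 = 1 /\ z ^+ 5 = z ^+ 2 + 1.
Proof.
pose p : {poly 'F_2} := 'X^5 + ('X^2 + 1).
have sp : size p = 6.
  by rewrite size_polyDl size_polyXn // size_polyDl size_polyXn ?size_poly1.
have p0 : p != 0 by rewrite -size_poly_gt0 sp.
have [L [zs Dp _]] := FinSplittingFieldFor p0.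
case: zs Dp => [|z zs] Dp.
  by have := eqp_size Dp; rewrite big_nil size_poly1 size_map_poly sp.
have rz : root (map_poly (in_alg L) p) z.
  by rewrite (eqp_root Dp) big_cons rootM root_XsubC eqxx.
exists L, (in_alg L), (coord [tuple (1 : L)] 0), z; split.
  have fr : free [tuple (1 : L)] by rewrite seq1_free oner_eq0.
  by have := coord_free 0 0 fr; rewrite eqxx.
move: rz; rewrite /p /root !rmorphD /= !rmorphXn /= map_polyX rmorph1 !hornerE.
have L2 : (1 + 1 : L) = 0 by rewrite -[1](rmorph1 (in_alg L)) -rmorphD addF2 rmorph0.
have N2 (x : L) : - x = x.
  by apply/eqP; rewrite eq_sym -addr_eq0 -[x]mulr1 -mulrDr L2 mulr0.
by move=> h; apply/eqP; rewrite -[_ + 1]N2 -addr_eq0 addrA.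
Qed.

Section BitPowers.

Variables (K : fieldType) (z : K).
Hypothesis K2 : (1 + 1 : K) = 0.
Hypothesis hz : z ^+ 5 = z ^+ 2 + 1.

Definition bit_val (s : seq bool) : K := \sum_(i < 5) (nth false s i)%:R * z ^+ i.

Definition bit_add (s t : seq bool) : seq bool :=
  [seq nth false s i (+) nth false t i | i <- iota 0 5].

(** Multiplication by z: since z^5 = z^2 + 1, the bit leaving degree 4 comes back in degrees 0 and
    2. *)
Definition bit_shift (s : seq bool) : seq bool :=
  let b := nth false s in [:: b 4; b 0; b 1 (+) b 4; b 2; b 3]%N.

Definition bit_pow (m : nat) : seq bool := iter m bit_shift [:: true].

Lemma bit_valD s t : bit_val (bit_add s t) = bit_val s + bit_val t.
Proof.
rewrite /bit_val -big_split; apply: eq_bigr => i _ /=.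
by rewrite (nth_map 0%N) ?size_iota // nth_iota // natr_addb // mulrDl.
Qed.

Lemma bit_val_shift s : bit_val (bit_shift s) = z * bit_val s.
Proof.
rewrite /bit_val !big_ord_recl !big_ord0 /= /bump /= natr_addb //.
move: (nth false s 0)%:R (nth false s 1)%:R (nth false s 2)%:R => a b c.
move: (nth false s 3)%:R (nth false s 4)%:R => d e.
have -> : z * (a * z ^+ 0 + (b * z ^+ 1 + (c * z ^+ 2 + (d * z ^+ 3 + (e * z ^+ 4 + 0))))) =
   a * z + b * z ^+ 2 + c * z ^+ 3 + d * z ^+ 4 + e * z ^+ 5 by ring.
by rewrite hz; ring.
Qed.

Lemma bit_powE m : z ^+ m = bit_val (bit_pow m).
Proof.
elim: m => [|m IH]; last by rewrite exprS IH -bit_val_shift.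
by rewrite /bit_val big_ord_recl /= big1 ?addr0 ?mulr1 // => i _; rewrite nth_default ?mul0r.
Qed.

Lemma sqrDK (x y : K) : (x + y) ^+ 2 = x ^+ 2 + y ^+ 2.
Proof. by rewrite sqrrD -[_ *+ 2]mulr_natr (_ : 2%:R = 0) // mulr0 addr0. Qed.

Lemma frobD i (x y : K) : (x + y) ^+ (2 ^ i) = x ^+ (2 ^ i) + y ^+ (2 ^ i).
Proof. by elim: i => // i IH; rewrite expnSr !exprM IH sqrDK. Qed.

Lemma root31 : z ^+ 31 = 1.
Proof.
by rewrite bit_powE (_ : bit_pow 31 = bit_add (bit_pow 0) [::]) //
  bit_valD -bit_powE expr0 /bit_val big1 ?addr0 // => i _; rewrite nth_nil mul0r.
Qed.

Lemma root_neq1 : z != 1.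
Proof.
apply/eqP => z1; move: hz; rewrite z1 !expr1n K2 => /eqP.
by rewrite oner_eq0.
Qed.

(** As 31 is prime and z is not 1, z^w = 1 only if 31 divides w; otherwise the geometric series of a
    nontrivial 31st root of unity vanishes. *)
Lemma geometric_sum w : \sum_(k < 31) z ^+ w ^+ k = (31 %| w)%N%:R.
Proof.
case: (boolP (31 %| w)%N) => [/dvdnP[q ->]|ndvd].
  rewrite mulnC exprM root31 expr1n; under eq_bigr => k _ do rewrite expr1n.
  by rewrite sumr_const card_ord (natr_odd K2 31).
have xn1 : z ^+ w != 1.
  apply: contra root_neq1 => /eqP w1.
  have cop : coprime 31 w by rewrite prime_coprime.
  have /coprimeP[//|[u v] /= huv] := cop; have e : (u * 31 = v * w + 1)%N by lia.
  have := congr1 (fun k => z ^+ k) e; rewrite /= exprD [(u * _)%N]mulnC [(v * _)%N]mulnC.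
  by rewrite !exprM root31 w1 !expr1n mul1r => /esym/eqP.
have /eqP := subrX1 (z ^+ w) 31; rewrite -exprM mulnC exprM root31 expr1n subrr.
by rewrite eq_sym mulf_eq0 subr_eq0 (negPf xn1) => /eqP.
Qed.

Lemma trace_pow m : \sum_(i < 5) (z ^+ m) ^+ (2 ^ i) =
  bit_val (foldr (fun i => bit_add (bit_pow (m * 2 ^ i %% 31))) [::] (iota 0 5)).
Proof.
have E l : \sum_(i <- l) (z ^+ m) ^+ (2 ^ i) =
  bit_val (foldr (fun i => bit_add (bit_pow (m * 2 ^ i %% 31))) [::] l).
  elim: l => [|i l IH].
    by rewrite big_nil /bit_val big1 // => i _; rewrite nth_nil mul0r.
  by rewrite big_cons IH /= bit_valD -bit_powE -exprM (expr_mod _ root31).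
by rewrite -E -[iota 0 5]/(index_iota 0 5) big_mkord.
Qed.

(* The basis dual to 1, z, ..., z^4 for the trace form consists of powers of z. *)
Definition dual_exp (k : nat) : nat := nth 0%N [:: 26; 25; 29; 28; 27]%N k.

Lemma trace_dual (j k : 'I_5) :
  \sum_(i < 5) (z ^+ (j + dual_exp k)) ^+ (2 ^ i) = (j == k)%:R.
Proof.
have v1 b : bit_val [:: b; false; false; false; false] = b%:R.
  rewrite /bit_val big_ord_recl /= mulr1 big1 ?addr0 // => i _.
  by case: i => [[|[|[|[|]]]]] //= _; rewrite mul0r.
rewrite trace_pow -v1 -val_eqE; congr bit_val; apply/eqP.
have : all (fun j => all (fun k => foldr (fun i =>
    bit_add (bit_pow ((j + dual_exp k) * 2 ^ i %% 31))) [::] (iota 0 5)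
    == [:: j == k; false; false; false; false]) (iota 0 5)) (iota 0 5).
  by vm_compute.
move=> /allP/(_ (val j)); rewrite mem_iota ltn_ord => /(_ isT)/allP/(_ (val k)).
by rewrite mem_iota ltn_ord => /(_ isT).
Qed.

End BitPowers.

(** * Eigenvectors of the Singer cycle *)

Section Eigen.

Variables (K : fieldType) (emb : {rmorphism 'F_2 -> K}).
Variables (lam : {additive K -> 'F_2}) (z : K).
Hypothesis lam1 : lam 1 = 1.
Hypothesis hz : z ^+ 5 = z ^+ 2 + 1.

Notation P := {mpoly K[5]}.
Notation sigma := (tau true).
Notation sid := (tau false).

Lemma addK2 : (1 + 1 : K) = 0.
Proof. by rewrite -[1](rmorph1 emb) -rmorphD addF2 rmorph0. Qed.

Lemma frob_pow m : (z ^+ m) ^+ 32 = z ^+ m.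
Proof. by rewrite exprS -exprM mulnC exprM (root31 addK2 hz) expr1n mulr1. Qed.

(* The linear form of v in the coordinates where multiplication by z is
   diagonal. *)
Definition ell (v : K) : P := \sum_(i < 5) v ^+ (2 ^ i) *: 'X_i.

Lemma ellD u v : ell (u + v) = ell u + ell v.
Proof.
by rewrite /ell -big_split; apply: eq_bigr => i _; rewrite (frobD addK2) scalerDl.
Qed.

Lemma ell0 : ell 0 = 0.
Proof.
by rewrite /ell big1 // => i _; rewrite expr0n expn_eq0 /= scale0r.
Qed.

Lemma ell_sum (I : Type) (r : seq I) (G : I -> K) :
  ell (\sum_(i <- r) G i) = \sum_(i <- r) ell (G i).
Proof. exact: (big_morph ell ellD ell0). Qed.

Definition eigen : P5 -> P := mmap (@mpolyC 5 K \o emb) (fun j => ell (z ^+ j)).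
HB.instance Definition _ := GRing.RMorphism.on eigen.

Lemma eigenX j : eigen 'X_j = ell (z ^+ j).
Proof. by rewrite /eigen mmapX mmap1U. Qed.

Lemma eigenC c : eigen c%:MP = (emb c)%:MP.
Proof. by rewrite /eigen mmapC. Qed.

Lemma eigenZ c f : eigen (c *: f) = emb c *: eigen f.
Proof. by rewrite -mul_mpolyC rmorphM /= eigenC mul_mpolyC. Qed.

Lemma tsq_lin t (c : 'I_5 -> K) : tsq t (\sum_(i < 5) c i *: 'X_i) =
  (\sum_(i < 5) c i *: 'X_i)%:P + (\sum_(i < 5) c i *: 'X_(t i) ^+ 2)%:P * 'X.
Proof.
rewrite !rmorph_sum /= mulr_suml -big_split; apply: eq_bigr => i _ /=.
by rewrite tsqZ tsqX mulrDr mulrA -!rmorphM /= !mul_mpolyC.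
Qed.

Lemma sum_sigma (V : nmodType) (G : 'I_5 -> V) : \sum_(i < 5) G (sigma i) = \sum_(i < 5) G i.
Proof. by rewrite [RHS](reindex_inj (@tau_inj true)). Qed.

(** The shift lowers i by one and squaring restores it; v^32 = v is what closes the cycle at i = 0,
    where sigma gives 4. *)
Lemma pow_sigma (v : K) (i : 'I_5) : v ^+ 32 = v -> (v ^+ (2 ^ sigma i)) ^+ 2 = v ^+ (2 ^ i).
Proof.
move=> v32; rewrite -exprM -expnSr val_tau; case: i => [[|i] hi] //=.
Qed.

(** The origin of the twist: for v^32 = v the square of ell(v) is the sum of v^(2^(i+1)) y_i^2, that
    is, of v^(2^i) y_(i-1)^2, which is the effect of y_i |-> y_(i-1)^2 on ell(v). *)
Lemma eigen_hits f : hits sid f -> hits sigma (eigen f).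
Proof.
apply: (@hits_comm _ _ emb eigen) => [c|j]; first exact: eigenC.
rewrite /= tsqX rmorphD rmorphM /= !map_polyC map_polyX /= tau_id rmorphXn /= eigenX.
rewrite /ell tsq_lin (mpoly_sqr_sum addK2); congr (_ + _%:P * _).
rewrite -[LHS]sum_sigma; apply: eq_bigr => i _.
by rewrite exprZn pow_sigma // frob_pow.
Qed.

Definition realizable (T : P -> P) :=
  exists g : GL5, forall f, T (eigen f) = eigen (act g f).

Lemma realizable_comp T U : realizable T -> realizable U -> realizable (T \o U).
Proof.
move=> [g hg] [h hh]; exists (g * h)%g => f.
by rewrite /= hh hg Defs.actM.
Qed.

Lemma realizable_iter k T : realizable T -> realizable (iter k T).
Proof.
move=> hT; elim: k => [|k IH]; first by exists 1%g => f; rewrite act1g.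
exact: realizable_comp hT IH.
Qed.

(** The columns of [s] are the coordinates, in 1, z, ..., z^4, of the images of these powers; [t] is
    there to certify invertibility. *)
Lemma realize (s t : seq (seq bool)) (T : {rmorphism P -> P}) :
  bit_mul s t == bit_id -> (forall c, T c%:MP = c%:MP) ->
  (forall j : 'I_5, T (ell (z ^+ j)) = ell (bit_val z (nth [::] s j))) ->
  realizable T.
Proof.
move=> /bit_mx_unit/GL5_of_unit[g hg] TC TX; exists g => f.
rewrite -[LHS]/((T \o eigen) f) -[RHS]/((eigen \o act g) f).
apply: mpoly_rmorph_ext => [c|j] /=.
  by rewrite eigenC TC /act comp_mpolyC eigenC.
rewrite eigenX TX Defs.actX /lin_form hg rmorph_sum /bit_val ell_sum.
apply: eq_bigr => i _ /=; rewrite eigenZ eigenX mxE /bit_entry rmorph_nat.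
by case: (nth _ _ _); rewrite ?mul1r ?scale1r // mul0r scale0r ell0.
Qed.

Definition dil : P -> P := mmap (@mpolyC 5 K) (fun i => z ^+ (2 ^ i) *: 'X_i).
HB.instance Definition _ := GRing.RMorphism.on dil.

Lemma dilC c : dil c%:MP = c%:MP.
Proof. by rewrite /dil mmapC. Qed.

Lemma dilZ c f : dil (c *: f) = c *: dil f.
Proof. by rewrite -mul_mpolyC rmorphM /= dilC mul_mpolyC. Qed.

Lemma dilX i : dil 'X_i = z ^+ (2 ^ i) *: 'X_i.
Proof. by rewrite /dil mmapX mmap1U. Qed.

Lemma dil_mon m : dil 'X_[m] = z ^+ weight m *: 'X_[m].
Proof.
rewrite [in LHS]mpolyXE_id rmorph_prod /= [in RHS]mpolyXE_id /weight -prodrXr -scaler_prod.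
by apply: eq_bigr => i _; rewrite rmorphXn /= dilX exprZn -exprM mulnC.
Qed.

Lemma dil_ell v : dil (ell v) = ell (z * v).
Proof.
rewrite /ell rmorph_sum; apply: eq_bigr => i _ /=.
by rewrite dilZ dilX scalerA mulrC exprMn.
Qed.

Lemma rho_ell v : v ^+ 32 = v -> rho (ell v) = ell (v ^+ 2).
Proof.
move=> v32; rewrite /ell rmorph_sum -[RHS]sum_sigma; apply: eq_bigr => i _ /=.
by rewrite rhoZ rhoX exprAC pow_sigma.
Qed.

Lemma norm_ell v : v ^+ 32 = v -> norm (ell v) = ell (v + v ^+ 2 + v ^+ 4).
Proof.
move=> v32; have v32' : (v ^+ 2) ^+ 32 = v ^+ 2 by rewrite exprAC v32.
rewrite !ellD -[v ^+ 4]/(v ^+ (2 * 2)) exprM -(rho_ell v32') -(rho_ell v32).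
rewrite /ell !rmorph_sum -!big_split; apply: eq_bigr => i _ /=.
by rewrite -mul_mpolyC rmorphM /= normC !mul_mpolyC !rhoZ !rhoX normX !scalerDr.
Qed.

Lemma realizable_dil : realizable dil.
Proof.
apply: (@realize [seq bit_pow j.+1 | j <- iota 0 5] [seq bit_pow (j + 30) | j <- iota 0 5] dil).
- by vm_compute.
- exact: dilC.
move=> j; rewrite -[LHS]/(dil _) dil_ell -exprS (nth_map 0%N) ?size_iota // nth_iota //.
by rewrite add0n (bit_powE addK2 hz).
Qed.

Lemma realizable_rho : realizable (@rho K).
Proof.
apply: (@realize [seq bit_pow (2 * j) | j <- iota 0 5]
  [seq bit_pow (16 * j) | j <- iota 0 5] (@rho K)).
- by vm_compute.
- exact: rhoC.
move=> j; rewrite -[LHS]/(rho _) rho_ell ?frob_pow // -exprM.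
rewrite (nth_map 0%N) ?size_iota // nth_iota //.
by rewrite add0n -(bit_powE addK2 hz) mulnC.
Qed.

(** On the powers of z the map is v + v^2 + v^4, that is 1 + F + F^2 with F the Frobenius. As F^5 =
    1 there, its inverse is F + F^2 + F^4, which gives the exponents 2, 4, 16. *)
Lemma realizable_norm : realizable (@norm K).
Proof.
pose tri a b c := [seq bit_add (bit_add (bit_pow (a * j)) (bit_pow (b * j))) (bit_pow (c * j))
                  | j <- iota 0 5].
apply: (@realize (tri 1 2 4) (tri 2 4 16) (@norm K)).
- by vm_compute.
- exact: normC.
move=> j; rewrite -[LHS]/(norm _) norm_ell ?frob_pow // -!exprM.
rewrite (nth_map 0%N) ?size_iota // nth_iota //.
by rewrite add0n !(bit_valD _ addK2) -!(bit_powE addK2 hz) mul1n mulnC [(j * 4)%N]mulnC.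
Qed.

(** * Averaging an invariant class over the group of order 155 *)

Section Average.

Variable f : P5.
Hypothesis hf : forall g, hit (act g f + f).

Lemma realizable_hits T : realizable T -> hits sigma (T (eigen f) + eigen f).
Proof. by move=> [g ->]; rewrite -rmorphD; apply/eigen_hits/hitP/hf. Qed.

Lemma odd_sum_hits n (G : nat -> P) (u : P) : odd n ->
  (forall k, hits sigma (G k + u)) -> hits sigma (\sum_(k < n) G k + u).
Proof.
move=> on hG; have -> : \sum_(k < n) G k + u = \sum_(k < n) (G k + u).
  rewrite big_split sumr_const card_ord /=; congr (_ + _).
  by rewrite -scaler_nat (natr_odd addK2) on scale1r.
by apply: hits_sum => k _.
Qed.

Lemma average_hits :
  hits sigma (orbit_sum (\sum_(k < 31) iter k dil (eigen f)) + eigen f).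
Proof.
rewrite /orbit_sum; apply: (@odd_sum_hits 5 (fun t => iter t (@rho K) _)) => // t.
set G := \sum_(k < 31) _.
have hG : hits sigma (G + eigen f).
  apply: (@odd_sum_hits 31 (fun k => iter k dil (eigen f))) => // k.
  exact: realizable_hits (realizable_iter k realizable_dil).
have h1 : hits sigma (iter t (@rho K) (G + eigen f)).
  by elim: t => //= t; apply: hits_rho.
have h2 := realizable_hits (realizable_iter t realizable_rho).
have := hitsD h1 h2; rewrite iter_rhoD -addrA [iter t _ (eigen f) + (_ + _)]addrA.
by rewrite (mpoly_addxx addK2) add0r.
Qed.

End Average.

Lemma mdeg_eigen n f m : f \is n.-homog -> m \in msupp (eigen f) -> mdeg m = n.
Proof.
move=> /dhomogP hf; suff /dhomogP : eigen f \is n.-homog by apply.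
rewrite (mpolyE f) rmorph_sum /= big_seq; apply: rpred_sum => w /hf <-.
rewrite eigenZ; apply: rpredZ; rewrite mpolyXE_id rmorph_prod /= mdegE.
elim/big_rec2: _ => [|j d p _ hp]; first exact: dhomog1.
have hl : ell (z ^+ j) \is 1.-homog.
  by apply: rpred_sum => i _; apply: rpredZ; rewrite dhomogX; apply/eqP/mdeg1.
apply: dhomogM => //; rewrite rmorphXn /= eigenX.
by have := dhomogMn (w j) hl; rewrite mul1n.
Qed.

Section Line.

Variables (n : nat) (pats : seq (seq N)) (B : seq expo).
Variable red : seq (seq (nat * expo)).
Hypothesis n62 : (n < 62)%N.
Hypothesis pats_low : all (low_ok true n) pats.
Hypothesis red_ok : red_check n pats B red.

Lemma eigen_span f : f \is n.-homog -> (forall g, hit (act g f + f)) ->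
  in_span (F := K) B (eigen f).
Proof.
move=> hn hf; set G := \sum_(k < 31) iter k dil (eigen f).
suff hG : in_span (F := K) B (orbit_sum G).
  have := in_spanD hG (in_span_hits B (average_hits hf)).
  by rewrite addrA (mpoly_addxx addK2) add0r.
(* Each monomial is an eigenvector of [dil], so [geometric_sum] turns the sum over the powers of
   [dil] into the projection onto the monomials fixed by it. *)
have -> : G = \sum_(m <- msupp (eigen f))
    (31 %| weight m)%N%:R * (eigen f)@_m *: 'X_[m].
  have iterM m k : iter k dil 'X_[m] = z ^+ weight m ^+ k *: 'X_[m].
    elim: k => [|k IH]; first by rewrite scale1r.
    by rewrite iterS IH dilZ dil_mon scalerA exprSr.
  have iterE k : iter k dil (eigen f) =
      \sum_(m <- msupp (eigen f)) (eigen f)@_m *: iter k dil 'X_[m].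
    elim: k => [|k IH]; first by rewrite {1}[eigen f]mpolyE.
    by rewrite iterS IH rmorph_sum; apply: eq_bigr => m _ /=; rewrite dilZ.
  rewrite /G; under eq_bigr => k _ do rewrite iterE.
  rewrite exchange_big /=; apply: eq_bigr => m _.
  rewrite -scaler_sumr; under eq_bigr => k _ do rewrite iterM.
  by rewrite -scaler_suml (geometric_sum addK2 hz) scalerA mulrC.
rewrite big_seq; elim/big_rec: _ => [|m p hm hp].
  by rewrite orbit_sum0; apply/in_span_hits/hits0.
rewrite orbit_sumD orbit_sumZ; apply: in_spanD hp => //.
have md := mdeg_eigen hn hm.
case: (boolP (31 %| weight m)%N) => [w31|_].
  apply: in_spanZ; rewrite -(expo_ofK m).
  by apply: (red_check_span addK2 n62 pats_low red_ok); rewrite expo_ofK.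
by rewrite mul0r scale0r; apply/in_span_hits/hits0.
Qed.

End Line.

(** * Descent to the field with two elements *)

Definition coeig : P -> P :=
  mmap (@mpolyC 5 K) (fun i => \sum_(k < 5) (z ^+ dual_exp k) ^+ (2 ^ i) *: 'X_k).
HB.instance Definition _ := GRing.RMorphism.on coeig.

Lemma coeigX i : coeig 'X_i = \sum_(k < 5) (z ^+ dual_exp k) ^+ (2 ^ i) *: 'X_k.
Proof. by rewrite /coeig mmapX mmap1U. Qed.

Lemma coeigC c : coeig c%:MP = c%:MP.
Proof. by rewrite /coeig mmapC. Qed.

Lemma coeigZ c f : coeig (c *: f) = c *: coeig f.
Proof. by rewrite -mul_mpolyC rmorphM /= coeigC mul_mpolyC. Qed.

Lemma coeig_hits f : hits sigma f -> hits sid (coeig f).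
Proof.
apply: (@hits_comm _ _ idfun coeig) => [c|j]; first exact: coeigC.
rewrite /= tsqX rmorphD rmorphM /= !map_polyC map_polyX /= rmorphXn /= !coeigX.
rewrite tsq_lin (mpoly_sqr_sum addK2); congr (_ + _%:P * _).
by apply: eq_bigr => k _; rewrite exprZn pow_sigma ?frob_pow // tau_id.
Qed.

(** The coefficient of x_k in the image of x_j is the trace of z^j times the k-th vector of the dual
    basis, hence 1 or 0 according to whether j = k. *)
Lemma coeig_eigen f : coeig (eigen f) = map_mpoly emb f.
Proof.
rewrite -[LHS]/((coeig \o eigen) f); apply: mpoly_rmorph_ext => [c|j] /=.
  by rewrite eigenC coeigC map_mpolyC.
rewrite eigenX map_mpolyX /ell rmorph_sum /=.
under eq_bigr => i _ do rewrite coeigZ coeigX scaler_sumr.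
rewrite exchange_big /=; transitivity (\sum_(k < 5) (j == k)%:R *: 'X_k : P).
  apply: eq_bigr => k _; under eq_bigr => i _ do rewrite scalerA -exprMn -exprD.
  by rewrite -scaler_suml (trace_dual addK2 hz).
rewrite (bigD1 j) //= eqxx scale1r big1 ?addr0 // => k.
by rewrite eq_sym => /negPf ->; rewrite scale0r.
Qed.

Definition coord_mpoly : P -> P5 := map_mpoly lam.

Lemma coord_mpolyZ c (f : P5) : coord_mpoly (c *: map_mpoly emb f) = lam c *: f.
Proof.
apply/mpolyP => m; rewrite /coord_mpoly mcoeff_map_mpoly !mcoeffZ mcoeff_map_mpoly.
rewrite /=; have [->|->] := F2_01 (f@_m); first by rewrite (rmorph0 emb) !mulr0 (raddf0 lam).
by rewrite (rmorph1 emb) !mulr1.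
Qed.

(** The squares of monomials have coefficients in the field with two elements, so applying the
    additive map [lam] to all coefficients commutes with the squares. *)
Lemma coord_mpoly_hits (f : P) : hits sid f -> hits sid (coord_mpoly f).
Proof.
have sqt_emb k g : sqt sid k (map_mpoly emb g) = map_mpoly emb (sqt sid k g).
  apply: (@sqt_comm _ _ emb (map_mpoly emb)) => [c|j]; first exact: map_mpolyC.
  rewrite tsqX rmorphD rmorphM /= !map_polyC map_polyX /= rmorphXn /= !map_mpolyX.
  by rewrite tsqX.
have sqt_coord k g : coord_mpoly (sqt sid k g) = sqt sid k (coord_mpoly g).
  have embX m : 'X_[m] = map_mpoly emb 'X_[m] :> P by rewrite map_mpolyX.
  transitivity (\sum_(m <- msupp g) lam g@_m *: sqt sid k 'X_[m]).
    rewrite {1}(mpolyE g) sqt_sum [coord_mpoly _]raddf_sum; apply: eq_bigr => m _.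
    by rewrite sqtZ embX sqt_emb; apply: coord_mpolyZ.
  have -> : coord_mpoly g = \sum_(m <- msupp g) lam g@_m *: 'X_[m].
    rewrite {1}(mpolyE g) [LHS]raddf_sum; apply: eq_bigr => m _.
    by rewrite embX; apply: coord_mpolyZ.
  by rewrite sqt_sum; apply: eq_bigr => m _; rewrite sqtZ.
move=> [s ->]; exists [seq (p.1, coord_mpoly p.2) | p <- s].
by rewrite /coord_mpoly raddf_sum big_map; apply: eq_bigr => p _; rewrite -sqt_coord.
Qed.

Lemma hits_descend (f h : P5) a :
  hits sigma (eigen f + a *: eigen h) -> hit (f + lam a *: h).
Proof.
move=> /coeig_hits/coord_mpoly_hits/hitP; rewrite rmorphD /= coeigZ !coeig_eigen.
rewrite -[map_mpoly emb f]scale1r /coord_mpoly raddfD /= -!/(coord_mpoly _).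
by rewrite !coord_mpolyZ lam1 scale1r.
Qed.

End Eigen.

Section Line.

Variables (n : nat) (pats : seq (seq N)) (B : seq expo).
Variables (red : seq (seq (nat * expo))) (As : seq (seq expo)) (W : seq (seq bool)).
Hypothesis n62 : (n < 62)%N.
Hypothesis pats_low : all (low_ok true n) pats.
Hypothesis red_ok : red_check n pats B red.
Hypothesis As_ok : all (functional_ok true n) As.
Hypothesis matrix_ok : matrix_check As W B.

(** Over K both f and h are multiples of the same element e modulo hits. The multiple for h is not
    zero, so e can be eliminated, and the resulting relation between f and h descends. *)
Lemma invariant_line (h : P5) : h \is n.-homog ->
  (forall g, hit (act g h + h)) -> ~ hit h ->
  forall f, f \is n.-homog -> (forall g, hit (act g f + f)) ->
  exists c, hit (f + c *: h).
Proof.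
move=> hn hh h0 f fn hf.
have [K [emb [lam [z [lam1 hz]]]]] := field32.
have degB : all (fun y => edeg_nat y == n) B by case/and3P: red_ok.
have n64 : (n < 64)%N by apply: leq_trans n62 _.
have [e line] := matrix_check_line (addK2 emb) n64 degB As_ok matrix_ok.
have key u : u \is n.-homog -> (forall g, hit (act g u + u)) ->
    exists c, hits (tau true) (eigen emb z u + c *: e).
  move=> un hu; apply: line; first exact: eigen_span pats_low red_ok _ un hu.
  exact: (realizable_hits hz hu (realizable_norm emb hz)).
have [a ha] := key h hn hh; have [c hc] := key f fn hf.
(* Otherwise the image of h over K would be hit, and by descent h itself. *)
have a0 : a != 0.
  apply/eqP => a0; apply: h0; rewrite -[h]addr0 -(scale0r h) -(raddf0 lam).
  apply: (hits_descend (emb := emb) lam1 hz); rewrite scale0r.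
  by move: ha; rewrite a0 scale0r.
exists (lam (c / a)); apply: (hits_descend (emb := emb) lam1 hz).
have -> : eigen emb z f + c / a *: eigen emb z h =
    (eigen emb z f + c *: e) + (c / a) *: (eigen emb z h + a *: e).
  by rewrite scalerDr scalerA divfK // addrACA (mpoly_addxx (addK2 emb)) addr0.
by apply: hitsD hc (hitsZ _ ha).
Qed.

End Line.

(** * Certificates *)

(* The character of code 48 + v stands for the digit v; line breaks are skipped. *)
Fixpoint digits (s : string) : seq N :=
  if s is String c s' then
    let v := N_of_ascii c in
    if N.leb 48 v then N.sub v 48 :: digits s' else digits s'
  else [::].

Fixpoint fives (l : seq N) : seq expo :=
  if l is [:: a, b, c, d, e & l'] then Expo a b c d e :: fives l' else [::].

(** 78 is the digit of the tilde, which separates the blocks. *)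
Definition blocks (l : seq N) : seq (seq N) :=
  foldr (fun v r => if N.eqb v 78 then [::] :: r else (v :: head [::] r) :: behead r)
    [:: [::]] l.

(* The digit 78 is a continuation: it is added to the gap that follows. *)
Definition gaps (l : seq N) : seq N :=
  foldr (fun v r => if N.eqb v 78 then N.add 78 (head 0%num r) :: behead r else v :: r)
    [::] l.

Definition upto (m : N) : seq N := [seq N.of_nat i | i <- iota 0 (N.to_nat m).+1].

(** A row consists of s + 1 monomials and p is the next free position in it. A gap that runs past
    the end of the row is carried to the next one, diminished by what was left of this row. *)
Fixpoint gap_row (s : N) (f : N -> expo) (p : N) (gs : seq N) (acc : seq expo) :=
  if gs is g :: gs' then
    let q := N.add p g in
    if N.leb q s then gap_row s f (N.add q 1) gs' (f q :: acc)
    else (N.sub q (N.add s 1) :: gs', acc)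
  else ([::], acc).

(* The monomials of degree d, in lexicographic order, selected by the numbers of
   those skipped. *)
Definition gap_expos (d : N) (gs : seq N) : seq expo :=
  (foldl (fun st a => foldl (fun st b => foldl (fun st c =>
       let s := N.sub d (N.add a (N.add b c)) in
       gap_row s (fun x => Expo a b c x (N.sub s x)) 0 st.1 st.2)
     st (upto (N.sub d (N.add a b)))) st (upto (N.sub d a))) (gs, [::]) (upto d)).2.

(** The i-th string lists the arguments of Sq^(2^i): the squares of these degrees generate the
    Steenrod algebra. *)
Definition gap_cert (n : nat) (ss : seq string) : seq (nat * expo) :=
  flatten [seq let k := (2 ^ i)%N in
    [seq (k, z) | z <- gap_expos (N.of_nat (n - k)) (gaps (digits (nth EmptyString ss i)))]
    | i <- iota 0 (size ss)].

Definition transvection_cert18 : seq (nat * expo) := gap_cert 18 [::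
"~~A000001:11111633F1D1~~Z3>2=54~<1~7@06010?1~pe1>\~t000001:11111633F1D1r100004=26031313001200320
721;2130500P2;11110302100605506019000124000A27:E2i103<1B100030130;D16;>110S007611<20~:k0F7O02~~~
~~~~~~~o3>2=54|2T7000@WO08<L4~>;S~~5y1~:14[012<~LGsI~~0@06010?1_0M7T00K500~4~~~~~~~1~~H~>1>~~e"%string;
"~}G93~D3:11001Z0e@0005102@27~xy01~~~SG93~d43010Q<5500A100<4423102320240510<00G000D1B1z^q41131109
2~R7<30]3:11001Z0h1004;B0601400120390PK:<P06JaC360P60\~~0@0005102@27_000Q536U0M7~~[1m~~K~~~~NqL~
~~N01f~~~~~~|"%string;
"~_0=;1~~9=Bf20>0e0c~w0=;1~4@:780701W;433430410F@B00L43330`1Q132~~~:|R~~^=B^S00~2[1RJr20>0V~A1mz0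
~~l"%string;
"~~~~X=~^"%string;
""%string].

Definition cycle_cert18 : seq (nat * expo) := gap_cert 18 [::
"~~R1402071001025105414012:003<501006534~~:3313564090D4083dD@EC19170801>1634~~]~~P140207100102510
5414012:003<501006534914020200002140001200405404001266@11111200181281001020003148724000020234002
0:325823510300731635@<<40:41751222205201012332260203501240211017:03035219:003080C712368314263143
<51616110290100141100320010172:316330443010621~~~~~~~~~~w3313564090D4083D3201;D0111@31211704413@
10=311@8?631314;80D:080231<06H075222910U:@748090422984846:fD@EB01001B34113112A02~59023C32N11<<85
7406=02Y50r1E19170801>1634919250>201000O17204100008101?025075240N0140000001000007H1022709161808=
441064~~~~~~~~~:?1;09d09SC1m05K"%string;
"~~?6601210062000E521H313M133?64:0A>0182D<1340:82@4134~1dh\~~~;6601210062000E521H313>670630001072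
N1C60=01210020001240010014200120001003200422831211920005040311561003>2540010Z^`;214112012534501?
4325432KA440254123643010Y133?64:0A>018261332000070005413200100041521312384@K:V6302110E:=099C37G0
707100003130008e602>@1<50110116C2131F<1340:82@41349=0001300@2119??1340114101092000000@200250895X
80000020110:=52422582M80;32360612001054301064~6d~~~Y43~0~1~157~~<\9;412:}N^:4~~~f55E9@3~:"%string;
"~l1=A4073303~fD581T[3~~~81=A4073303M1<89713:001N70171040730>K252@32B40:2G22831922:63010022103301
0145219~~:B~AH=D~6~JD581K882<00T_I?602I13121050=A02U[36961241>RL1035}261x060R05~~2"%string;
"~5~~o\3N;~A"%string;
""%string].

(* Found by linear algebra over the field with two elements, as are the
   certificates for degree 41 below. *)
Definition base18 : seq expo := fives (digits
"007:10097213356135270=311"%string).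

Definition relations18 : seq (seq (nat * expo)) :=
  [seq [seq (18 - edeg_nat z, z)%N | z <- fives r] | r <- blocks (digits
"009530471523525024730623502435~00953010970;41109511~01097~005;1014390;4110312:0243504316~0143903
1490;22104316~005;1~00953~0143904316~02435~01439~0=12112452~08135~0;411~0=121~03149~15218~00763~
02473~04715~11456~23525~23354~0331:~04373~13166~05711~13318~11437~14333~23335~13337"%string)].

Definition functionals18 : seq (seq expo) :=
  [seq fives r | r <- blocks (digits
"14373~11673~031862110>321843300<6118273080530467014622167630637202751165131:33112;3392123733~010
>30182708523100:71:42121861300>13082504761064714067144433546210:2332063725623427231<131905311543
539231137256153327333"%string)].

Definition inverse18 : seq (seq bool) :=
  [seq [seq N.eqb x 1 | x <- r] | r <- blocks (digits
"0111~0010~1000~0100"%string)].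

Definition transvection_cert41 : seq (nat * expo) := gap_cert 41 [::
"~~~~~~~~~~~~i|n171nj^7~~~~~~~~~~~~~~~=7|x1b3j7Z3~~~~~~~~~~~~~~~E5p~~~~~~~~~~~~~~a1519Z;7V7nfR~b~
E~~~~~~~~~o7~~~~~~~~~~~~@7~~~~~~~~~~~~~~~~~~~~`;R7R^qx~~~~~~~~~~~~~~~~~~~~~~~~~~~~~~~~~~~~~~~j|n
171nj^7~~~~~UT>E`C\04195vL5EF332859~~~~\~w=~~:\5~~~~]S7NS19D271BF2:3i@3H13171N511~j1g~~kd7h\7~G~
~~|K?O3~1784>1\6091J2<R~~~X137~Y333Z;~C~~~K9=1<>21;J60?=13?2105>N20E7@C3AH13;>LrF18~~u~lX~~~>SB3
7E8GC31R7>790I:A1516222HI=@~e3b73~39{eFD`Z[4319G:3|@MGN?>B1~g1553^L1~knv=71?90?T;<?E02K50<>2:1B~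
A;~~X~5K3H641;3=8;11519>HPOI06~x~H~~a3_1~~9P~~1~B~~~~~W~~~~~~~~~~~~~~~~~~~~~~~~~~y~e~~~~~~~~~~~~
~~~~c|39Z~~~~~~~~~~~~~~u~0X~~m~~?~~~~~~~~A17~~B\^~F3~3~~~~~~~t~O~~r~~~~~~~<^;`~e~~~~~~F`X1~Xp~~~
~~~;~~5~~~~I~N]~~~~~~~~~~~~~~~~~~~~~~~~67|x1b3j7Z3~~~~~B0F0<593<7957153D:<1=7`J0>083;<6167711C70
1755w7A~~g~2f~U~~G~~O7I6008021<V8107==619I;64263:9E8I1?>73;51~12;3P1]170F3kI`93^~SRf1~e1~6959M1j
L1H?P515O13aVb3~~HA\~WT~~cQO7E>05SQ57i;;P3QB3w~5irhTdL~~q8[b236479?021Da4:3bEG~~~U~~M377F00U813=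
515Y0282;370\1947I8:~6^91u\1L1~q00042UH?q1806:77727~C7~~~O3D281N39713<P06377Q1~d~a~s~~>3~~hL=3~~
~~~~~~~~~~~~~~~~~~~~~~~ph~~~3~~~~~~~~~~~~Z?5bd~O7`~~~~~~~~~~|~~J~;~~~~~~~~~r1Z\d33~~[~~~~~~~Q113
dZu7~~~~~~~a;~q~=~~~~|\~HL1F~~~~~:3sJ1F~~~~~K~~~~E~~~~~~~~~~~~~~~Q5p~~~~~~~29N9=l33G<1[43no~~~91
11~W7~M7~;P~~~F7Xe<dQ~~4~~73f~~_~~~~bT`;>~2@N~s5~~~:~~ybfv1400>;J1[9>X6~R~~~~YSK2RX1N20L2T4AC~~q
1P1HLL~DaF=~>@15Yv~~~lE==~Q~~~~~S1~~~~v~~~~~~~~~~~~~~~~~~~~~~~~~E~o~;~~~~~~~~~~~~5jf~711Z5X~S1~~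
~~~~~Y~a~~i~~~~~~~~~~~~~~~~~~~~m~~~~~d5~J~~~~~O~~~~~~~~~~~C~~~~~~~~~~~~~~g1519Z;7V7nfR~b~E^331=1
=3:100;5984>5G904=8QFAN>602@D03tMG7OyxfZf1P7~H3~U11111;17>32S309B13991h637514>@5>7Ge11H8G0F3q1~~
~2~~M5958082e?153l871B::76R=1LBC0@02~~9~~~UC<31V4;2}73;42<D06351e70HF~13113\Tk511B_1>K?>1G?6?737
;J21M:7H1hu~T~r3151?@E64411531X206HL3S3m~~~9001117R5W7B012~~~v2M4J0T~7R~~j0@0f3~U~B~A~~V1~t8f84~
~~~~~~~~~~~~~~~~~~~~i~t~7~~~~~~~~D33~t{~~~~~~~@~\T~~~~~~~~U~~~~~S~~~~~~~~~~~=~~~~~~~~:~~~~~~~~@7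
~~~~~q4`LB622UKDS0Sl3~~e^~;J15NH1~fDJ6B~~~~~513~?1X~B~Q2;02:;1E8Uk~1~~~~~~EA`j433@9A057450K6~P\P
~~a~8?~~~H~fMRe~N~~dK~~49~~~~~~~~~~~~~~~~~~~~~~~~c5~~~~~~~m?~~~~~~~~~~~~~~~~~~a~k~~~~~~~~~~~~~~~
~e~O~~~~~~~~~~~~~~<7~~~~~V\1938CRdi=~~`d`yF7]3~;0136DF135;7@2FNH~~V~hTJJ5~S2431U<31F12@_2Y~~~~~M
20ET1a7334P04~?X5TJL~WC~~]~~bKS~0~~~~~~~~~~~~~~~~~~~~~]33~A~i~~~~~~N113X~\~~~~~~G~~~~~~~~v~~~~~~
~~~~~~~~~~~~~~~~~~~~~~~~S2WFfF~~F1`Xy~~~~~~W~~~~0~~~~~~\111~U~~~k3::0^~c71~~k~~~~~~~~~~~~~~~~~F1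
3V}9HJ5~~~~~[j~J~~~~~G7VTg~~~~S~~~~}~~~~~~~~~~~~~~g;R7R^qx^3T1L124=9803:1DR?<=11817~rwR~W3I58D79
335Z36;8I61~dyFJ~82341\[J01~~~y28D4GV1l~~Z?:H~?~W1Yj~~~h1~t8f84~~~~~t~~~~~~~~~~~~~~~~~~~~~~~~~~~
~~~~~~~~~~wA~~~~~D0~~~~~U~~P~~u~~o~~~~~~~~~~~~~01RX]3~~~~~~~~~~~~~J~~~~~~~~~~~~~~cL?`~~~~~q"%string;
"~~~~~~~~~~~~~~~~~~~~~~:~g7~K7~~~~~`7U8~@B;z7>;~~~~~~~~~~~~~~~~~~~~~~Q~~~~~~|7BC~K~7~~~~~~~~~~~~~
~~~~]7~~~~~~~~~~~~~~~~~~~~~~~~~e7}m~~~~~~~~~~~~~~~~~~~~~~~~~~~~~~~~~~~~~~~~~~~~~H=~Wp~~<~~~~~;7J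
7~D73J3v;:3333n3~7~U~E17Q;E0;Z37HHCU7>3:308t~~~~~~~~~~~vzT5~[~~3~G11~M7]0z7Jn>60r~~g17B:0~J38@33
0R91<63D\e13kE~~~~~~~C~~~2~~~Y:3w62;~f6]G~7H353PETJEHc5LK~~~~~[191P9~~n11~EE03yb:32S~N2060@OCE~?
I~~~~KL}~5~<~~w~~~~~~~~~~~~~~~~~~~~Z~g7~K7~~~~~~5C~S?rJ68n~~~yCh=nT~~2~~~~:S7>783Y3b463Z732W3315
3R~^a~~@7~~[;~~~~j;~P~~~~b~~~~~~KGE8T50>;3u30B33ATF3~K2D~|~7;}~~~8M03~0EgA06f6Z~o1X;~Z~t3Q0K;63?
TH;3EO513;:F463Q~P33uu7~5~Q~^AS~C\~H~U3J7;?6;333[17;6J06~~~~o~Q~~~pRC~~~~~~~~~~~~~~~~~27U8~@B;z7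
>;~~~~l17=;b20^\20<77]A472=6i6kV~~MU391187dQl3N2Q6B3E3D3~x=~;39113:1624010H25W=1;01JV90317<140:4
067?<757002U:3KL016101T02~NV2{~;Q03f3~U~W6\6V11;:>o5?032<5N91q_OMGMhJI:=C2153;=_VZ3~aT55:?~91C16
8@3E5L2^~11~MF3z~3>~M~[3nA8C3R=0E14\Yf73798AE3>RZ467>3Q16>6F836v@432:40=13220077E55V47=10310:276
060@7@29313~6J6~_6~y;A5~J6~h033A?~B>727~F=4C1?2iJ0~~c~^3~i3xZ~~d~~~~~~~~~~~~~~~~~~~~~~~~~~~~~~~~
~~~~9~~w~~g~~~~~~~~~~~~~~~~~~~~~~~<6~~~~~~~~~~~~~~~[3~u7~~@~~6~~~~~~~~~~~9~~RS~~~~~~~~~~~~~~~~~~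
~~~~~~~~~~~~@~~~:~PL~{CN3v;Jn3J~~~XAN=d3h3ni;q3~~~~~~~~7~U11\7}3Rc~~~X~~~~7~L[~~1~~~~~~wT~W~~q~T
~Th~~~~~~hR5~~~~~R~~~~p~~~~~~~~~~~~~~~l~~~~~~|V~[n~~~y3~~~~~~~cn~2~~~~~~~~~~~7~~~~~~n~~Pd~Q2cU~~
~~~~~[_9b~4~~~~B=~Q~~~~~~~~~~]1~~~~~~~~~~~~~~~~~M7BC~K~7~~~f7987;3E32kC0442c11<3=7g2[318?~:33?A0
:0T:72NOK:IY50367~6F}60>9C>3074>@;?F0G972E4:FLF<E><81J02~B3~~~~~U8n~5333E~{CBrr813;624H=NB19I0bD
023:438~E4834A009Eg3502~:3:64nw06^FkA4230=bA41N:~J333A>E64673Z206e3pQ20524111OZ7Q12~~~~B~~f355r7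
?4w=4;1U0E~:~m3q3~_0~2`~~~9~|~~~~~~~~~~~~~~~~~~~~g3;~~U~~~~~~~~~~~~~~~~~~~~~~~~~~~~~~~~9~~~~~~~~
~~~~~~~~~~~~~~~~~~~~u~~_~~~_J20z>6~03p~}060Lw5w~~~~~~~~~~~~13;E~m^~R~U?335X~~~~~~1~x;~~o7~N~~~J~
~~~~~~~~~~~~~~\7~~~~~k20~;:v:W7=O3~~~<N~J~`02:S4R6c~~~J~?~~z77>~~~~~~~Tka10433U0\~<3u~~~~f~~d:~~
~~~~~~~~~~~~~~~~~~~~hZ58pKJM96F5166O3~B2B9;4429ML>N27J01V5M2}11310010080<1@0HDA2e~~]>>~_~i9<3O~J
:~a735315B0V@N:=~U60=2W~0~~~~X4~~:3:27~~H6n~~~~~~~~~~~~~~~~~~~~~~~~~~~~p~~~~~~~~~~~~~~a~~~~~~~~~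
~~~~~~~~~~~~~~~~~~EZhV~>~~2~~~~Dk~~~~~}TR~~~~~X~~~~j1~~~~~~~~~~~~~~~~~~~~~~~M~~~~~~~~~~~~~~~~@3~
~~~j~~~~~~~~~~~~o7}m~y234950cAQ>29~=3RJ032;;Z27333B<173~95851304147>^>J00~~~~~~t;7vG|=49XG~~t~~5
|^`~~~9~|~~~~~~~~~~~~~~~~~~~~~~~~~~~~~~~~~~~~~~X}]3~~S]~~~~~~:1~~~~9~~~~~~~~~~~~~~~7~~~~~~~~~~~~
~~~~~~~~~~~~~:@8]~~~~~a~~~~~~~~~~~~~~~~~~~~~~~~~~~~~~~~~~~A~~~~~~~~~~~~~~~~~~~~~~~~~~~~~~~F"%string;
"~~~R~~~~~~~~n?N~~@~~~~~oj~~~~~~~HM8_~~~~~~W~O;~C~~~~D7Vz7>;~?~~~~O7~~~~~~_8I>_0I~~a:~~~~~~~~~~~~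
~~~~~~vF~~~~~~~~~~~~~~~~[0=BO0s:~~~~~~~~~~~~~~~~~~~~~~~~~~~~~K?N~~@~~~~~~70>=~V^~~~~~?77MD71D4~V
M0=7~W=~~oM076;6:Bc3uRj~~k7F~HJr>n7me~C33F60Un742=83\S8^0fk~K0;1I7800C3E032<3761013001\>A1H=4CXH
::j\:@18@70H2340361:011884O0KOH6A30:@72973>03~~~~~~~j_0~De~~t~~~@5TZ~~`~I~~~~79L^Nr1}=5;104017E0
P13q6~6=18:516E=@~303~~5~b~~~~~~~~~~~~~~~~~~~~~gj~~~~~~~~\~~~~~~X~~~~~~~P0~~H~~~~;j~=191~~~~~>5~
t~uV~~~~~~l7Sw11P5shHDb~~U~~~~iZF~J~~~~{~~3CW~3<C~~~~]N~V~90~~~gFl1:7D7~~~~~~~~~~~~~~~~~~~~~~pM8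
_~~~~~d~8N732<0514E5S5\P?BE~~~>C3~G3~?7E4f~>=~V3X==817C31700@@:3R1;B?5:C62=2ZZ:1~R;?VZ=D4411|B;:
~<9=~60=19:4;@7<<415544416<301R031190D5842>14=183H2C8B1T717~~M9~e~<7518158B1>F250010315150200N7G
8160\42W~~~~S~~~d~>1[~~9P7e?T~Tdu~WEN925EAM13i362y;910401A7474814038s0253z~~ZC15EE0302024?D[13~u
~A~~~~~~~~~~~~~~~j~O;~C~~~~c7~K?r~u~~x~;~~~1~{5FK7y~<BA_>~~~~~g~~DC~R~~~~~U~~rCE4O;6v6G9>E2a;3~n
7y3~Y~~~~G~~a~z7y7]3q~~~~k~~~~~DC:4p~Z~z~~~E~10~~~~~~~~W7Vz7>;~?~~~Z33E^~40;06^Ri2cJ~d0S<7E?63G3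
37882T6X>E>B=a=~7=1<4060D500J<82:062G:E4HUF433E>9;1J02~J=~~~~~~=~~A~CCB202<Sv?5B24H611QN54>0bE32
5442~5;7:037D14202[7?038313~Un:~~ZJtF14I=8Yf7RCFbt~<hY93UI?~~~~3~~I43733n7?>m=4;1U0E~{zu3]~10~~~
~~~~~y7~~~~~~`7~H~}K~~~>~~A~~~l2~~~~f~?~~~~:Rn~5~]1~~~~^~~606H7Y~S~3~~~:m~m~~~]~o~~~~~q~~~~~~~~~
~~~~~~b8I>_0I~~a:~AB1=2J63027352340360141>3:P9:D6J2200912ZNC3Q~3e13:\~53vUVK1>A8O007301635030N?7
]~[13~0=1?01160223?66L4:M24L11A66Y02~2031001127:12436CF:1<~n~kG@d~t1J:2C8?;134^820c4VH~I3^~~D7N4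
39m~<5jz~M708R8~<i~m`6n~~~~la~~~~2HpN>d1~~~~~~~~~~~~~~~~~~~~Z~~~~~~A~~~~~L~~~~JgL~~~~~~~~~J~~~~E
~~~~~~~~~~~~~~~~~~~~~h1^R~~~B~~~~~[~~~77>rF~~d7~9~~~k19~~~~~~~~~~~~~CZl~~~~~~~~~~~~~~~~~~~~I~K~~
s~~~~>~~~~H~~~~~~~~~_E?Be~~J~~{~~~~~~~~~~~~~~~~~1F~~~~~3844Ox~~[~]~~C>WQS~d~~~<X~3~I9hrnP81:ZCY^
2~u~~~~~~~~~~~~~~~~~~~~~~2~~~9~~~~~~~C~~~~~b~~~~W~~~~~~~~~~~~~~~~~~~~110UB3G|3~P5=e71>c1B2y3500D
@00B@>0~~~~~~~d7V~f6b~~~~~~~~~~~~~~~~~~P`5~~~~~~~~~~~A~~~~~6~~o~~~~~~~~~`0=BO0s:~D1528032160@022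
??IPA13Q~7:71B751~9DIH520223J7[13b;7>4b=9y10>3083T1E~1~`1]73s~w~~xHpN>d1~~~~~~~~~~~t~~~~~~~~~~~~
~~~~~~~LRD11~~[~D~~~<~~~~~~~~~~~~~~~~~~~~~~~~~~~~~~~~~~N;~~~~~M~~~~~~~~~~~~~~~~~~~~~~~~~j"%string;
"~~|~~~~~~~:3~?~~~~~~~~~~~~w~~~~~~D~~~~@~GJ~~~~C~~~~mLA7B3S0EBO053>~~~S~~~~O~~~~~~y0=BO0s:~~~~~~~
~~~~~~~~~~~~~~~~~~~~~~73~?~~~~~u~~~~~{3IHF0B7E>k6:3~~~j2IB1l~~~T~~Ou~uJL0rA7Q390p}q0[6YsN37453>~
j4C31EDZ1>47F10080320;132J07~s~7~F~Q0M^J~:~;0=I01?>Wp6~D18B6S@~303~@~~w~~c~~~~~~~~~~~~~~~~~~~~~~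
~~~~~~~~~~~~~~\:Ud3~~~Zb1~9~~~H~@7AGO3~~~~A~~QI~;eH~~3~~~~~l~y3~YsrUD7~~~~?f~~~~~~~~~~~~~~~~~~g~
~~~^{020C4^=A7e~~~}~1VA3~~:c5CC214cC6_61530100~uCL`V19F2M397:~N_3aE<1C20064@014:4692B150~55~{~~>
@4`?2>N793292100G~Q8X97EK0MR:2}51916C7A814038j1602~g~wC15R80554T[13~=A~~`~~~~~~~~~~~~~~~}~~~~DFz
}~~~~~dP~~2GHE~3~~~~~~~~~~~~~~~JSc@03:7Q~r~Y~~~~~K~>3F;:5c46M0~;~~~~~~~~~~~~~~i~GJ~~~Z~rZ:20?~~M
KD5?~J2Q9E~|3Hm4>>T;316O02~~~1~~~~`~a~O12QB4~Z0Bg713177<:01R~~43]~~@7~93=428RS140?>40g=4;1UF~~~~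
~~~~~~~~~~G~~~~TeX\X=C~~~mR5~~[~q~~~~~~emA~~~~~M~3Y~~~f~~:5~~~~~~~~~~~~~~~4LA7B3S0EBO053>~j0JG00
B0I:312084@C@1921320?~Y]V00y>L89~?803DV@00V63708200:<553D~5R~;9~SmQ^>~:9>0>~>71<1UP431@1<A37822V
2;51B7j3;:3?S7?4Fa11833071T00:549350~~S0`w93~9J~~~~~~~~~G~~~K~~~~~5~~0~?e~~~Ja~~~~4~~l3F4pU~~~~~
~~~~~~G~~~~~e~~l8tA2110[0~J\5<M6K;147>V9}51:J00:7@>05[~~^3~~~~|OG~384205p~{~~V~~~~~p~~~~~~~b`D~~
~R~~8~~~~~~~~~~~~~~~~~~~~~~~00=BO0s:~D152806160@010>483WDC3Q~7B1J5bVDIH520223J7[13nF4bGy10>3083T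
1E~1~`1]73so~~~~2HpN>d1~~~~~~U~~~~~~~~~~~~~~~~~~~~~~~~~K~~~~~~J~~~~~~~~~~~~~~~~~~~~~~~~~~~~~~~~~
~~W1B~~~~~~~~~~~~~~~~~~~~~~~~~~~~~~~~~5"%string;
"~~~~~~~~~~~~~~~~~~~~~~~~~~~~~~~~~~~~~~~~~~~~~~~~~~~~~~~~~~~~~0~~~~~~~~~~~~~~~~~~~~~~~~~~~~~~~~~~
~~~~b~H~~~~~~~~~~~~~~~~~~~^~~Po~~~~~~~~f~~~~~~~~~~~~~~~~~~~~~~~~~~~~~~~~~~~~~~~~~~~~~~~~~~~~~~~~
~~~~~~~~~~T~~~~~~~~~~~~~~~~~~}~~~~~~~~~~~~~~~~~~~~~~~~~~~I~~["%string].

Definition cycle_cert41 : seq (nat * expo) := gap_cert 41 [::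
"~~~~~~~~~~~~~~e1~Khp~~3P~~~~~~~~~~~~x~:3~I59\~K~3qc~~~~~~~~~~~Q1np~xX~eHD~~~~~~~~~D1~O111=V13`1~
jm3~7~~~~~~~~~~E5~~~~~~~~~~~~u3V~B15JDH~~~~~~~~Z~~A~~~~~n3V9\11N131e17[111D>~~~~~~~~~~~~~~~~~~~~
~~~~~~~~~~~~~~~~~~~~~Q1~Khp~~3P~~X7J07>=7Q<A1H0B0j0K1<b20:3D361<~u40[N~~T\~:~??~E~3~<FF~260?\130
0V;;A:5=91@4@L[=1<E223246335845mxX~~~7?^^;~KPX7~8nqG>G24100850<3N2F91;;0V286:75:1<a77421~D3F29K4
:6~k`153Rlf1Z~_jc170I06C6;:00@@0=7B@74L8730H5F1p1M46?ID100;100383~fd3~~~~~2U51T7~4~8007M@8131~:0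
2pr~GT7u~XQI0?KAB3=690B5131H9<d115[08;EA8~P311~b3N3J3LH@3<OVG1116<@J351;11A4FfT<9:<@~EPT~aDj721Q
62432@7201281M23H138=>@0I1>338~~3~~u2q~~~~8~~~57~~~~j~~~@=SX3~pb|1~~~~~~~~~~~~~~~~~~~z~~~E^~~~~~
~~~~~~~~m~2Z~I~~~]>1~~~~~~~~qn~~TR~3~]~~~~~~~~~K~IZAZ~cD~~~~~~~]7~S~~~~~~~~~~~IdJ~B~~~~~~NnR~N~5
~~~~~6~qLf~~~~~f~7~~~~~~~~~~2~~~~~~~~~~\:~~~j~:3~I59\~K~3qc~H0F=7=90033F3;?146RC:07FK0[91:?41107
5>>4502soJ00C00?11~0x91TIZA\~KL~~QZQ2B29?E:;533?<6:3;7433>8Z51F74:J0:01I40d3163Mb5@o13315\I1~;17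
;R3f1V7L7Lk_>:T392GK9?057199C2\=5G02D>;1;5=@K@\<O37531?31bz^3d`N}i~^59e2:;;5?>B428@1NG3>OF7f>C00
4~^;bZ}3NR~Y59rT52101391@78223NA?:15113130051>=02C;7<BojPb~c3FFbE3R18<@515040=?7323jOL66730?AZh3
5ZVDR31DND~E7X7<0i606F7BN7<YA~~~8L:32T6?5>32F10205]1131<=2958~~D~{LN0?D;~R13~CfC:@02H;56213854;1
I~~~0EN1MolM<a0<@~1m;8C~8K80A;1k~~~~~~~~~~~~~pT~U~nN~I~~~~~~~~~Bb3=b7n\^5L9R~~~~~~~~~~}~~S3~aH~~
~~~~~_CX1~~Si3g~~~~~~~O~;1;~a[~~~~~l1~I1mZc~~~~~~~~~~~~bXq7B1JF>:~~~~}~~~acFd~~~F~~v~~<~k~?~~s1n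
p~xX~eHD~x1?lE?:8^DA3:X3=5:1I~`~~CjRd~C5~c_l1U~G00F=?ZC61;u5dxBB~~Eb~959H~~es06o0G3D0~026Gz79J<0
3F~~63}1;PRkjei2J51A42:NG728BIbKEBJ4~D1~7RT7P~t20;57:61ZBD5~LB30EAh9^V7~|3Q3:bF79284157:CP~~N~~~
]\3157~~G1{~~]7157E50Kn1BC53~~P1~~1~~~j0?;J~@~~7=wBbn~K`wR~~~~~~~~~~~4v~A~~^z>~~~~~~~~DT97Z73V^3
91L57q3JNFU:~~~~~~~e5jd~3~~~~~~~~u1?~~~\~~~~~~<=~5L~e~~~~kX;~_~~~~~41~~~~~~71P1311~~~~XNg~~~MD~~
~=1~~:~Z~C~~71~O111=V13`1~jm3~7[1;3b=1=D735210=V6U21I;4120C51>0J5312X<150@FC3FtZ=Pj1Z73~~~p001[5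
44;0775;5N742P135B9@=5C33F02U5<2Q184~Y3X?P~;3N5F~[111=J;J_07G7>00I1=4=3;3B;C3A66k4~8=~Z~FFw13?25
45455362022320w507B3466?28C60A1O~<T\X3kc1SU1=05540069B5;1G8E01C<=198;136J@3:^5P~RF]MZ=:15592;3?7
E03<1172F2341M95c\~61J>s410=33N?d;~9~~]?>?11E4E1263>Qq3DLD~;154A^[33HDBDM3666:4M13E3~i~~5124>Yfv
C~~~~~~~~~~i~~~~~~~~~~~iP1b~7~}~~~~~~~?~X~~~~~~~e9~7~~T1:~~~~~~H~~~~~~~C~~~~f3~~~~~~k~~O~~~~~~~~
~~~~z5~~~~~@~0B~CAB2811351Q=9D:~o^13~hJ~M1{56X69;B44=3;1smL~~S3~5{gN>~S9:317E02BB6>A0Q4R;413U0<m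
~X~L@~15E>JN6~GH5=3BE~hR~Ay~V~Dp~~Vg1B_~~T~~SzhV~~@<V>E73~~aD266~0DjB~VW53:6J<3:J~~~~~~~~h~~~~2~
~~~~~~~~~0~~~~~~~~8?~P~EM1~~~~~~~~~~~~~~~~~~?1~~~~~?~~~~L~~x~~f1>~I~N~~~u3V~B15JDHvhT36:38=BZ9B3
P2N<;<G03~]3ZbRVNr~8Q10042407K426D14HH1>59>=B2696<ufN=R3HPJa~2187F2:1>0010140>B2811?0\c>[\?H~[b1
L39Z2E9U9@0G1GB451?WVLTJ~Dk=730A6~4~>|^]Z<Hc5~K~J>514?3=B:<7pLm1558=326K<561PY>QF19?;1QBBK<93046
81WQR~~~~~~~~C~~=3i~~~~~~T3T7T~~^~~~~~~~~~~~~~~~~~~J~~B~~x~~~~3~H~~~~g~i~~~~w~~A~j0S7=<1<G~c7~~~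
0~~E1YZ<CY4>~2~~~~[E3T~~kT~~a31=:7RQKxz~~20C92OI~b1~~2~5~~~~~=2:90F1:rVA0yD7J~~~~~~~1X`P3L15HJ~~
~~~g3{53kc~~~~~JJ1TJ~~~~Si3~9~~~55c5u~~OJ5@3Q1~~531@U<~p<~~l~f3V9\11N131e17[111D>Q3;100J@7G5557:
B6I0<359:<?4;74@dRNwLF7m9:505N7349777I0Ue29~87~[y1131=HRid3614~~q13166I8F4P7BI6h~~<4C5TcJ~<173Js
~~~b11133>2081:w7J[C~~~~~~~~~~~~~~~~~~~~~~~~~~~~~~~~~p~~~~~~~~~~>W~~X~G~f6;~~~<~IC~~~~P~~~~~~~~~
~~~~~~~T7T1L1a@~~~m~~@1~~pPz~~kJ{~~~~P3>M~~R:1~~~~~LMQp~~~~~~~~gX~~~O~~~~~~~~~~~~7~~~~~~~~~~~~~~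
~~~~~~~~~~~~~~~~~~~~~~~~~~~~~~~~~~~~~~~~~~~~~~~~~~~~6"%string;
"~~~~~~~~~~~~~~~~~~~~~~~z~G~O~u~~vD~@3~C3I7~@~m`~~~~~~~~~~~~~~~~~~n~~~o~U~tE7w3I4v~N~~~~~~~~~~~~~
~~~~m~3~~~R~K0jw06S503~~~~~~~~~~~~~~~x3A4n=4d0`020~~~~~~~~~~~~6~~~~~~~~~~~~~~~~~~~~~~~~~~~~~~~~~
~~4ChXp31Z3~~~~F7Q?w7Q;0~;683}3~p8R5020~BH207;283A1n6B47A`3=37470:30O=E568~^R0262?4~~~~~~~~ln35t
1~=715~1~~K@:~3;N~<39@nEzb3=]3~7G3;0M90]=M242RF23~D0IF82M29C~~~~~~~v~G5~P~G1~I3;>2wEk3=_3>3XQ~2: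
4730;[@32E\3~3Q42D5~~~~~Q^b7mRJ5f1~67B20^}=]~C?0D[4D[3650e155~~~~~~Q>~~4~~~~~~~~~~~e~~~~~~~~~~~~
f~G~O~u~~T7Q<~4~j20~?~t4\~~6E1~EC3`b3~91~~C<qGL<24;E;57b24:21@3:2;>C41136J<N5~^5~~C~S7~Oy~~1~d0;
20z3~C3B3j9~G[~~~2~~9~~:902`12=8>u44E3350n;5<H103gO010<~R?~?~~~~8;Q}0;~i230~~~U\3Pi~@VG56503BA8K
F;:7V7S93@;4~P~u33a~`9w5<~IJ5~~~~E94I:2234p12DW:=154@~q~~@B~~~~~sE10LS~~}\~rbWD?3~~CJ5~c~TY~~eD~
@3~C3I7~@~m`~;7?@2;0;3110c9ND69Z93F38652w65}f]20=5~5]<4~859@0_?7:1221105<7FC62043T[V2LF0GD;12022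
33110:40:12301330:0J43111113=L02><033243594;333024201300L23B2;20Q113V381=M001820740~Q:<z3As7J2_~
9S>Mr331=3B627T511A?0820255N351J558G11715a1e=9=18T3R17959?004ZKB46?533@;47I54~[503;4111^96461B50
73@27501?5A=>8738Xm{1477044~G42~sI[~~3I0?3Z;=3<085N33570830g30E=43>5I3BI13=42<104?=8G024137B2L41
012533673>301G37Y7<3046752159126<74356630J874?12562J:B40280225~<3>x<Z~?[G8<0605JAr=JZ~1131~WB~58
020:637131919202501001001453937<4721182444010728rF~F9~P42FFNBB~QL0=Hh3>=3D110G@~@~vI:2~DA24394<B
HP;=d~;>Y871AA858:3q~~~~~~~~~~~~~~~~~~~~~~~~~~u~~k~q~5~~~~~~~~~~~~~~~~~~X~~0~Dr~~~~~~~~~~~~~R~y~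
~4~~~D~~~~~~~~~~~~WeM~~~~~~~~8~~~~~~s~~~~~~~~~~~~~~d`19~xNX3~p~K37A;7~1A@r~J~dm5EMFX3P2E]35H5Z~3
4L_~~~~~~~751T17ZjVy5H7J~~~~~~I~4;@2y~`QCAH~~~~~P`?RVq~~X306~~~[=8`~38~1~~~~~03131LDa~~~o>202YM7
C<R~~~z3~P~iB~~p1]~~09~k~8~~t~~~o~U~~A~~~T:~~~~~~;~~~0~~kaUF?1~=K~~~~~~~~>~Jp~~~9\L;~~~41<05\4EB
~]Y~^~7q~~~~u20~8~~~~<;74~~~~~~~~~~~U5F:n1U=7~}~~~~jP~~~|`~~~~5E7w3I4v~N~~p34360348=0OKI4156M739
4230@0t64ERL9C35S93^=3;1@BY800M9LCB3363C550102_XG3E7>357:220;22566042333@515527=<;;39;>:33U;52?0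
71119@D80<03~G4r~M4e~hL3A2[==NL;~:~>3y07TT>CV;^131DWA4=314010024345702036u>44;8628551P602005=~Q5
33z3320d0`Q]735377857Z7930L119424Y3H41F=;3@C5433FF03>=D6;>:k02002251=2H@@J064<190~~{9RX9~~Z242:?
~r;0>02<0E2:1722934PoZJ[336371111UBn43D2p6DB1I~m~Z34eY~~~~~~~~~~~~~~~~~~~~~X6703f?6?~~~~~~~~~~~~
~~~~~~Z~4~r~~~~~~~~~~~U33~~0~~~~~~~~~~~~~~Z~~~~~~~~~~~~A~~B~~~~FE0~Cqb75a~SH824M[Y;66rN=E34~~~~~
~~~~~BF~t70z0^D~dUU~~~~[~~~`7~>9{M~WD~~|~G~~z=6K4~~e~<3~9501>~eQ5X~~~w~3~~~Vw~7E_5a0~i~hT3~8~>36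
Q33153K3477B03QQ4eJM~~~~~NF7fA~ZL~~~~IRC2ue5TE~9~~~~z~~~9=~=j~~~~~~JC5CM0~~8G5~4N=3;0~~~~C~K0jw0
6S503~o024M7M9720I7:203CH5=05L6262~PC2l9;24JRYL6=51:LL02=062250533L0063>4023T30:@L<0B7403616~<uB
:W~qE0D;4HB2EIBPb1d6337>08B2>1D0K=pT0@:8000;1L3;002=DAQ70C33~2~~FJ919D1<3~041J534HT756n3^32;3F22
400101J01I~~M7:715VA:O3263140X0>4?06<3243330=2D411`r3>1KD62>G;03733112637PY~~~~~~~~~~~~~~~~qx~Z~
~~~~~~~~~~~~~~~~~~~~~~~~~~~~~~~~~~~~~~N~~TJF~l~0:~~q8de~~~~~O7qP3LY~~~~@\~~~~~D~~~~~~DY~~76~~~~~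
~~~~~g~~~E~~~7W~~~~~~~~~~~nNl~~~a=~~~~~~~~FB0A~@~~Z3A4n=4d0`020|?3702304058GCc58325050P8=55G39H3
?4=7AO0a60:F2HA480586;12UFU0:a3544c~~~~~E5T~0Z1A4839875S4PM~~E=<v0n4w0<:;_~~~D02046311973~~~~~~~
~~~~~~~~~~~~~~~~j~~~~~~F~~~~~~~~~r7ua~~V|X`~]1~~~~~P~[=74v4~|h~f3>M~~R:1~~~~~~~~~5~~~~~~~~~~~~~~
~~~~y~~~~[~~j~8~~~A~~~@3~~~d~~~~~~~~~~~~~~~~~~~~~~~~~~W~~~~~~]YM~~~~~~~~~~~~~~~~~~~~~~~~~~~~~~Q"%string;
"~~~B~~~~o~~~~>M0>~~~~O~~~~X~~W~~~~{6V~~8~g>H~~~r~K~u~~j770v3I730~~?~M~~~~~:~~IM0?KC7FE38K03;4@E0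
nW:IJP23~~~~~~~~~~~~~~L~~~~S~fW~~~>~Q~nw~[02~~~~r7C=5BA4D350l350@3~~~~~~~~~~S~~~~~~~C=n~~~~~~~~~
~MM0>~~~~O~~b~T0<y~~~;~~~?N6`249~jY~==K~~H?BC535197719A~D9J?7:~Dl~B7~KM3<~~3fk03~W?;0~23K430\=8?
40j<4~7026`N6D9J05:3?AF7134143~:7E0=A3M\3@1S0>=?;1<109GL374246031412;0:ZV7]0G>A473351~~~~~~M~?^~
7~~~UK=8~N=~};MB~~H~2~M~R~[0hD~L~=5FNE186z@xK764T;32b491~~?~~~~~~~~~s~~epWHU~~~~~~~~~Z~~W~~~~~~~
~~u~~~~~~I~~~w?1;sv\X~S~~4l~C~~~~V;AfN366~~U_5~~~\{JL~N9oG?`<2>19N5<fJEB28~~9~~~~~Z~~~~~~K~lLZ5<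
w~~}~~r4FB~>~~~~B:KZ4LI0DN3~~~~~~~~~~~~B1~~M@~~b~~~~a6V~~8~g>H~~H1A7L951I;00=0T?}5209D~D0Z~O333A
;<Af1Rn3FR6N34~MMl59AD31133>5627001333D1?309S7P10215J106<?3i37:000]sK^;66423O04144yM5BH0a2793059
0U6D177C0?R;3024033105204910603508E23D;07062330926303067I2D826104140`:~H1:4WGcQM~0d0643B1=1328C1
3236`8:@0[08;01Jf0~~~u~kXdZRLHH~~OL<Z:N~E=L15?RaN^?:cW017B203K43o54eD08L070;0324861107426GF70356
36}Yy~600F1800001001D233B15C798006;~e~?mI~~}I0111:}=IG<5T;F1781173~9S:C1;014~`{~~~~B~K~u~~~~=324
z~7>m\~~~~~^~~gJ1=MB20=I721A=}F=QJAB1~~~~~~~\<}?u~~~I~~~~8A0;I72202252w58A54K2u9C~~~Ta~~~Xk020~e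
~~zn:;Y7;aJ4~~~~?;~~0~~~>7>:323S<4635X~~~3\~~WL9>502<31~~b~ZK~~~~G770v3I730~~?~M~_60;Cu696523U3>
7~<24~;502~o6F7F28111;9064Ai5A3:6B41003;J;ZT770;13241L711?07C30013517460234010<;C9:G296H;0424:0;
19H406212~M~~~3~C~9M]\~c~>3Z19534010520110aA0667;506<;352z=C1E7307=2407A0360i504=44;8620119115N1
5:E303@3~5~0320~F~CR37d=0P>`030L1YC7;24Q7F3MS3>=h53AE;6=A0V=81D504~~~~~~E24=139YBJMJ;:003;202O41
422488L~LzJ11L434l;F3Hq1:7@~~mC14<B5707:7m~~~~~w~~~~~ne~~~~:~ZZ~~~_@8;8~S~~~~5w~~~2~5~R;~~1~~~0~
Y~B~S~~U~~~~~l~~Ey`~~g~~4~~61~~b~~~~BC~~BB3~~~9~~0M0?KC7FE38K03;4@E0nW:IJP23T0?Q61=0:76163?831:2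
236911007FDX?02>987@;1F06<553\;lPd=7KT3SINP10^7<06;>0>00;810480714103Fb0R<09GA992G38U=N331860Q5@
;@21505A;I1;=H6009:L:A38931B520710033320330:0513>0<3L751131@33D;<063398?15o;Z~~8^03;41743d36404d
64302^F70020GAFZ7B;E4|?a0;1K09Q0111170031W0;;H02330a69N~b8^3Z49023KY84Y534HP;p>N151510193370;156
:>61<aLNS1P:389A57702M3<NI9936`=D04I20s?0W9A00083117LJ5N2714:DR33218:~~~~~~~~~~~~~~~9~~~~~~~~k~u
~~~~~~~~~~951D~3~~~~~~~~~~~p~~M~~~0~~~~~~~~~~~~~~~~~Z\X~~~~~~~~~:5b~2~~b=4~B~R~~~~~lAEi80;ut~~~~
>X_J~m~~nU~2~~~~y8~~~~~~~~~7~~~~|~K~~s~~~~<DU~ADO~G~~?y~~a~~~y~8Pz~~~~~~~~~~~~~~f@01~~~~~~i~fW~z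
GD37?~DJ~wm~g~U`\r~H[4_?0R]@YG4P2l7E?1LL1~B?2~yA8@;>910;5:V<~~~~~k~~1t|gYnN<6HEB311~J@:~~~~X~Q~~
~~F~~~~v~~TC~P~~~~~~~~6NYH7[:3~~~~~~~~~D9QUmJ~~~~Ew~[02~d5H7B296~26205~Z`78~0iB9=6917H1=2000:^K0
C~~~ZAN~]1JH73~X8^A5765z~~~~~pW0v2GW36240G4~302837200811~~~~~~~~~~}~~~u~r~~V~{~~C0~D~~~~~~~~~~~>
7C=5BA4D350l350@3U7P1400:058B5=5312301E;8776140313ThoSH3U5<02M9;92:t^9\v@KA4559940X2M71>0;~3;q35
0311aP1?4r~110X;0v0@bn3F20E;08679o3218:~~~~~~~~~~~~~w~v~~|~~~~~~~~~~~~05k~~~j~~~~~~~O11W870~~~~~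
~~~~~K~~~~;~~~~~~E~~~~~~E~~K~~~~~~P<Y7E}x~~~~~~~~~~~~~~~~~~~~~~~~~~~~V~~~~~~~~~~~~~<=nYHU~~~~j"%string;
"~~x~C~73~~~~lI3sE~302~~~~~U\w~~~~rFW>B3L2~~~~?3}~~~Z3~?~8m~~~~~K~>I3`1H>6TB3>33C06>3L27~~2~3~Y~\
=8|4~M~~~~ZE07CCBFC0350HS350@3~~~~U~~~~u3=3~4Y~~~~~~~~~~~~~~~~~[I3sE~302~~~3~O30~~:A~=~~Oz5@FW09
;3393L34~~UeI11EIg1709?D3L~~J~~O:~~~3n^9b7924T65zHb1G12~55733:7=1742:3AD5}3IC210@0f56@1>7666;061
187@~gNb~9a0~[0g03D[h`EF5CQE136gG?VXE764K8;32]8:1~~;7Y0~~D~O3~62VW02PAO;1D6~~~`~~~~~~~~~~~~d\w~~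
~~~~\~~~2~~~~A~P4O1s~`3=~~}~~~~FIq{=2G>76~~~_~~~~:bXJ~~~~K>M9~02cQ15~~~o:KZ6~K~~~i1V5W1O~Sy;~A20
~~~~~~~~~~~~~tFW>B3L2~~Zd0E311DYD80N0>33<03H~>~>~2FsV9c~h0S913D22B8OU25l2100q~24~:X02>798205?520
63970C200~I111C0p31;40=0@360515=08?683041166~Y5NrKCaYbf@A0K778042]7{FW27B24L7k930;2_;17A::G51118
1=Y;07730361~1PH^U];7K985802115K=64;206OV:R2@0K03=E>3N;1374931?4;61739~G3Ac2;11G586045A:~~~~p@~~
~~~~Z3}~~~~XF|4m~~O~Ew~~L~;\J533N03~~~r~~~~~7~~M~~v3R~G:90G2V~Ky~zE8d0V:3~S~x=37<827E6@2463620=3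
;~~|~;~~N>X6~~~~~~~~f3~?~8m~~320~BA8xW366~~;2Fn1D>I433;V~53D0F4~:M60G2624336=:8~~~~~lEcAh4W~J1;3
2~R~AULY35]2563I03~;:fZ~;:D[<JCpK502DP145bJ7=07>15;4:214:0]k~eohQId5;=g~h~~~~~~~~I~~>1~34~F<~~~E
P31~~~~8;3~~~~~~~~<L52~~~9~\w:~~~m4LPaQ5T~~?jQ~~i0~~P=i~~~~xI3`1H>6TB3>33C06>3L27~03\031A21>33S2
=44;23503627443180G3913~_bsg1~=1C[TS335323412100O3200=OU=3B7<110p?7:3i02V6>W3S5A42074;1_80~?~248
bH@330RE023P2905@_39027::609>G7:6?Z33<074376I>2122430A1ELBQ0{067123:;543702H03300O3Dc:>^~09r372?
>L~~~~u~3~Y~~k~T~~~~gnBa0z@~Sq~~re~~~a9D966f5J::~_~v~~~E~~[5Q~I6U3~~~k=8|4~M~N<hF2\g2eRLW8A002Ih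
54T8;7=69007H0028120118^K0>00~A4~j~~C}<932OjH:A45311F0?I1430C063I~~~~~\:01AA10k3502G5\25G~=40822
005<~~~~~~~vNIG8~t3JL~~4D06~~~~a>@~}~~A?R:N~~~~~l~~~~~?E07CCBFC0350HS350@3T07O01400:0587:1;;3122
001QH614413T~9>eH_<0P9;92~1^9\v@KF51=940K?f0;~?NQ0350371W3R?4rtn30vGxR3F3E;08679o3218:~~~~~Fq~~~
~~~~~~~~~~S~~~~~~~~J~~~~[~~j~8~~~~~~R33~~~``~~~~~~~~~~~~~~~~~~~~~~R3=3~4YY3L3aY~~~~~~~~@A<~b~5~~
~~~~~~~~~~~~~~~~~7"%string;
"~~~~~~~~~~~~~~~~~~~~~~~~~~~~~~~~~~~~~~~~~~~~~~~~~~~~~~~2~~~~~~N~~~~At1~~~~~~~~~~~~~~~~~~~~~~~~=~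
~~~~~~~v~~T~~~~~~~~D~~~~~~q9qr~~t~:<?Nt>~~~7e~~~Qw~~~~~~~KS~~~~~~~~~~~~~~~~~~~~~~~~~~~~~~~~~~~~;
H~~~~~~~~~~~~~~~~~~~N~~~~~~~~~~~~~~~~~~2~~~61~~~;7~~~~9~?~~~~~~~~~~~~~~~~~~~~~I"%string].

Definition base41 : seq expo := fives (digits
"003O7012G?0136O017O202K75035?B0635K073;D0:7G10=F330C=6312M6311?E311C?5377;=37;5?1K733"%string).

Definition relations41 : seq (seq (nat * expo)) :=
  [seq [seq (41 - edeg_nat z, z)%N | z <- fives r] | r <- blocks (digits
"003??~017M301;G501?A7051O30E13?112G=12O151:C55032O303:C703O320;C7202G57053F705;2?0783?136?82493?
~017?:~0117O017M301?A711?C4193E51?C22017G6036E707E7207G43136G425=3:~112G=~02C?302K3706A770C7741?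
782~0117O~07M131117M~035=C1?C22~017M301?A712O151:C55032O303:C702G57070G707E7207?832835?~0397E171
>A1758C033>C03:C7123:G136G423:C31;27<2975:~03O5107M131322O0G53607=;23683=~017M301?A707E722835?~1
:C5503:C702G570783?~036=;~017M3051O312O15032O303O32~053F7136?8~053>;~155K216I3517D1;136K215E1;03
74G06A77157::1?782345;:~06A771?782~12O15032O3~11?C4033>C07G4337<38~0783?~033>C03;2G136G4~070?;~0
397E16E931758C12G;20716G0G36507;>12975:~017M3~017G6~1635I37896~02G57~0357F~036E7~0374G~01;G5~073
9E1587C0:7C3395:6~01?A7~11?C4033>C~01?3>~02;?5~02?97~03:7=~03>1?~02C?3~05;2?~0397E03O5107I71097?
909?3=0;15G0?=;10A37=116A?11=F311>5C11E:7121?E1259G12K73141K714A3?1=;4;1B;3723=5A2==39339=<354A;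
35G453779>39?943=43A3==560737F0;6;;122K7123:G12:?;12G;216C:31:;?225C672635G2963C2;>3933;8>3;>563
=;660716G0:7?50??2513<>716=?21:?561B5671D27725;>5297=634?4;35?:439=663?4960:3=712=>3143:?14:?31:
9671>72956877~069;7~07;>1~07=;2~07?83~16E9312G;20716G~0C774~03O5107I71122K7~0G5363683=~116A?~0O1
17~11>5C~03O51~121?E~1259G27879~07I71~1259G~0C7=1~0G1?1~12O15~07M13~11E:712K73333D:1D2770:77914:
?3~1153N~0937>~11=F3~11?C4~0E13?~11C=6~11E:7~136?8~141K7~143:?~12K73~0C?15~0;15G157::~0739E395:6
~157::~123:G~1635I~235A=233B=1B56735C4612=>313<6;~14A3?~12G;2~16E93~16I35~136K2~0397E2975:~1768;
~137:B~172>9~174;:~1:C55~136G4~17D1;~171>A1;61>~157B6~171>A~0?1?2~12=>3~1B795~1B;37333D:1B567~1B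
567~13<6;~13>3<~14:?3~1B;37~131E>~1;51F~17:2=~035=C0397E097?90=5;;187;=18;5?1:?;31<57?1=7:91A56;
2==393967?3=43A1:67?1:;?2287;;2963C29;;62;>393<76;0:7?50;67=0?7>10??2515?6:16=?21<6?31??4225=;62
97=634?4;~1K5431633J~1E6721>729~051O3~035=C~0397E~155K2~35C46~235A=~0:3=7~23=5A~1G952~2493?~1?;2
4~1M253~0;25?~25A;523B;5~0739E~0:779~1:796~1;27<~25A;5~2835?~1:967~1>729~17B2;~13=3D~2963C~1=32>
~0A37=~3=43A~1=:72~1?782~2A759~1792E~25=3:~26=93~0G935~0K355~3478;~3649;~1K543~1587C~2=34;~343>9
~345;:~16C:3~354A;~1758C~3683=~0?936~37<38~1963E~197A6~3;55@~39A65~0?3<3~1A56;~2777A3A5:53A9473C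
467~3A5:5~3A947~487;7~0:7?5~097?909?3=149?;35G450737F25C672635G0;67=14;6?56877~0;67=~097?90=5;;0
;6;;287;;3?496~0;6;;3?496~0?=;1149?;12:?;14;6?~0?=;1~14;6?~149?;~0?7>1~187;=~18;5?~1:?56~13<>7~2
5;>5~1:?;3~29;;61??4225=;6297=6~1:;?20??25~1>9=3~15?6:~1=7:917<7:~1=;4;34?4;~39=66~1:;?2~097?9~0
9?3=~16=?2~1??42~297=6~29;=5~0=5;;~29;;6~25?87~2=997~2==39~339=<~358;=~33;8>~199>7~19?5:~2;>39~1
<6?3~39?94~1=7:9~1=97:~1=;4;~35?:4~1?4;9~1?85;~3=9;4~3=;85~3;:;4~0;6;;~1;:7:~59:5;~579:9~596;9~5
6877~16=76~1F557~1G762~25C67~25E57~2635G~1775D~35E74~35G45~2777A~2775B~575@7~15=?61>=750??6313>?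
6235?>~235?>~15=?60??63~15?<734;>7~3<76;~1<57?~1>=75~1>?27~2=7:7~2=5?5~15=?6~15?<7~1>7>3~35<5?~1
7<=7~375<=~3=;66~3==56~3?:47~3>47;~0:?77~2?4;7~558?7~3779>~3796?~4;57=~3967?~47;5=~577=8~1G;23~1
33B?~1K372~1C27;~0;G33~13;6C~2;53C~0C;73~335C:~173;B~239;?~1;>3;~0773G~3A776~273=?~29?77~33=7>~1
;6?7~477;;~57;7:~11C;719?3;57;5;159?71=57;1597;~11C;7131C?1G9331C;33~131C?~11;G31397C1G9331735E1
597;1973=~1397C1739C1G5531973=~11;G3~11C;7~1397C1973=~1597;~1397C~1K353359;5~1A37;~1G933~1K353~1
739C~3;53A~11?=7~159?7~19?3;~339;=~57;5;~577;9~1773E~197?7~373==~1;?33~3773A~3739?~39777~5777;~3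
777?"%string)].

Definition functionals41 : seq (seq expo) :=
  [seq fives r | r <- blocks (digits
"39?77~3=?73~331M533A5=53A97711I771A1?73A=1139=?719=;515??53=?571=7=3;1?;3;93?7;9;3G317737?1?753?
;77?93;375??137??37=3?71?3~1731M1M7315739A7531I9535C973A5=7C11?53A1A5?31A=371A=71397;59;539==5;1
;=53=7=5779=?751?5;559?33;;7;933735G5773C;?375?57;37777=~1@>73@9673A=623C8671C<4338=>33;<>310>?7
54<?374?>715>>356<?718>5779>765<8777<?473=:675=<727=>437=?661><573?<761C:723::?33B67732?>37:;677
;?6276?767E95331=?39997799=53;=9?31E57715?5791;73CA?333I37337973?~231L723A4?331N433A6<53A:663A<3
711J671A2>72A87730H773@0?73A>0139>>329<?719>:738<;43=>7534>?61=6?705>?72=>573<6=23?7>327?>62;?76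
3:7?63??2722??72?;6736?:73>3>517=?53?=571?5=333K533C3=73C;113;;?3;3=;3;;1?71;;;7;;9353C77713G7G3
3577973?7?5;3?7;17?;537~0>G310F;710F?130N3531F?301N3701N7128631G8737@8771B9633D:635A;671@@67;1@6
;53@>335@?730A6;70A6?12A>352B>711<639;<7;38<?31:=63;8>6;19?>318:775<<673=<73?4<7796=675:>63=5>77
=0>7?14>?354?6794:73;:6733F;637>>7;72?63?2?6;36>67775731I=73A19739==7;55;7;1;7735C=77;3??371~0>7
C12=63A4:73A@6739A8637A=623C<433J5631L27310?6;92<7;98:7;58;63=9<6;3:873=<;6;1>87;1>9639D7635F473
50<77?1>67=4<7?34=67;5<63?5>6?16=6;57<6798>5779>765<?473=<727=>437=?661><573?<761C:723;:63;G6633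
2?6?33>6;76:77;;?6276?767E95339=53;1=7?55?579A?333;97;3C57373;77=~31H7631J4733E86353@>35B96370A>
3710N3A0?63A2<7712A>7130N71A:67301N73@87;71@6?13@6?30A6?310F319>>338<?39<;639>873;9<63=8:7;1:=6;
1<:7;90>735D673=6=6714>?75;<6778=6795>67;4<7;54?6;56<7336?>372>?37?:63?3>673>;677::77;2?6;37>6?3
2>7355=?75=977=1=7?15=731;;?3;;97;39;733G5737A7771C77~31I6633H4735C86371@>37@963A1>63C0<7713@>71
B96730A>7310N?31@631:=>31<:?390>?39=:63;<87798:7;1;<6;38=671D67354?>356<?3=7<63?4=675<;675>87779
<6796=67=0?67=2<7;55>6;74<7?14?6?16<7?50>73;:;6;3::733F7637B67337>>3?6:7732>?73?:67;3>6;72?63=99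
7;1=97;91=735E57715=?31K373A3;7339;?73A7777;97~631E:63=3@63?0A6792A6;17@6;34A6;51B6?10C6K7106O13
06O301733D8771@:7;70@7?12@>316A>350C>C530>C701>G121?352@F3?10F7930F7;01F;350F;521F?112G?300N3170
N3341N3512N7103O3700O71206399>73;8<>?;10?318>6775@635?<637<=671>=6758?775:<7794>633B;>333B63;6?6
73;>737>:73?2>7;36>735A9?711A7;19=73=5=739;;731G777;1?~631D;633A<63;5@63=2A6791B6;16A6;50C6G;106
K5306K7016O121731F8735@:77;0@7;52@>315B>C350>C521>G112?334@?710B?G300F3=30F3?01F7921F;170F;341F;
512F?103G;700G?120N3161N3503O35206398?739:<7;18>>;?10>?930>?;016757@6774AF7750635>=671=>73=4>773
<<6;33B>332CN3332637;>673:?7776>7?11A?351AO71117759=733C97793?7;35?~4631K5633H8673A<63A3=63C0863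
9?873?88779:87;3<8?31>963;<:63=9:6;1=:7?18:?358;6798;>31<<7;;0<>339<?392>6;91>?;10?>3904737D4771
F6635E6775@7671D9675>:77=4<67;5<6;57<7?52<?734=67=2=6;74=6?16=>356>>715?6?502733J:73C2;6;3:7637B
673;>:677;:7;76;63?6>6?33>>373?>7321731M5739A973A5=7C1197;59=?7519?33;;7;933735G5773C;7?35~11F>3
11N271A6:721L732A4?32A<3730D?330L3731N613@4;73A6>13A>25@9763A8727A:437A;661A?423B8573C:471C<5230
<?;31>>;1887?388?378=?239:6?19:>359<7:39>4;39?>21:<=33;><31@4777A66750=6?72=>753<6?54:?754>5?34?
?615<>735>7>16>=71<:577<?563=:765?>561C>2332:7?72??273>7:76;6?36;>377?6:3:;767>>373?;627>7677A=7
13597?55=5;77==35=?751?95753;?;1;;5;3C3775C7537?57;3~2=6C12=72A2?43A4:7C16963A8673AA8727A:437A?4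
23B5639C<523D2739E9623G8433J5721J7431N16310:7;=0?7:91<6;;2>5;98;72=9863?9<7:39=62;9>4;3:96;5::53
=;<43;<;7:1=86;3>9729>:5;1>;439D7725E4637F65350=6?73<6?54877?4=76;4>5?35:67=5>7>15?6696<57;6=7:5
6?4;57>479:=477;=665<67;5<:577<?563=:765?>561C>2332:7?72;67?2?7>33>7:73?62?>>373A=7133=57=597?55
=5;77=5?1=?751397;;G1737?57;37777=~1A>633@<73A9627B9473C8437C96610=>;33<>;1896?389>379=6:3:=<33;
86?1;8>35;<4;3;=>21@5677C46750>5?70??651>7>52>=75487?74;>754=?274?4?35:6?55<7:75>4;75?6>15?>2568
?756<5?36<=376=?616?<717<7>17><358?567;>565<9767<;477=?427>=563?8765?:475?<527??4612:?;3:;?23;:7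
:3B2777B7763C67272;6?73?6:77:>73:67?3:6?37:>377>?273?>2371?=;19;5?19;=35A75753=5?55==739?755==71
7?=75131C?331K373A3;7A;337C;371C;713C?1339?3;3;?;31"%string)].

Definition inverse41 : seq (seq bool) :=
  [seq [seq N.eqb x 1 | x <- r] | r <- blocks (digits
"0010110101100001~0000111010000110~0110011101001000~1011010000000000~0001101000111001~10100011111
00011~1001101100111001~0111011000111111~0110100111010110~0110100011011001~1110011100101001~01101
00111111001~0011000000000000~0110000000000000~1000000000000000~0100000000000000"%string)].

Definition dual18 : seq expo := fives (digits
"111>1112=11439118351114;112591185311169111871129511493111:5111<314535143551145712555145531165511
4751123;12339183331293311:3312393112;313635127351235716353136531336515363117631127712375173332"%string).

(* Weight vectors all of whose monomials are hit. *)
Definition low18 : seq (seq N) := [:: [:: 0]; [:: 2; 0]]%num.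
Definition low41 : seq (seq N) :=
  [:: [:: 1]; [:: 3; 1]; [:: 5; 0]; [:: 3; 3; 0]; [:: 5; 2; 0]; [:: 5; 0; 1]]%num.

Definition xi18_list := ltac:(let t := eval unfold xi18 in xi18 in
  match t with poly_of ?s => exact [seq expo_of_tuple x | x <- s] end).
Definition xi41_list := ltac:(let t := eval unfold xi41 in xi41 in
  match t with poly_of ?s => exact ([seq add_double (Expo 1 1 1 1 1) z | z <- xi18_list] ++
    [seq expo_of_tuple x | x <- s]) end).

(** * From the checks to the two quotients *)

Lemma not_hit n A l : (n < 64)%N -> all (fun z => edeg_nat z == n) l ->
  functional_ok false n A -> odd (count (fun z => tmem (encode z) (ptrie l)) A) ->
  ~ hit (psum 'F_2 l).
Proof.
move=> n64 /allP dl okA oddA /hitP/(funct_hits addF2 n64 okA)/eqP.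
have vl : all valid l.
  by apply/allP => y /dl /eqP hy; rewrite /valid edegE -/(edeg_nat y) hy.
have /andP[/allP dA _] := okA; rewrite (_ : funct A _ = 1) ?oner_eq0 //.
rewrite -[RHS]/(true%:R) -oddA -(natr_odd addF2) -sum1_count big_mkcond natr_sum /funct.
rewrite big_seq [RHS]big_seq; apply: eq_bigr => y /dA /eqP hy.
rewrite (coef_psum_mem addF2 vl); first by case: (tmem _ _).
by rewrite /valid edegE -/(edeg_nat y) hy.
Qed.

(** Translation to the quotient: in characteristic two, equality of the classes of f and g means
    that f + g is hit. *)
Lemma Q_line n (h : P5) (hn : h \is n.-homog) :
  (forall g, hit (act g h + h)) ->
  (forall f, f \is n.-homog -> (forall g, hit (act g f + f)) ->
     exists c, hit (f + c *: h)) ->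
  forall q : Q n, GL5_invariant q <-> exists c : 'F_2, q = c *: cls (DHomog hn).
Proof.
have sub2 (x y : P5) : x - y = x + y.
  by congr (_ + _); apply/eqP; rewrite eq_sym -addr_eq0 (mpoly_addxx addF2).
move=> hh line q; have [f ->] : exists f : P5deg n, q = cls f.
  by eexists; apply/esym/clsK.
split=> [invq|[c ->] g]; last first.
  rewrite -clsZ actQ_cls; apply/cls_eqP/hit_predP.
  by rewrite raddfB /= Defs.actZ -scalerBr sub2; apply: hitZ.
have [||c hc] := line f; first exact: dhomog_is_dhomog.
  move=> g; have := invq g; rewrite actQ_cls => /cls_eqP/hit_predP.
  by rewrite raddfB /= sub2.
by exists c; rewrite -clsZ; apply/cls_eqP/hit_predP; rewrite raddfB /= sub2.
Qed.

Lemma xi18E : xi18 = psum 'F_2 xi18_list.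
Proof. exact: poly_ofE. Qed.

Lemma xi41E : phi xi18 + xi41 = psum 'F_2 xi41_list.
Proof. by rewrite psum_cat -phi_psum -xi18E -poly_ofE. Qed.

Fact low18_ok sh : all (low_ok sh 18) low18.
Proof. by case: sh; vm_cast_no_check isT. Qed.

Fact red18_ok : red_check 18 low18 base18 relations18.
Proof. vm_cast_no_check isT. Qed.

Fact functionals18_ok : all (functional_ok true 18) functionals18.
Proof. vm_cast_no_check isT. Qed.

Fact matrix18_ok : matrix_check functionals18 inverse18 base18.
Proof. vm_cast_no_check isT. Qed.

Fact transvection_cert18_ok : hit_cert false 18 low18 transvection_cert18
  (foldr (expand (lin_opts (col_vars transvection)) 0) xi18_list xi18_list).
Proof. vm_cast_no_check isT. Qed.

Fact cycle_cert18_ok : hit_cert false 18 low18 cycle_cert18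
  (foldr (expand (lin_opts (col_vars cycle5)) 0) xi18_list xi18_list).
Proof. vm_cast_no_check isT. Qed.

Fact dual18_ok : functional_ok false 18 dual18 &&
  odd (count (fun z => tmem (encode z) (ptrie xi18_list)) dual18).
Proof. vm_cast_no_check isT. Qed.

Fact xi18_list_deg : all (fun z => edeg_nat z == 18) xi18_list.
Proof. vm_cast_no_check isT. Qed.

Fact low41_ok sh : all (low_ok sh 41) low41.
Proof. by case: sh; vm_cast_no_check isT. Qed.

Fact red41_ok : red_check 41 low41 base41 relations41.
Proof. vm_cast_no_check isT. Qed.

Fact functionals41_ok : all (functional_ok true 41) functionals41.
Proof. vm_cast_no_check isT. Qed.

Fact matrix41_ok : matrix_check functionals41 inverse41 base41.
Proof. vm_cast_no_check isT. Qed.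

Fact transvection_cert41_ok : hit_cert false 41 low41 transvection_cert41
  (foldr (expand (lin_opts (col_vars transvection)) 0) xi41_list xi41_list).
Proof. vm_cast_no_check isT. Qed.

Fact cycle_cert41_ok : hit_cert false 41 low41 cycle_cert41
  (foldr (expand (lin_opts (col_vars cycle5)) 0) xi41_list xi41_list).
Proof. vm_cast_no_check isT. Qed.

(** The functional of [dual18] composed with Kameko's homomorphism, which sends x_1...x_5 u^2 to u
    for each monomial u and all other monomials to 0. *)
Definition dual41 := [seq add_double (Expo 1 1 1 1 1) z | z <- dual18].

Fact dual41_ok : functional_ok false 41 dual41 &&
  odd (count (fun z => tmem (encode z) (ptrie xi41_list)) dual41).
Proof. vm_cast_no_check isT. Qed.

Fact xi41_list_deg : all (fun z => edeg_nat z == 41) xi41_list.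
Proof. vm_cast_no_check isT. Qed.

Fact transvection_unit : bit_mul transvection transvection == bit_id.
Proof. by []. Qed.

Fact cycle5_unit : bit_mul cycle5 (iter 3 (bit_mul cycle5) cycle5) == bit_id.
Proof. by []. Qed.

Theorem theorem2p6 :
  (forall q : Q 18,
     GL5_invariant q <-> exists c : 'F_2, q = c *: cls (DHomog xi18_homog)) /\
  (forall q : Q 41,
     GL5_invariant q <->
     exists c : 'F_2, q = c *: cls (DHomog phi_xi18_xi41_homog)).
Proof.
have inv18 g : hit (act g xi18 + xi18).
  rewrite xi18E; apply: fixes_all; apply: (@cert_fixes _ _ 18).
  - by [].
  - exact: low18_ok.
  - exact: transvection_unit.
  - exact: transvection_cert18_ok.
  - by [].
  - exact: low18_ok.
  - exact: cycle5_unit.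
  exact: cycle_cert18_ok.
have inv41 g : hit (act g (phi xi18 + xi41) + (phi xi18 + xi41)).
  rewrite xi41E; apply: fixes_all; apply: (@cert_fixes _ _ 41).
  - by [].
  - exact: low41_ok.
  - exact: transvection_unit.
  - exact: transvection_cert41_ok.
  - by [].
  - exact: low41_ok.
  - exact: cycle5_unit.
  exact: cycle_cert41_ok.
split; apply: Q_line => //.
  apply: (invariant_line _ (low18_ok true) red18_ok functionals18_ok matrix18_ok) => //.
    exact: xi18_homog.
  have /andP[ok1 ok2] := dual18_ok.
  by rewrite xi18E; apply: (not_hit _ xi18_list_deg ok1 ok2).
apply: (invariant_line _ (low41_ok true) red41_ok functionals41_ok matrix41_ok) => //.
  exact: phi_xi18_xi41_homog.
have /andP[ok1 ok2] := dual41_ok.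
by rewrite xi41E; apply: (not_hit _ xi41_list_deg ok1 ok2).
Qed.
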